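(* Let $d\ge 1$, $R>0$, $s,s',r_1,r_2\in\mathbb{R}$ with $r_1-d/2>s$, and let $t>s$ and $t'>s'$. Suppose one observes $\{(u_i,f_i)\}_{i=1}^N$ with $f_i=\mathcal{A}u_i+w_i$, $1\le i\le N$, where $\mathcal{A}\in\mathcal{O}(s,s',R)$ is unknown, $u_1,\dots,u_N$ are i.i.d. $\mathcal{GP}(0,(I-\Delta)^{-r_1})$, $w_1,\dots,w_N$ are i.i.d. $\mathcal{GP}(0,(I-\Delta)^{-r_2})$, and the two sequences are independent. Then there is a constant $c>0$, depending only on $d,s,s',r_1,r_2,t,t',R$, such that for all $N\ge1$ $$ \inf_{\widehat{\mathcal{A}}}\ \sup_{\mathcal{A}\in\mathcal{O}(s,s',R)}\ \mathbb{E}\,\|\widehat{\mathcal{A}}-\mathcal{A}\|_{H^t\to H^{-t'}}\ \ge\ c\, N^{-\min\left\{\frac12,\ \frac{t-s}{2(r_1-s)+d},\ \frac{t'-s'}{(2(-r_2-s')+d)_+}\right\}}, $$ where the infimum is over all measurable estimators based on $\{(u_i,f_i)\}_{i=1}^N$ and the expectation is under the law of the data generated with true operator $\mathcal{A}$.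
   Context: Work on the torus $\mathbb{T}^d=(\mathbb{R}/\mathbb{Z})^d$. For $a\in\mathbb{R}$, $H^a=H^a(\mathbb{T}^d)$ is the usual $L^2$-based Sobolev space; the dual of $H^a$ is identified with $H^{-a}$ through the $L^2$ pairing $\langle\cdot,\cdot\rangle$. For a linear operator $\mathcal{A}$, $\|\mathcal{A}\|_{H^a\to H^{-b}}:=\sup\{|\langle \mathcal{A}w,v\rangle| : \|w\|_{H^a}\le 1,\ \|v\|_{H^b}\le 1\}$. The operator class is $\mathcal{O}(s,s',R):=\{\mathcal{A}\in\mathcal{L}(H^s,H^{-s'}):\|\mathcal{A}\|_{H^s\to H^{-s'}}\le R\}$, where $\mathcal{L}(H^s,H^{-s'})$ is the space of bounded linear operators. $\mathcal{GP}(0,(I-\Delta)^{-r})$ denotes the centered Gaussian field (random distribution) on $\mathbb{T}^d$ with covariance operator $(I-\Delta)^{-r}$; it belongs almost surely to $H^\alpha$ for every $\alpha<r-d/2$. Since $r_1-d/2>s$, $\mathcal{A}u_i\in H^{-s'}$ is well defined almost surely; the equation $f_i=\mathcal{A}u_i+w_i$ is understood in the sense of distributions. Conventions: $a_+:=\max\{a,0\}$ and $a/0:=+\infty$ for $a>0$. *)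

(* Defs.v *)
From HB Require Import structures.
From mathcomp Require Import all_boot all_order all_algebra.
From mathcomp Require Import all_classical all_reals all_analysis.

Set Implicit Arguments.
Unset Strict Implicit.
Unset Printing Implicit Defensive.

Import Order.TTheory GRing.Theory Num.Theory.
Import numFieldNormedType.Exports.

Local Open Scope classical_set_scope.
Local Open Scope ring_scope.

Section test_functions.
Context {R : realType} {d : nat}.
Implicit Types (f g : 'rV[R]_d -> R) (l : seq 'I_d) (k : 'rV[int]_d).

(* Functions on (R/Z)^d are 1-periodic functions on R^d. *)
Definition partial l f : 'rV[R]_d -> R :=
  foldr (fun i g => 'D_(delta_mx 0 i) g) f l.

Definition smooth f := forall l,
  continuous (partial l f) /\
  forall i x, derivable (partial l f) x (delta_mx 0 i).

Definition torus_smooth : {pred 'rV[R]_d -> R} :=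
  [pred f | `[< smooth f /\ forall i, periodic f (delta_mx 0 i) >]].

Lemma partialD l f g a : smooth f -> smooth g ->
  partial l (a *: f + g) = a *: partial l f + partial l g.
Proof.
move=> sf sg; elim: l => [//|i l IH] /=; rewrite IH; apply/funext => x.
have df := (sf l).2 i x; have dg := (sg l).2 i x.
by rewrite deriveD ?deriveZ//; exact: derivableZ.
Qed.

Lemma torus_smooth_submod : submod_closed torus_smooth.
Proof.
split=> [|a f g].
  apply/asboolP; split=> // l.
  suff -> : partial l 0 = cst 0.
    split=> [x|i x].
      exact: (@cst_continuous _ _ (0 : R)).
    exact: derivable_cst.
  elim: l => //= i l ->; apply/funext => x; exact: derive_cst.
move=> /asboolP[sf pf] /asboolP[sg pg]; apply/asboolP; split=> [l|i x].
  rewrite partialD//; split=> [x|i x].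
    exact: (cvgD (@cvgMl_tmp R _ _ _ _ a _ ((sf l).1 x)) ((sg l).1 x)).
  by apply: derivableD; [apply: derivableZ; exact: (sf l).2|exact: (sg l).2].
by rewrite /GRing.add /= /GRing.scale /= pf pg.
Qed.

HB.instance Definition _ := GRing.isSubmodClosed.Build R ('rV[R]_d -> R)
  torus_smooth torus_smooth_submod.

Definition freq k (x : 'rV[R]_d) : R := 2 * pi * \sum_i (k 0 i)%:~R * x 0 i.

Lemma freqD k x y : freq k (x + y) = freq k x + freq k y.
Proof.
rewrite /freq; under eq_bigr do rewrite mxE mulrDr.
by rewrite big_split /= mulrDr.
Qed.

Lemma freqZ k a x : freq k (a *: x) = a * freq k x.
Proof.
rewrite /freq; under eq_bigr do rewrite mxE mulrCA.
by rewrite -mulr_sumr mulrCA.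
Qed.

Lemma freq_delta k i : freq k (delta_mx 0 i) = 2 * pi * (k 0 i)%:~R.
Proof.
rewrite /freq (bigD1 i)//= big1 => [|j ji]; first by rewrite mxE !eqxx mulr1 addr0.
by rewrite mxE (negbTE ji) andbF mulr0.
Qed.

Lemma continuous_freq k : continuous (freq k).
Proof.
have h i : xpredT i -> continuous (fun x : 'rV[R]_d => (k 0 i)%:~R * x 0 i).
  move=> _ x; exact: (@cvgMl_tmp R _ _ _ _ _ _ (@coord_continuous _ _ _ 0 i x)).
have hs := @continuous_big R 'I_d +%R 0 xpredT (@add_continuous R) _
  (index_enum 'I_d) _ h.
move=> x; exact: (@cvgMl_tmp R _ _ _ _ (2 * pi) _ (hs x)).
Qed.

Let wave k (a b : R) (x : 'rV[R]_d) : R := a * cos (freq k x + b).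

Let is_derive_wave k a b v (x : 'rV[R]_d) :
  is_derive x v (wave k a b) (wave k (a * freq k v) (b + pi / 2) x).
Proof.
pose g (h : R) := wave k a b (h *: v + x).
have dg : is_derive (0 : R) (1 : R) g (wave k (a * freq k v) (b + pi / 2) x).
  have -> : g = (fun h : R => a * cos (h * freq k v + (freq k x + b))).
    by apply/funext => h; rewrite /g /wave freqD freqZ addrA.
  apply: is_derive_eq.
  rewrite /wave (addrA (freq k x)) cosDpihalf.
  rewrite mul0r add0r scaler0 add0r addr0 /GRing.scale /= mulr1.
  by rewrite -mulrA (mulrC (freq k v)).
have dvg : derivable (wave k a b) x v.
  by apply/derivable1P; exact: (@ex_derive _ _ _ _ _ _ _ dg).
apply: DeriveDef dvg _; rewrite -(@derive_val _ _ _ _ _ _ _ dg).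
have e : (fun h : R => h^-1 *: ((wave k a b \o shift x) (h *: v) - wave k a b x)) =
    (fun h : R => h^-1 *: ((g \o shift 0) (h *: 1) - g 0)).
  by apply/funext => h /=; rewrite /g /= scale0r add0r addr0 [h%:A]mulr1.
by rewrite /derive e.
Qed.

Let partial_wave k a b l : exists a' b', partial l (wave k a b) = wave k a' b'.
Proof.
elim: l => [|i l [a' [b' /= ->]]]; first by exists a, b.
exists (a' * freq k (delta_mx 0 i)), (b' + pi / 2).
by apply/funext => x; exact: (@derive_val _ _ _ _ _ _ _ (is_derive_wave _ _ _ _ _)).
Qed.

Let wave_torus_smooth k a b : wave k a b \in torus_smooth.
Proof.
apply/asboolP; split=> [l|i x].
  have [a' [b' ->]] := partial_wave k a b l; split=> [x|i x]; last first.
    exact: (@ex_derive _ _ _ _ _ _ _ (is_derive_wave _ _ _ _ _)).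
  have h : cos (freq k z + b') @[z --> x] --> cos (freq k x + b').
    apply: (@continuous_comp _ _ _ (fun z => freq k z + b') cos).
      exact: (@cvgD R R _ _ _ _ _ _ _ (@continuous_freq k x) (cvg_cst b')).
    exact: continuous_cos.
  exact: (@cvgMl_tmp R _ _ _ _ a' _ h).
rewrite /wave freqD freq_delta addrAC; congr (_ * _).
set y := freq k x + b; clearbody y.
have cosn n z : cos (z + 2 * pi * n%:R) = cos z :> R.
  have -> : 2 * pi * n%:R = pi *+ 2 *+ n :> R by rewrite mulr_natr mulr_natl.
  exact: (periodicn (@cosD2pi R)).
case: (k 0 i) => n; first exact: cosn.
by rewrite NegzE rmorphN mulrN -[LHS](cosn n.+1) subrK.
Qed.

Definition cosk_fun k (x : 'rV[R]_d) : R := cos (freq k x).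
Definition sink_fun k (x : 'rV[R]_d) : R := sin (freq k x).

Lemma cosk_subproof k : cosk_fun k \in torus_smooth.
Proof.
suff -> : cosk_fun k = wave k 1 0 by [].
by apply/funext => x; rewrite /cosk_fun /wave mul1r addr0.
Qed.

Lemma sink_subproof k : sink_fun k \in torus_smooth.
Proof.
suff -> : sink_fun k = wave k 1 (- (pi / 2)) by [].
by apply/funext => x; rewrite /sink_fun /wave mul1r cosBpihalf.
Qed.

End test_functions.

Record testfun (R : realType) (d : nat) := TestFun {
  testfun_fun :> 'rV[R]_d -> R;
  testfunP : testfun_fun \in torus_smooth }.

Section testfun_structure.
Context {R : realType} {d : nat}.
HB.instance Definition _ := [isSub for @testfun_fun R d].
HB.instance Definition _ := [Choice of testfun R d by <:].
HB.instance Definition _ := [SubChoice_isSubLmodule of testfun R d by <:].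
End testfun_structure.

Definition cosk {R : realType} {d : nat} (k : 'rV[int]_d) : testfun R d :=
  TestFun (cosk_subproof k).
Definition sink {R : realType} {d : nat} (k : 'rV[int]_d) : testfun R d :=
  TestFun (sink_subproof k).

Section distributions.
Context {R : realType} {d : nat}.
Local Notation test := (testfun R d).

Definition is_linear_form (u : test -> R) :=
  forall a (phi psi : test), u (a *: phi + psi) = a * u phi + u psi.

(* Continuity for the Frechet topology of C^oo, i.e., u is bounded by a
   multiple of a C^m norm; B ranges over the upper bounds of that norm. *)
Definition finite_order (u : test -> R) := exists C (m : nat), forall (phi : test) B,
  (forall l : seq 'I_d, (size l <= m)%N -> forall x, `|partial l phi x| <= B) ->
  `|u phi| <= C * B.

Definition distribution_pred : {pred test -> R} :=
  [pred u | `[< is_linear_form u /\ finite_order u >]].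

Lemma distribution_submod : submod_closed distribution_pred.
Proof.
split=> [|a u v].
  apply/asboolP; split=> [b phi psi|]; first by rewrite mulr0 addr0.
  exists 0, 0%N => phi B _.
  by rewrite mul0r normr_le0.
move=> /asboolP[lu [C [m Cu]]] /asboolP[lv [D [n Dv]]]; apply/asboolP; split.
  move=> b phi psi.
  have E w : (a *: u + v) w = a * u w + v w by [].
  by rewrite !E lu lv !mulrDr mulrCA -!addrA; congr (_ + _); rewrite addrCA.
exists (`|a| * C + D), (maxn m n) => phi B hB.
apply: (le_trans (ler_normD _ _)); rewrite mulrDl lerD//.
  rewrite normrM -mulrA ler_wpM2l// Cu// => l lm; apply: hB.
  by rewrite (leq_trans lm)// leq_maxl.
by apply: Dv => l ln; apply: hB; rewrite (leq_trans ln)// leq_maxr.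
Qed.

HB.instance Definition _ := GRing.isSubmodClosed.Build R (test -> R)
  distribution_pred distribution_submod.

End distributions.

Record dist (R : realType) (d : nat) := Dist {
  dist_fun :> testfun R d -> R;
  distP : dist_fun \in distribution_pred }.

Section dist_structure.
Context {R : realType} {d : nat}.
HB.instance Definition _ := [isSub for @dist_fun R d].
HB.instance Definition _ := [Choice of dist R d by <:].
HB.instance Definition _ := [SubChoice_isSubLmodule of dist R d by <:].
HB.instance Definition _ := isPointed.Build (dist R d) 0.

Definition dist_cylinder : set (set (dist R d)) :=
  [set A | exists (phi : testfun R d) (B : set R),
     measurable B /\ A = [set u : dist R d | B (u phi)]].

HB.instance Definition _ := @isMeasurable.Build (sigma_display dist_cylinder)
  (dist R d) <<s dist_cylinder >> (@sigma_algebra0 _ setT dist_cylinder)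
  (@sigma_algebraC _ dist_cylinder)
  (@sigma_algebra_bigcup _ setT dist_cylinder).

End dist_structure.

Section sobolev.
Context {R : realType} {d : nat}.
Implicit Types (k l : 'rV[int]_d) (u v w : dist R d) (a b : R).
Local Notation D' := (dist R d).

(* The complex Fourier coefficient u (exp (- 2 i pi k . x)) of the real
   distribution u is (reF u k) + i (imF u k). *)
Definition reF u k : R := u (cosk k).
Definition imF u k : R := - u (sink k).

(* Eigenvalue of I - Delta on exp (2 i pi k . x). *)
Definition symbol k : R := 1 + 4 * pi ^+ 2 * \sum_i (k 0 i)%:~R ^+ 2.

Definition sobolev_norm a u : \bar R :=
  sqrte (\esum_(k in [set: 'rV[int]_d])
    (symbol k `^ a * (reF u k ^+ 2 + imF u k ^+ 2))%:E).

Definition sobolev a : set D' := [set u | (sobolev_norm a u < +oo)%E].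

(* Sum over Z^d of an absolutely summable real family. *)
Definition zsum (F : 'rV[int]_d -> R) : R :=
  fine (\esum_(k in [set: 'rV[int]_d]) (Num.max (F k) 0)%:E) -
  fine (\esum_(k in [set: 'rV[int]_d]) (Num.max (- F k) 0)%:E).

(* Extension to H^(-a) x H^a of the L^2 scalar product (Parseval). *)
Definition pairing u v : R :=
  zsum (fun k => reF u k * reF v k + imF u k * imF v k).

Definition opnorm a b (A : D' -> D') : \bar R :=
  ereal_sup [set `|pairing (A w) v|%:E | w in [set w | (sobolev_norm a w <= 1)%E]
                                       & v in [set v | (sobolev_norm b v <= 1)%E]].

(* L(H^a, H^(-b)): only the restriction of A to H^a is relevant. *)
Definition bounded_operator a b (A : D' -> D') :=
  [/\ forall w, sobolev a w -> sobolev (- b) (A w),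
      forall x v w, sobolev a v -> sobolev a w -> A (x *: v + w) = x *: A v + A w
    & (opnorm a b A < +oo)%E].

Definition operator_class a b (rad : R) : set (D' -> D') :=
  [set A | bounded_operator a b A /\ (opnorm a b A <= rad%:E)%E].

(* Application of A in L(H^a, H^(-b)) to a distribution that is in H^a only
   almost surely; the value 0 off H^a is a convention. *)
Definition apply_on a (A : D' -> D') u : D' :=
  if `[< sobolev a u >] then A u else 0.

End sobolev.

Section gaussian.
Context {R : realType}.

Fixpoint iter_integral n : ('rV[R]_n -> \bar R) -> \bar R :=
  match n with
  | 0 => fun F => F 0
  | m.+1 => fun F => (\int[lebesgue_measure]_x
      iter_integral (fun y : 'rV_m => F (row_mx (x%:M : 'rV_1) y)))%E
  end.

Definition gaussian_density n (S : 'M[R]_n) (x : 'rV[R]_n) : R :=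
  expR (- (x *m invmx S *m x^T) 0 0 / 2) / Num.sqrt ((2 * pi) ^+ n * \det S).

(* Centered square integrable random vectors: if the covariance matrix is
   singular, Y is almost surely supported by a hyperplane, so that its law is
   determined by those of the subfamilies with nonsingular covariance. *)
Definition gaussian_vector d (T : measurableType d) (P : probability T R) n
    (Y : 'I_n -> T -> R) :=
  (forall i, Y i \in Lfun P 2%:E /\ ('E_P[Y i] = 0)%E) /\
  let S := \matrix_(i, j) fine ('E_P[fun o => (Y i o * Y j o)%R])%E in
  S \in unitmx ->
  forall B : 'I_n -> set R, (forall i, measurable (B i)) ->
    P [set o | forall i, B i (Y i o)] =
    iter_integral (fun x => ((\prod_i \1_(B i) (x 0 i)) * gaussian_density S x)%:E).

Variable dim : nat.

(* The covariance operator is given by its matrix in the orthonormal basis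
   (exp (2 i pi k . x))_k, i.e., the Fourier coefficients satisfy
   E[F(k) conj (F(l))] = <(I - Delta)^(-r) e_l, e_k>; the last two clauses are
   the real and imaginary parts of this identity. *)
Definition gaussian_field d (T : measurableType d) (P : probability T R) (r : R)
    (X : T -> dist R dim) :=
  [/\ measurable_fun setT X,
      forall n (phi : 'I_n -> testfun R dim),
        gaussian_vector P (fun i o => X o (phi i)),
      forall k l,
        ('E_P[fun o => (reF (X o) k * reF (X o) l + imF (X o) k * imF (X o) l)%R] =
         ((k == l)%:R * symbol k `^ (- r))%:E)%E
    & forall k l,
        ('E_P[fun o => (imF (X o) k * reF (X o) l - reF (X o) k * imF (X o) l)%R] =
         0)%E].

End gaussian.

Definition mutually_independent {R : realType} d (T : measurableType d)
    (P : probability T R) d' (D : measurableType d') (I : finType)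
    (X : I -> T -> D) :=
  forall B : I -> set D, (forall i, measurable (B i)) ->
    P [set o | forall i, B i (X i o)] = (\prod_i P (X i @^-1` B i))%E.

Section minimax.
Context {R : realType} {dim N : nat}.
Local Notation D' := (dist R dim).

Definition iid_gaussian_design d (T : measurableType d) (P : probability T R)
    (r1 r2 : R) (u w : 'I_N -> T -> D') :=
  [/\ forall i, gaussian_field P r1 (u i),
      forall i, gaussian_field P r2 (w i)
    & mutually_independent P
        (fun i : 'I_N + 'I_N => match i with inl j => u j | inr j => w j end)].

Definition observations (s : R) (A : D' -> D') T (u w : 'I_N -> T -> D') (o : T) :
    N.-tuple (D' * D') :=
  [tuple (u i o, apply_on s A (u i o) + w i o) | i < N].

(* Weak operator measurability. *)
Definition estimator (t t' : R) : set (N.-tuple (D' * D') -> D' -> D') :=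
  [set Ahat | (forall z, bounded_operator t t' (Ahat z)) /\
    forall h v, sobolev t h -> sobolev t' v ->
      measurable_fun setT (fun z => pairing (Ahat z h) v)].

Definition minimax_risk d (T : measurableType d) (P : probability T R)
    (u w : 'I_N -> T -> D') (s s' t t' rad : R) : \bar R :=
  ereal_inf [set ereal_sup [set
      (\int[P]_o opnorm t t' (fun h => Ahat (observations s A u w o) h - A h)%R)%E
    | A in operator_class s s' rad] | Ahat in estimator t t'].

End minimax.

(* In \bar R, x%:E / 0 = +oo for x > 0, and the minimum is finite. *)
Definition rate_exponent {R : realType} (d : nat) (s s' r1 r2 t t' : R) : R :=
  fine (Order.min (2^-1)%:E (Order.min
    ((t - s) / (2 * (r1 - s) + d%:R))%:E
    ((t' - s')%:E / (Num.max (2 * (- r2 - s') + d%:R) 0)%:E))%E).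

(* Main.v *)
Require Import Defs.
From HB Require Import structures.
From mathcomp Require Import all_boot all_order all_algebra.
From mathcomp Require Import ring lra.
From mathcomp Require Import all_classical all_reals all_analysis.
From mathcomp Require Import measurable_realfun.

(** The bound holds because the data do not determine the signs of many small
    entries of the operator, and an error on these signs is visible in the
    loss.

    Let [J] be a finite set of indices. To each sign pattern [th] corresponds an
    operator that maps the coefficient of the input at the frequency [kk j] to
    [a * th j] times the wave of frequency [ll j], for all [j] in [J]
    ([hyp_op]). Either the [kk j] are distinct up to sign and all [ll j] are
    zero, or the converse. Three conditions fix the amplitude [a] and the
    number of indices.
    - The class: the squared operator norm is at most [#|J| * a ^+ 2] divided
      by powers of the symbols ([hyp_op_class]).
    - The loss: testing the error against waves with optimal signs bounds the
      operator norm from below by a multiple [lam] of the sum of the absolute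
      errors on the entries ([opnorm_ge_entries]).
    - The data: flipping one sign moves the noise along a wave by a multiple of
      the input coefficient. Since a wave is a Cameron-Martin direction of the
      noise ([wave_shift]), both laws have densities with respect to the law of
      the noise alone, and the loss on this entry is at least a multiple of
      [a] for one of the two signs, unless the expected sum of the squared
      signals is large ([two_point], [signal_energy]).

    As in Assouad's lemma, averaging over all sign patterns turns these
    two-point bounds into a lower bound [3 / 32 * (lam * a * #|J|)] of the
    minimax risk ([minimax_lower]).

    The three rates come from three choices. A single index on the constant
    mode gives [N ^ (- 1 / 2)] ([parametric_rate]). For the others [J] has
    [M ^ d] elements, with frequencies of size [M]: the high modes are those of
    the input ([input_rate]), which is smooth, or those of the output
    ([noise_rate]), where the noise is rough. The data hide the signs as long
    as [N <= M ^ (2 (r - s) + d)] and the risk is then of order [M ^ (s - t)]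
    ([box_rate]), with [(s', t', - r2)] instead of [(s, t, r1)] in the second
    case.

    The Gaussian fields are given by the laws of their values on finitely many
    test functions, so the Cameron-Martin formula is proved from these. The
    direction [eta] dual to a variable [w chi] of unit variance is the
    covariance [phi |-> E (w phi * w chi)], which is a distribution
    ([field_cov_finite_order]). The residual [w - w chi *: eta] is uncorrelated
    with [w chi], hence independent of it ([gaussian_indep], where degenerate
    covariances are reduced to invertible ones), and translating [w] along
    [eta] only translates a one-dimensional Gaussian variable
    ([cameron_martin]). For a wave [chi], that [eta] is a multiple of a wave follows from
    the uniqueness of Fourier coefficients ([dist_fourier_inj]), proved with
    Fejer means; the averages that they involve are limits of Riemann sums
    along an ultrafilter ([mean]). *)

Set Implicit Arguments.
Unset Strict Implicit.
Unset Printing Implicit Defensive.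

Import Order.TTheory GRing.Theory Num.Theory.
Import numFieldNormedType.Exports.

Local Open Scope classical_set_scope.
Local Open Scope ring_scope.

(** * Calculus of test functions on the torus *)

Section test_function_calculus.
Context {R : realType} {d : nat}.
Implicit Types (f g : testfun R d) (F G : 'rV[R]_d -> R) (x z : 'rV[R]_d).
Local Notation e i := (delta_mx 0 i : 'rV[R]_d).

Lemma testfun_eq f g : (forall x, f x = g x) -> f = g.
Proof. by move=> h; apply/val_inj/funext. Qed.

Lemma testfun_smooth f : smooth f.
Proof. by have /asboolP[] := testfunP f. Qed.

Lemma testfun_periodic f i x : f (x + e i) = f x.
Proof. by have /asboolP[_ /(_ i x)] := testfunP f. Qed.

Lemma testfun_continuous f : continuous f.
Proof. exact: (testfun_smooth f [::]).1. Qed.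

Lemma testfun_derivable f i x : derivable f x (e i).
Proof. exact: (testfun_smooth f [::]).2. Qed.

Lemma testfun_derive_subproof f i : (fun x => 'D_(e i) f x) \in torus_smooth.
Proof.
apply/asboolP; split=> [l|j x].
  suff -> : partial l (fun x => 'D_(e i) f x) = partial (rcons l i) f.
    exact: (testfun_smooth f (rcons l i)).
  by rewrite /partial foldr_rcons.
rewrite /derive; set q1 := fun h => _; set q2 := fun h => _.
suff -> : q1 = q2 by [].
by apply/funext => h; rewrite /q1 /q2 /= addrA !testfun_periodic.
Qed.

Definition tderiv i f : testfun R d := TestFun (testfun_derive_subproof f i).

Lemma partial_rcons l i f : partial (rcons l i) f = partial l (tderiv i f).
Proof. by rewrite /partial foldr_rcons. Qed.

(** All the ways to distribute the derivatives [l] over two factors, as in the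
    Leibniz rule. *)
Fixpoint splits (l : seq 'I_d) : seq (seq 'I_d * seq 'I_d) :=
  if l is i :: l' then
    [seq (i :: p.1, p.2) | p <- splits l'] ++
    [seq (p.1, i :: p.2) | p <- splits l']
  else [:: ([::], [::])].

Let dsum F G (s : seq (seq 'I_d * seq 'I_d)) :=
  \sum_(p <- s) (partial p.1 F * partial p.2 G).

Let is_derive_dsum F G s i x : smooth F -> smooth G ->
  is_derive x (e i) (dsum F G s)
    (dsum F G ([seq (i :: p.1, p.2) | p <- s] ++
      [seq (p.1, i :: p.2) | p <- s]) x).
Proof.
move=> sF sG; elim: s => [|p s IH].
  rewrite /dsum !big_nil; exact: is_derive_cst.
rewrite /dsum /= big_cons -cat_cons !big_cat !big_cons /=.
have dF : is_derive x (e i) (partial p.1 F) (partial (i :: p.1) F x).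
  by apply: derivableP; exact: (sF p.1).2.
have dG : is_derive x (e i) (partial p.2 G) (partial (i :: p.2) G x).
  by apply: derivableP; exact: (sG p.2).2.
move: IH; rewrite /dsum big_cat /= => IH.
apply: is_derive_eq; rewrite /GRing.scale /=.
have E (A B : 'rV[R]_d -> R) : (A + B) x = A x + B x by [].
have E' (A B : 'rV[R]_d -> R) : (A * B) x = A x * B x by [].
rewrite !E !E' -!/(_ + _) /=; ring.
Qed.

Lemma partialM F G l : smooth F -> smooth G ->
  partial l (F * G) = \sum_(p <- splits l) (partial p.1 F * partial p.2 G).
Proof.
move=> sF sG; elim: l => [|i l IH]; first by rewrite /= big_seq1.
apply/funext => x; rewrite /= IH.
exact: (@derive_val _ _ _ _ _ _ _ (is_derive_dsum (splits l) i x sF sG)).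
Qed.

Lemma smoothM F G : smooth F -> smooth G -> smooth (F * G).
Proof.
move=> sF sG l; rewrite partialM//; split=> [|i x]; last first.
  exact: (@ex_derive _ _ _ _ _ _ _ (is_derive_dsum (splits l) i x sF sG)).
elim: (splits l) => [|p s IH] x.
  rewrite big_nil; exact: (@cst_continuous _ _ (0 : R)).
rewrite big_cons.
exact: (cvgD (cvgM ((sF p.1).1 x) ((sG p.2).1 x)) (IH x)).
Qed.

Lemma testfun_mul_subproof f g : ((f : _ -> R) * g) \in torus_smooth.
Proof.
apply/asboolP; split=> [|i x]; first exact: smoothM (testfun_smooth f) (testfun_smooth g).
have E' (A B : 'rV[R]_d -> R) y : (A * B) y = A y * B y by [].
by rewrite !E' !testfun_periodic.
Qed.

Definition tmul f g : testfun R d := TestFun (testfun_mul_subproof f g).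

Lemma tmulE f g x : tmul f g x = f x * g x. Proof. by []. Qed.
Lemma testfunD f g x : (f + g) x = f x + g x. Proof. by []. Qed.
Lemma testfunZ a f x : (a *: f) x = a * f x. Proof. by []. Qed.
Lemma testfunN f x : (- f) x = - f x.
Proof. by []. Qed.
Lemma testfun0 x : (0 : testfun R d) x = 0. Proof. by []. Qed.

Lemma testfun_sum (I : Type) (r : seq I) (P : pred I) (h : I -> testfun R d) x :
  (\sum_(i <- r | P i) h i) x = \sum_(i <- r | P i) h i x.
Proof. by elim/big_ind2: _ => // a b c c' <- <-. Qed.

Lemma tderivD i f g : tderiv i (f + g) = tderiv i f + tderiv i g.
Proof.
apply: testfun_eq => x; rewrite testfunD /=.
by rewrite deriveD//; exact: testfun_derivable.
Qed.

Lemma tderivZ i a f : tderiv i (a *: f) = a *: tderiv i f.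
Proof.
apply: testfun_eq => x; rewrite testfunZ /=.
by rewrite deriveZ//; exact: testfun_derivable.
Qed.

Lemma tderivM i f g :
  tderiv i (tmul f g) = tmul f (tderiv i g) + tmul g (tderiv i f).
Proof.
apply: testfun_eq => x; rewrite testfunD /=.
by rewrite deriveM//; exact: testfun_derivable.
Qed.

Lemma testfun_periodic_int f (k : 'rV[int]_d) x :
  f (x + map_mx intr k) = f x.
Proof.
have per1 i (n : int) y : f (y + n%:~R *: e i) = f y.
  have pern (m : nat) z : f (z + m%:R *: e i) = f z.
    elim: m z => [|m IH] z; first by rewrite scale0r addr0.
    by rewrite mulrSr scalerDl scale1r addrA testfun_periodic IH.
  case: n => n; first exact: pern.
  rewrite NegzE rmorphN scaleNr /= -[LHS](pern n.+1).
  by rewrite -addrA addNr addr0.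
have -> : map_mx intr k = \sum_i (k 0 i)%:~R *: e i.
  by rewrite [LHS]row_sum_delta; apply: eq_bigr => i _; rewrite mxE.
elim: (index_enum _) x => [|i s IH] x; first by rewrite big_nil addr0.
by rewrite big_cons addrA IH per1.
Qed.

(** By periodicity only the values on the unit cube, a compact set, matter. *)
Lemma testfun_bounded f : exists2 B, 0 <= B & forall x, `|f x| <= B.
Proof.
pose A := [set v : 'rV[R]_d | forall i, `[0%R, 1%R]%classic (v ord0 i)].
have cA : compact A.
  exact: (@rV_compact R d (fun=> `[0%R, 1%R]%classic) (fun=> @segment_compact R 0 1)).
have : compact (f @` A).
  apply: continuous_compact => //; apply: continuous_subspaceT => x.
  exact: testfun_continuous.
move=> /compact_bounded[M [_ hM]].
pose k x : 'rV[int]_d := map_mx (fun a => - Num.floor a) x.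
exists (Num.max (M + 1) 0); first by rewrite le_max lexx orbT.
move=> x; rewrite -(testfun_periodic_int f (k x)) le_max; apply/orP; left.
apply: (hM (M + 1)); first by rewrite ltrDl.
exists (x + map_mx intr (k x)) => // i /=.
have /andP[h1 h2] := real_floor_itv (num_real (x ord0 i)).
rewrite in_itv /= !mxE rmorphN /= subr_ge0 h1 lerBlDr addrC.
by move: h2; rewrite intrD => /ltW.
Qed.

Lemma testfun_mvt f i x (h : R) : exists2 y, `|y| <= `|h| &
  f (x + h *: e i) - f x = h * tderiv i f (x + y *: e i).
Proof.
pose g (y : R) := f (x + y *: e i).
have dg (y : R) : is_derive y (1 : R) g (tderiv i f (x + y *: e i)).
  have E : (fun h : R => h^-1 *: ((g \o shift y) (h *: 1) - g y)) =
      (fun h : R => h^-1 *: ((f \o shift (x + y *: e i)) (h *: e i) - f (x + y *: e i))).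
    apply/funext => u /=; rewrite /g /= [u *: 1]mulr1 scalerDl.
    by rewrite addrCA.
  have df := @testfun_derivable f i (x + y *: e i).
  have dd : derivable g y (1 : R) by rewrite /derivable E; exact: df.
  by apply: DeriveDef => //; rewrite /= /derive E.
have cg : continuous g.
  move=> y; apply/differentiable_continuous/derivable1_diffP.
  exact: (@ex_derive _ _ _ _ _ _ _ (dg y)).
have g0 : g 0 = f x by rewrite /g scale0r addr0.
have [h0|h0] := leP 0 h.
  have [c] := MVT_segment h0 (fun y _ => dg y) (continuous_subspaceT cg).
  rewrite in_itv /= => /andP[c0 ch]; rewrite subr0 g0 mulrC => E.
  by exists c => //; rewrite !ger0_norm.
have [c] := MVT_segment (ltW h0) (fun y _ => dg y) (continuous_subspaceT cg).
rewrite in_itv /= => /andP[c0 ch]; rewrite sub0r g0 mulrN mulrC => E.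
exists c; first by rewrite !ler0_norm ?lerN2 // ltW.
by apply: oppr_inj; rewrite opprB.
Qed.

Lemma testfun_lipschitz f : exists2 L, 0 <= L &
  forall x z, `|f (x + z) - f x| <= L * \sum_i `|z 0 i|.
Proof.
have /choice[B hB] : forall i : 'I_d, exists b : R,
    0 <= b /\ forall x, `|tderiv i f x| <= b.
  by move=> i; have [b b0 hb] := testfun_bounded (tderiv i f); exists b.
have B0 i : 0 <= B i by have [] := hB i.
exists (\sum_i B i); first exact: sumr_ge0.
have BL i : B i <= \sum_i B i by rewrite (bigD1 i)//= lerDl sumr_ge0.
set L := \sum_i B i in BL *; clearbody L.
move=> x z; rewrite [z in f (x + z)]row_sum_delta.
elim: (index_enum _) => [|i s IH].
  by rewrite !big_nil addr0 subrr normr0 mulr0.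
rewrite !big_cons; set S := \sum_(j <- s) _ *: _ in IH *.
rewrite mulrDr (addrC (_ *: _)) addrA.
apply: (le_trans (ler_distD (f (x + S)) _ _)); apply: lerD => //.
have [y _ ->] := testfun_mvt f i (x + S) (z 0 i).
by rewrite normrM mulrC ler_wpM2r// (le_trans ((hB i).2 _)).
Qed.

End test_function_calculus.

(** * An invariant mean on test functions *)

Section invariant_mean.
Context {R : realType} {d : nat}.
Implicit Types (f g : testfun R d) (x z : 'rV[R]_d) (n : nat).
Local Notation e i := (delta_mx 0 i : 'rV[R]_d).

Definition grid_point n (a : 'rV['I_n.+1]_d) : 'rV[R]_d :=
  map_mx (fun j : 'I_n.+1 => (j : nat)%:R / n.+1%:R) a.

Definition grid_mean n (F : 'rV[R]_d -> R) : R :=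
  #|{: 'rV['I_n.+1]_d}|%:R^-1 * \sum_(a : 'rV['I_n.+1]_d) F (grid_point a).

Let cardgt0 n : 0 < #|{: 'rV['I_n.+1]_d}|%:R :> R.
Proof. by rewrite ltr0n; apply/card_gt0P; exists 0. Qed.

Lemma grid_mean_le n F B : (forall x, `|F x| <= B) -> `|grid_mean n F| <= B.
Proof.
move=> hB; rewrite normrM gtr0_norm ?invr_gt0// mulrC ler_pdivrMr//.
apply: (le_trans (ler_norm_sum _ _ _)).
apply: (@le_trans _ _ (\sum_(a : 'rV['I_n.+1]_d) B)); first exact: ler_sum.
by rewrite sumr_const mulr_natr.
Qed.

Lemma grid_meanP n a f g :
  grid_mean n (a *: f + g) = a * grid_mean n f + grid_mean n g.
Proof.
rewrite /grid_mean mulrCA -mulrDr; congr (_ * _).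
by rewrite mulr_sumr -big_split.
Qed.

Lemma grid_mean_shift n f i :
  grid_mean n (fun x => f (x + n.+1%:R^-1 *: e i)) = grid_mean n f.
Proof.
rewrite /grid_mean; congr (_ * _).
pose inc : 'rV['I_n.+1]_d := \row_j if j == i then inZp 1 else 0.
rewrite [RHS](reindex_inj (addIr inc)) /=; apply: eq_bigr => a _.
have incE : (inZp 1 : 'I_n.+1) = (1 %% n.+1)%N :> nat by [].
have n0 : n.+1%:R != 0 :> R by rewrite pnatr_eq0.
have [an|an] := ltnP (a 0 i) n.
  congr (testfun_fun f); apply/rowP => j; rewrite !mxE /=.
  have [->|ji] := eqVneq j i.
    rewrite incE modnDmr modn_small ?addn1 ?ltnS//.
        by rewrite mulr1 -[X in _ + X]mul1r -mulrDl natr1.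
  by rewrite mulr0 addr0 /= addn0 modn_small.
have {}an : (a 0 i : nat) = n.
  by apply/eqP; rewrite eqn_leq an andbT -ltnS ltn_ord.
rewrite -[RHS](testfun_periodic f i); congr (testfun_fun f); apply/rowP => j; rewrite !mxE /=.
have [->|ji] := eqVneq j i.
  rewrite incE modnDmr addn1 an modnn mul0r add0r mulr1.
  by rewrite -[X in _ + X]mul1r -mulrDl natr1 divff.
by rewrite mulr0 !addr0 /= addn0 modn_small.
Qed.

(** The mean of a derivative is, up to O(1/n), the mean of a difference
    quotient over one grid step, which vanishes by invariance of the grid. *)
Lemma grid_mean_deriv f i :
  exists L : R, forall n, `|grid_mean n (tderiv i f)| <= L / n.+1%:R.
Proof.
have [L L0 hL] := testfun_lipschitz (tderiv i f).
exists L => n; pose h : R := n.+1%:R^-1.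
have h0 : 0 < h by rewrite invr_gt0 ltr0n.
pose G x := tderiv i f x - h^-1 * (f (x + h *: e i) - f x).
have -> : grid_mean n (tderiv i f) = grid_mean n G.
  rewrite {2}/grid_mean /G sumrB -mulr_sumr sumrB mulrBr (mulrCA _ h^-1) mulrBr.
  rewrite -!/(grid_mean n _).
  have := grid_mean_shift n f i; rewrite /grid_mean => ->.
  by rewrite subrr mulr0 subr0.
apply: grid_mean_le => x; rewrite /G.
have [y yh ->] := testfun_mvt f i x h.
rewrite mulrA mulVf ?gt_eqF// mul1r distrC.
apply: (le_trans (hL _ _)); rewrite ler_wpM2l//.
rewrite (bigD1 i)//= big1 => [|j ji]; last first.
  by rewrite !mxE eqxx (negbTE ji) mulr0 normr0.
by rewrite !mxE !eqxx mulr1 addr0 (le_trans yh)// gtr0_norm.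
Qed.

(** Along an ultrafilter every bounded sequence of grid means converges, so
    that linearity, positivity and invariance pass to the limit. *)
Definition free_ultrafilter : set_system nat :=
  projT1 (cid (ultraFilterLemma eventually_filter)).

#[local] Instance free_ultrafilterP : UltraFilter free_ultrafilter.
Proof. by rewrite /free_ultrafilter; case: cid => ? []. Qed.

Lemma free_ultrafilter_ge : \oo `<=` free_ultrafilter.
Proof. by rewrite /free_ultrafilter; case: cid => ? []. Qed.

Definition mean f : R := lim (grid_mean n f @[n --> free_ultrafilter]).

Lemma mean_cvg f : grid_mean n f @[n --> free_ultrafilter] --> mean f.
Proof.
have [B B0 hB] := testfun_bounded f.
have := @segment_compact R (- B) B; rewrite compact_ultra => cB.
have UF : UltraFilter (grid_mean n f @[n --> free_ultrafilter]).
  split=> [|G GF sG]; first exact: fmap_proper_filter.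
  apply/seteqP; split=> [A GA|]; last exact: sG.
  have [//|nA] := in_ultra_setVsetC (grid_mean ^~ f @^-1` A) free_ultrafilterP.
  exfalso; have : G (A `&` ~` A) by apply: filterI => //; exact: (sG (~` A)).
  by rewrite setICr; exact: filter_not_empty.
have [|p [_ pf]] := cB _ UF.
  apply: (@filterS _ free_ultrafilter _ setT) filterT => n _ /=.
  by rewrite in_itv /=; have := grid_mean_le n hB; rewrite ler_norml.
by apply/cvg_ex; exists p.
Qed.

Lemma meanP a f g : mean (a *: f + g) = a * mean f + mean g.
Proof.
apply: cvg_lim => //.
under eq_cvg do rewrite grid_meanP.
exact: (cvgD (cvgMl_tmp (@mean_cvg f)) (@mean_cvg g)).
Qed.

Lemma mean_ge0 f : (forall x, 0 <= f x) -> 0 <= mean f.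
Proof.
move=> f0; apply: (cvgr_to_ge (@mean_cvg f)); apply: nearW => n; rewrite /grid_mean mulr_ge0 ?invr_ge0//.
exact: sumr_ge0.
Qed.

Lemma mean_const f c : (forall x, f x = c) -> mean f = c.
Proof.
move=> fc; apply: cvg_lim => //.
suff -> : (fun n => grid_mean n f) = fun=> c by exact: cvg_cst.
apply/funext => n; rewrite /grid_mean (eq_bigr (fun=> c))// sumr_const.
by rewrite -[c *+ _]mulr_natl mulKf// gt_eqF.
Qed.

Lemma mean_tderiv i f : mean (tderiv i f) = 0.
Proof.
apply: cvg_lim => //.
have [L hL] := grid_mean_deriv f i.
apply: (@cvg_trans _ (grid_mean n (tderiv i f) @[n --> \oo])).
  by move=> A; exact: free_ultrafilter_ge.
apply: norm_cvg0.
apply: (@squeeze_cvgr _ _ _ _ (fun=> 0) (fun n => L * harmonic n)).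
- by near=> n; rewrite normr_ge0 /= hL.
- exact: cvg_cst.
- by rewrite -(mulr0 L); apply: cvgMl_tmp; exact: cvg_harmonic.
Unshelve. all: by end_near. Qed.

Lemma mean0 : mean 0 = 0. Proof. exact: (mean_const (@testfun0 R d)). Qed.
Lemma meanD f g : mean (f + g) = mean f + mean g.
Proof. by rewrite -{1}[f]scale1r meanP mul1r. Qed.
Lemma meanZ a f : mean (a *: f) = a * mean f.
Proof. by rewrite -[a *: f]addr0 meanP mean0 addr0. Qed.
Lemma mean_sum (I : Type) (r : seq I) (P : pred I) (h : I -> testfun R d) :
  mean (\sum_(i <- r | P i) h i) = \sum_(i <- r | P i) mean (h i).
Proof. exact: (big_morph mean meanD mean0). Qed.

End invariant_mean.

(** * Fejer approximation and uniqueness of Fourier coefficients *)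

Section fourier_uniqueness.
Context {R : realType} {d : nat}.
Implicit Types (f g : testfun R d) (x y z : 'rV[R]_d) (n : nat) (k : 'rV[int]_d).
Local Notation e i := (delta_mx 0 i : 'rV[R]_d).

Lemma freqNl k x : freq (- k) x = - freq k x.
Proof.
rewrite /freq -mulrN; congr (_ * _); rewrite -sumrN.
by apply: eq_bigr => i _; rewrite mxE rmorphN mulNr.
Qed.

Lemma freqDl k l x : freq (k + l) x = freq k x + freq l x.
Proof.
rewrite /freq -mulrDr; congr (_ * _); rewrite -big_split.
by apply: eq_bigr => i _; rewrite mxE rmorphD mulrDl.
Qed.

Lemma freq0l x : freq 0 x = 0.
Proof. by rewrite /freq big1 ?mulr0// => i _; rewrite mxE mul0r. Qed.

Lemma coskE k x : cosk k x = cos (freq k x). Proof. by []. Qed.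
Lemma sinkE k x : sink k x = sin (freq k x). Proof. by []. Qed.

Lemma coskN k : cosk (- k) = cosk k :> testfun R d.
Proof. by apply: testfun_eq => x; rewrite !coskE freqNl cosN. Qed.

Lemma sinkN k : sink (- k) = - sink k :> testfun R d.
Proof. by apply: testfun_eq => x; rewrite testfunN !sinkE freqNl sinN. Qed.

Let derive_line (F : 'rV[R]_d -> R) v x (g : R -> R) (dg : R) :
  (forall h, F (h *: v + x) = g h) -> is_derive (0 : R) (1 : R) g dg ->
  'D_v F x = dg.
Proof.
move=> Fg dgP; rewrite -(@derive_val _ _ _ _ _ _ _ dgP) /derive.
set q1 := fun h => _; set q2 := fun h => _; suff -> : q1 = q2 by [].
apply/funext => h; rewrite /q1 /q2 /= addr0 -!Fg scale0r add0r.
by rewrite [h *: 1]mulr1.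
Qed.

Lemma tderiv_cosk i k :
  tderiv i (cosk k) = - (2 * pi * (k 0 i)%:~R) *: sink k :> testfun R d.
Proof.
apply: testfun_eq => x; rewrite testfunZ sinkE /=.
apply: (@derive_line _ _ _ (fun h => cos (h * freq k (e i) + freq k x))) => [h|].
  by rewrite /cosk_fun freqD freqZ.
apply: is_derive_eq; rewrite freq_delta /GRing.scale /=.
by rewrite mul0r !add0r mulr1 addr0; ring.
Qed.

Lemma tderiv_sink i k :
  tderiv i (sink k) = (2 * pi * (k 0 i)%:~R) *: cosk k :> testfun R d.
Proof.
apply: testfun_eq => x; rewrite testfunZ coskE /=.
apply: (@derive_line _ _ _ (fun h => sin (h * freq k (e i) + freq k x))) => [h|].
  by rewrite /sink_fun freqD freqZ.
apply: is_derive_eq; rewrite freq_delta /GRing.scale /=.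
by rewrite mul0r !add0r mulr1 addr0; ring.
Qed.

Lemma meanB f g : mean (f - g) = mean f - mean g.
Proof. by rewrite meanD -(scaleN1r g) meanZ mulN1r. Qed.

Lemma tderivB i f g : tderiv i (f - g) = tderiv i f - tderiv i g.
Proof. by rewrite tderivD -(scaleN1r g) tderivZ scaleN1r. Qed.

Lemma mean_by_parts i f g : mean (tmul f (tderiv i g)) = - mean (tmul g (tderiv i f)).
Proof.
by have := mean_tderiv i (tmul f g); rewrite tderivM meanD => /eqP; rewrite addr_eq0 => /eqP.
Qed.

(** Orthogonal projection on the waves of frequency [k]: since a derivative
    has mean zero, it commutes with differentiation. *)
Definition wave_part k f : testfun R d :=
  mean (tmul (cosk k) f) *: cosk k + mean (tmul (sink k) f) *: sink k.

Lemma tmulZl a f g : tmul (a *: f) g = a *: tmul f g.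
Proof. by apply: testfun_eq => x; rewrite tmulE !testfunZ tmulE mulrA. Qed.
Lemma tmulZr a f g : tmul f (a *: g) = a *: tmul f g.
Proof. by apply: testfun_eq => x; rewrite tmulE !testfunZ tmulE mulrCA. Qed.
Lemma tmulDl f g h : tmul (f + g) h = tmul f h + tmul g h.
Proof. by apply: testfun_eq => x; rewrite testfunD !tmulE testfunD mulrDl. Qed.
Lemma tmulDr f g h : tmul f (g + h) = tmul f g + tmul f h.
Proof. by apply: testfun_eq => x; rewrite testfunD !tmulE testfunD mulrDr. Qed.
Lemma tmulC f g : tmul f g = tmul g f.
Proof. by apply: testfun_eq => x; rewrite !tmulE mulrC. Qed.
Lemma tmul_suml (I : Type) (r : seq I) (P : pred I) (h : I -> testfun R d) g :
  tmul (\sum_(i <- r | P i) h i) g = \sum_(i <- r | P i) tmul (h i) g.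
Proof.
apply: testfun_eq => x; rewrite testfun_sum tmulE testfun_sum mulr_suml.
by apply: eq_bigr.
Qed.

Lemma tderiv_wave_part i k f : tderiv i (wave_part k f) = wave_part k (tderiv i f).
Proof.
rewrite /wave_part tderivD !tderivZ.
rewrite (mean_by_parts i (cosk k)) (mean_by_parts i (sink k)).
rewrite tderiv_cosk tderiv_sink.
rewrite !tmulZr !meanZ (tmulC f (sink k)) (tmulC f (cosk k)) addrC !scalerA.
by rewrite mulNr opprK mulrN [in RHS]mulrC [X in - X]mulrC.
Qed.

Definition nat_freq n (a : 'rV['I_n.+1]_d) : 'rV[int]_d :=
  map_mx (fun j : 'I_n.+1 => (j : nat)%:Z) a.

Let box n : R := #|{: 'rV['I_n.+1]_d}|%:R.

Let box_gt0 n : 0 < box n.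
Proof. by rewrite ltr0n; apply/card_gt0P; exists 0. Qed.

(** The mean of [f], over the frequencies of a box, of its partial Fourier sums;
    unlike those, it is the convolution with a nonnegative kernel. *)
Definition fejer n f : testfun R d :=
  (box n)^-1 *: \sum_(a : 'rV['I_n.+1]_d) \sum_(b : 'rV['I_n.+1]_d)
    wave_part (nat_freq a - nat_freq b) f.

(** The wave of frequency [k] and phase [0] at [x]: [y |-> cos (k.(x - y))]. *)
Definition centered_wave k x : testfun R d :=
  cosk k x *: cosk k + sink k x *: sink k.

Definition fejer_kernel n x : testfun R d :=
  (box n)^-1 *: \sum_(a : 'rV['I_n.+1]_d) \sum_(b : 'rV['I_n.+1]_d)
    centered_wave (nat_freq a - nat_freq b) x.

Lemma centered_waveE k x y : centered_wave k x y = cos (freq k (x - y)).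
Proof.
by rewrite /centered_wave testfunD !testfunZ !coskE !sinkE freqD -scaleN1r freqZ mulN1r cosB.
Qed.

Lemma fejerE n f x : fejer n f x = mean (tmul (fejer_kernel n x) f).
Proof.
rewrite /fejer /fejer_kernel testfunZ tmulZl meanZ; congr (_ * _).
rewrite testfun_sum tmul_suml mean_sum; apply: eq_bigr => a _.
rewrite testfun_sum tmul_suml mean_sum; apply: eq_bigr => b _.
rewrite /wave_part /centered_wave testfunD !testfunZ tmulDl meanD !tmulZl !meanZ.
by rewrite mulrC [X in _ + X]mulrC.
Qed.

(** The double sum over [(a, b)] is the square of the modulus of a sum of waves. *)
Lemma fejer_kernel_ge0 n x y : 0 <= fejer_kernel n x y.
Proof.
rewrite /fejer_kernel testfunZ mulr_ge0 ?invr_ge0 ?(ltW (box_gt0 n))//.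
rewrite testfun_sum; set z := x - y.
pose c (a : 'rV['I_n.+1]_d) := cos (freq (nat_freq a) z).
pose s (a : 'rV['I_n.+1]_d) := sin (freq (nat_freq a) z).
suff -> : \sum_(a : 'rV['I_n.+1]_d) (\sum_(b : 'rV['I_n.+1]_d)
    centered_wave (nat_freq a - nat_freq b) x) y =
    (\sum_a c a) ^+ 2 + (\sum_a s a) ^+ 2 by rewrite addr_ge0 ?sqr_ge0.
rewrite !expr2 !mulr_suml -big_split; apply: eq_bigr => a _ /=.
rewrite testfun_sum !mulr_sumr -big_split; apply: eq_bigr => b _.
by rewrite centered_waveE freqDl freqNl cosB.
Qed.

Lemma tderiv_fejer i n f : tderiv i (fejer n f) = fejer n (tderiv i f).
Proof.
have td0 : tderiv i 0 = 0 :> testfun R d.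
  by rewrite -[0 in LHS](scale0r (0 : testfun R d)) tderivZ scale0r.
rewrite /fejer tderivZ; congr (_ *: _).
rewrite (big_morph _ (tderivD i) td0); apply: eq_bigr => a _.
rewrite (big_morph _ (tderivD i) td0); apply: eq_bigr => b _.
exact: tderiv_wave_part.
Qed.

Lemma mean_cosk k : mean (cosk k : testfun R d) = (k == 0)%:R.
Proof.
have [->|k0] := eqVneq k 0.
  by apply: mean_const => x; rewrite coskE freq0l cos0.
have [i ki] : exists i, k 0 i != 0.
  by apply: contrapT => h; move/eqP: k0; apply; apply/rowP => i; rewrite mxE;
     apply/eqP/negPn/negP => ki; apply: h; exists i.
have := mean_tderiv i (sink k : testfun R d); rewrite tderiv_sink meanZ => /eqP.
rewrite !mulf_eq0 intr_eq0 (negbTE ki) orbF pnatr_eq0.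
by rewrite (gt_eqF (pi_gt0 R)) /= => /eqP.
Qed.

Lemma mean_sink k : mean (sink k : testfun R d) = 0.
Proof.
have [->|k0] := eqVneq k 0.
  by apply: mean_const => x; rewrite sinkE freq0l sin0.
have [i ki] : exists i, k 0 i != 0.
  by apply: contrapT => h; move/eqP: k0; apply; apply/rowP => i; rewrite mxE;
     apply/eqP/negPn/negP => ki; apply: h; exists i.
have := mean_tderiv i (cosk k : testfun R d); rewrite tderiv_cosk meanZ => /eqP.
rewrite !mulf_eq0 oppr_eq0 !mulf_eq0 intr_eq0 (negbTE ki) orbF pnatr_eq0.
by rewrite (gt_eqF (pi_gt0 R)) /= => /eqP.
Qed.

Lemma mean_centered_wave k x : mean (centered_wave k x) = (k == 0)%:R.
Proof.
rewrite /centered_wave meanD !meanZ mean_cosk mean_sink mulr0 addr0.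
have [->|] := eqVneq k 0; last by rewrite mulr0.
by rewrite coskE freq0l cos0 mulr1.
Qed.

Lemma nat_freq_inj n : injective (@nat_freq n).
Proof.
move=> a b /rowP ab; apply/rowP => j; apply/val_inj.
by have := ab j; rewrite !mxE => -[].
Qed.

Lemma mean_fejer_kernel n x : mean (fejer_kernel n x) = 1.
Proof.
rewrite /fejer_kernel meanZ mean_sum.
rewrite (eq_bigr (fun=> 1)) ?sumr_const ?mulVf ?gt_eqF// => a _.
rewrite mean_sum (bigD1 a)//= big1 ?addr0 => [|b ba].
  by rewrite subrr mean_centered_wave eqxx.
rewrite mean_centered_wave subr_eq0 (inj_eq (@nat_freq_inj n)).
by rewrite eq_sym (negbTE ba).
Qed.

Lemma card_last n i :
  #|[pred a : 'rV['I_n.+1]_d | a 0 i == ord_max]|%:R * n.+1%:R = box n.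
Proof.
pose N (c : 'I_n.+1) := \sum_(a : 'rV['I_n.+1]_d | a 0 i == c) (1 : R).
have N0 c : N c = N ord_max.
  pose inc : 'rV['I_n.+1]_d := \row_j if j == i then ord_max - c else 0.
  rewrite /N [RHS](reindex_inj (addIr inc)) /=; apply: eq_bigl => a.
  by rewrite !mxE eqxx -[LHS](inj_eq (addIr (ord_max - c))) [c + _]addrC subrK.
have -> : box n = \sum_(c : 'I_n.+1) N c.
  transitivity (\sum_(a : 'rV['I_n.+1]_d) (1 : R)); first by rewrite sumr_const.
  exact: (partition_big (fun a : 'rV['I_n.+1]_d => a 0 i) xpredT).
rewrite (eq_bigr _ (fun c _ => N0 c)) sumr_const card_ord mulr_natr.
by rewrite /N sumr_const.
Qed.

(** A pair [(a, b)] of the kernel contributes as soon as [b = a + e_i], and only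
    the frequencies [a] on one face of the box have no such partner [b]. *)
Lemma mean_fejer_kernel_cos n x i :
  1 - n.+1%:R^-1 <=
  mean (tmul (fejer_kernel n x) (centered_wave (delta_mx 0 i) x)).
Proof.
set u : 'rV[int]_d := delta_mx 0 i.
have prodE k : tmul (centered_wave k x) (centered_wave u x) =
    2^-1 *: (centered_wave (k + u) x + centered_wave (k - u) x).
  apply: testfun_eq => y; rewrite testfunZ testfunD tmulE !centered_waveE.
  by rewrite !freqDl freqNl cosD cosB; field.
have step (v : 'rV[int]_d) : v = u \/ v = - u ->
  box n - #|[pred a : 'rV['I_n.+1]_d | a 0 i == ord_max]|%:R <=
  \sum_(a : 'rV['I_n.+1]_d) \sum_(b : 'rV['I_n.+1]_d)
    (nat_freq a - nat_freq b + v == 0)%:R.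
  move=> vu.
  wlog -> : v {vu} / v = u.
    move=> W; case: vu => [->|->]; first exact: W.
    apply: (le_trans (W _ erefl)); rewrite exchange_big /=.
    apply: ler_sum => b _; apply: ler_sum => a _.
    by rewrite -oppr_eq0 !opprD !opprK addrC [- _ + _]addrC addrC.
  rewrite /box -!sumr_const [X in _ - X]big_mkcond /= -sumrB.
  apply: ler_sum => a _; rewrite inE.
  have [_|amax] := eqVneq (a 0 i) ord_max.
    by rewrite subrr; apply: sumr_ge0 => b _; exact: ler0n.
  have an : ((a 0%R i).+1 < n.+1)%N.
    by rewrite ltn_neqAle ltn_ord andbT eqSS; exact: amax.
  pose b : 'rV['I_n.+1]_d := \row_j if j == i then inord (a 0%R i).+1 else a 0 j.
  have nb : nat_freq a - nat_freq b + u = 0.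
    apply/rowP => j; rewrite !mxE /=.
    have [->|ji] := eqVneq j i; last by rewrite addr0 subrr.
    by rewrite inordK// intS opprD addrCA subrr addr0 addNr.
  rewrite subr0 (bigD1 b)//= nb eqxx lerDl.
  by apply: sumr_ge0 => c _; exact: ler0n.
rewrite /fejer_kernel tmulZl meanZ tmul_suml mean_sum.
set S := \sum_a _; have -> : S = 2^-1 * (\sum_(a : 'rV['I_n.+1]_d)
    \sum_(b : 'rV['I_n.+1]_d) (nat_freq a - nat_freq b + u == 0)%:R +
  \sum_(a : 'rV['I_n.+1]_d) \sum_(b : 'rV['I_n.+1]_d)
    (nat_freq a - nat_freq b + - u == 0)%:R).
  rewrite -big_split mulr_sumr; apply: eq_bigr => a _.
  rewrite -big_split mulr_sumr tmul_suml mean_sum; apply: eq_bigr => b _.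
  by rewrite prodE meanZ meanD !mean_centered_wave.
have h1 := step u (or_introl erefl); have h2 := step (- u) (or_intror erefl).
rewrite mulrC ler_pdivlMr//.
have n0 : n.+1%:R != 0 :> R by rewrite pnatr_eq0.
have -> : (1 - n.+1%:R^-1) * box n =
    box n - #|[pred a : 'rV['I_n.+1]_d | a 0 i == ord_max]|%:R.
  by rewrite mulrBl mul1r -[in LHS](card_last n i) mulrCA mulVf// mulr1 card_last.
move: h1 h2; set A := _ - _; set p := \sum_a _; set q := \sum_a _; lra.
Qed.

(** A point is, up to an integer, controlled by [1 - cos], which vanishes on
    the integers only. *)
Lemma dist_int_le_cos (dl : R) : 0 < dl -> exists2 C : R, 0 <= C &
  forall z : R, exists m : int, `|z - m%:~R| <= dl + C * (1 - cos (2 * pi * z)).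
Proof.
move=> dl0; pose D := Num.min dl (4^-1); have D0 : 0 < D by rewrite lt_min dl0 invr_gt0 ltr0n.
have Ddl : D <= dl by rewrite ge_min lexx.
have D4 : D <= 4^-1 by rewrite ge_min lexx orbT.
have p0 := pi_gt0 R.
pose c := 1 - cos (2 * pi * D).
have c0 : 0 < c.
  have : cos (2 * pi * D) < cos 0.
    rewrite ltr_cos; first by rewrite !mulr_gt0.
      by rewrite in_itv /=; apply/andP; split; nra.
    by rewrite in_itv /=; apply/andP; split; nra.
  by rewrite cos0 subr_gt0.
exists c^-1 => [|z]; first by rewrite invr_ge0 ltW.
have /andP[f1 f2] := real_floor_itv (num_real (z + 2^-1)).
set m := Num.floor _ in f1 f2; exists m.
have zm : `|z - m%:~R| <= 2^-1.
  by rewrite ler_norml; move: f1 f2; rewrite intrD; lra.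
have cosE : cos (2 * pi * z) = cos (2 * pi * `|z - m%:~R|).
  have -> : cos (2 * pi * `|z - m%:~R|) = cos (2 * pi * (z - m%:~R)).
    have [h|h] := leP 0 (z - m%:~R); first by rewrite ger0_norm.
    by rewrite ltr0_norm// mulrN cosN.
  have cosn (k : nat) (y : R) : cos (y + 2 * pi * k%:R) = cos y :> R.
    have -> : 2 * pi * k%:R = pi *+ 2 *+ k :> R by rewrite mulr_natr mulr_natl.
    exact: (periodicn (@cosD2pi R)).
  rewrite mulrBr; case: (m) => k; first by rewrite -[RHS](cosn k) subrK.
  by rewrite NegzE rmorphN mulrN opprK cosn.
rewrite cosE; set y := `|_| in zm *.
have y0 : 0 <= y by exact: normr_ge0.
have [yD|yD] := leP y D.
  apply: (le_trans yD); apply: (le_trans Ddl); rewrite lerDl; apply: mulr_ge0; first by rewrite invr_ge0 ltW.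
  by rewrite subr_ge0 cos_le1.
rewrite (le_trans zm)//.
have h : c <= 1 - cos (2 * pi * y).
  rewrite lerD2l lerN2 ltW// ltr_cos; first by rewrite ltr_pM2l ?mulr_gt0.
    by rewrite in_itv /=; apply/andP; split; nra.
  by rewrite in_itv /=; apply/andP; split; nra.
have : 1 <= c^-1 * (1 - cos (2 * pi * y)) by rewrite mulrC ler_pdivlMr ?mul1r.
lra.
Qed.

(** Korovkin's argument: [f x - f y] is small up to a multiple of
    [\sum_i (1 - cos (2 pi (x_i - y_i)))], whose mean against the kernel tends
    to zero. *)
Lemma fejer_cvg f (eps : R) : 0 < eps -> exists n0, forall n, (n0 <= n)%N ->
  forall x, `|fejer n f x - f x| <= eps.
Proof.
move=> eps0; have [L L0 hL] := testfun_lipschitz f.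
pose dl := eps / (2 * (L * d%:R + 1)).
have D0 : 0 < L * d%:R + 1 by rewrite ltr_wpDl ?mulr_ge0.
have dl0 : 0 < dl by rewrite divr_gt0 ?mulr_gt0.
have [C C0 hC] := dist_int_le_cos dl0.
have hF x y : `|f y - f x| <= L * d%:R * dl +
    L * C * \sum_(i < d) (1 - centered_wave (delta_mx 0 i) x y).
  have [m hm] : exists m : 'I_d -> int, forall i,
      `|(y - x) 0 i - (m i)%:~R| <= dl + C * (1 - centered_wave (delta_mx 0 i) x y).
    have /choice[m hm] : forall i : 'I_d, exists m : int,
        `|(y - x) 0 i - m%:~R| <= dl + C * (1 - cos (2 * pi * (y - x) 0 i)).
      by move=> i; exact: hC.
    exists m => i; apply: (le_trans (hm i)).
    have xyE : x - y = -1 *: (y - x) by rewrite scaleN1r opprB.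
    rewrite centered_waveE xyE freqZ mulN1r cosN /freq (bigD1 i)//= big1 => [|j ji].
      by rewrite [X in 2 * pi * (X%:~R * _ + _)]mxE !eqxx mul1r addr0.
    by rewrite mxE (negbTE ji) andbF mul0r.
  pose k : 'rV[int]_d := \row_i m i.
  have -> : f y = f (x + (y - x - map_mx intr k)).
    rewrite -[RHS](testfun_periodic_int f k); congr (testfun_fun f).
    by rewrite addrA subrK addrC subrK.
  apply: (le_trans (hL _ _)); rewrite -!mulrA -mulrDr ler_wpM2l//.
  have -> : d%:R * dl + C * \sum_(i < d) (1 - centered_wave (delta_mx 0 i) x y) =
      \sum_(i < d) (dl + C * (1 - centered_wave (delta_mx 0 i) x y)).
    by rewrite [RHS]big_split sumr_const card_ord -mulr_sumr mulr_natl.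
  by apply: ler_sum => i _; apply: le_trans (hm i); rewrite !mxE.
pose E := L * C * d%:R; have E0 : 0 <= E by rewrite !mulr_ge0.
exists (Num.truncn (2 * E / eps)).+1 => n nn x.
pose one : testfun R d := cosk 0.
have oneE y : one y = 1 by rewrite coskE freq0l cos0.
pose q : testfun R d := (L * d%:R * dl) *: one +
  (L * C) *: \sum_(i < d) (one - centered_wave (delta_mx 0 i) x).
have qE y : q y = L * d%:R * dl +
    L * C * \sum_(i < d) (1 - centered_wave (delta_mx 0 i) x y).
  rewrite /q testfunD !testfunZ oneE mulr1 testfun_sum; congr (_ + _ * _).
  by apply: eq_bigr => i _; rewrite testfunD testfunN oneE.
have tmul1 g : tmul g one = g by apply: testfun_eq => y; rewrite tmulE oneE mulr1.
set K := fejer_kernel n x.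
have K1 : mean K = 1 by exact: mean_fejer_kernel.
have K0 y : 0 <= K y by exact: fejer_kernel_ge0.
have KE g : fejer n g x = mean (tmul K g) by exact: fejerE.
have Kcos i : 1 - n.+1%:R^-1 <= mean (tmul K (centered_wave (delta_mx 0 i) x)).
  exact: mean_fejer_kernel_cos.
clearbody K.
have mq : mean (tmul K q) <= eps.
  rewrite /q tmulDr !tmulZr tmul1 meanD !meanZ. rewrite K1 mulr1.
  rewrite (tmulC K) tmul_suml mean_sum.
  apply: (@le_trans _ _ (L * d%:R * dl + L * C * \sum_(i < d) n.+1%:R^-1)).
    rewrite lerD2l ler_wpM2l ?mulr_ge0//; apply: ler_sum => i _.
    rewrite tmulC tmulDr tmul1 -scaleN1r tmulZr meanD meanZ K1.
    by rewrite mulN1r lerBlDr addrC -lerBlDr Kcos.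
  rewrite sumr_const card_ord -[_^-1 *+ d]mulr_natl (mulrA (L * C)) -/E.
  have -> : eps = eps / 2 + eps / 2 by lra.
  apply: lerD.
    have -> : L * d%:R * dl = eps / 2 * (L * d%:R / (L * d%:R + 1)).
      by rewrite /dl; field; rewrite gt_eqF.
    by rewrite ler_piMr ?divr_ge0 ?(ltW eps0)// ler_pdivrMr// mul1r lerDl.
  rewrite ler_pdivrMr ?ltr0n// mulrAC ler_pdivlMr// mulrC.
  have := truncnS_gt (2 * E / eps); rewrite ltr_pdivrMr// => /ltW h.
  apply: (le_trans h); rewrite mulrC ler_wpM2l ?(ltW eps0)// ler_nat.
  by rewrite (leq_trans nn).
have mK c g : (forall y, c * (g y - g x) <= q y) ->
    c * (fejer n g x - g x) <= mean (tmul K q).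
  move=> hc; rewrite KE -subr_ge0.
  have -> : mean (tmul K q) - c * (mean (tmul K g) - g x) =
      mean (tmul K (q - c *: (g - g x *: one))).
    have -> : tmul K (q - c *: (g - g x *: one)) =
        tmul K q - c *: (tmul K g - g x *: K).
      apply: testfun_eq => y.
      rewrite !(tmulE, testfunD, testfunN, testfunZ) oneE; ring.
    by rewrite !(meanB, meanZ) K1 mulr1.
  apply: mean_ge0 => y; rewrite tmulE mulr_ge0//.
  by rewrite testfunD testfunN testfunZ testfunD testfunN testfunZ oneE mulr1 subr_ge0.
apply: le_trans mq; rewrite ler_norml -[_ - _]mul1r.
have h1 : 1 * (fejer n f x - f x) <= mean (tmul K q).
  by apply: mK => y; rewrite mul1r qE (le_trans (ler_norm _))// hF.
have h2 : -1 * (fejer n f x - f x) <= mean (tmul K q).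
  apply: mK => y; rewrite mulN1r qE.
  by rewrite (le_trans _ (hF _ _))// -normrN ler_norm.
by rewrite h1 andbT mul1r lerNl -mulN1r.
Qed.

(** Differentiation commutes with the Fejer means, so that uniform convergence
    is inherited by the derivatives. *)
Lemma fejer_cvg_partial m f (eps : R) : 0 < eps -> exists n0, forall n, (n0 <= n)%N ->
  forall l, (size l <= m)%N -> forall x, `|partial l (fejer n f - f)%R x| <= eps.
Proof.
move=> eps0; elim: m f => [|m IH] f.
  have [n0 hn0] := fejer_cvg f eps0.
  by exists n0 => n nn [|//] _ x; apply: hn0.
have [n0 hn0] := fejer_cvg f eps0.
have /choice[p hp] : forall i : 'I_d, exists n0, forall n, (n0 <= n)%N ->
  forall l, (size l <= m)%N -> forall x,
    `|partial l (fejer n (tderiv i f) - tderiv i f)%R x| <= eps.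
  by move=> i; exact: IH.
exists (maxn n0 (\sum_i p i)) => n; rewrite geq_max => /andP[nn0 np].
case/lastP => [_ x|l i]; first exact: hn0.
rewrite size_rcons ltnS => lm x.
rewrite partial_rcons tderivB tderiv_fejer.
by apply: hp => //; apply: leq_trans np; rewrite (bigD1 i)//= leq_addr.
Qed.

Lemma distD (u : dist R d) f g : u (f + g) = u f + u g.
Proof.
have /asboolP[lu _] := distP u.
by have := lu 1 f g; rewrite scale1r mul1r.
Qed.

Lemma dist0 (u : dist R d) : u 0 = 0.
Proof.
have := distD u 0 0; rewrite addr0 => /eqP.
by rewrite -subr_eq0 opprD addrA subrr sub0r oppr_eq0 => /eqP.
Qed.

Lemma distZ (u : dist R d) a f : u (a *: f) = a * u f.
Proof.
have /asboolP[lu _] := distP u.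
by have := lu a f 0; rewrite addr0 dist0 addr0.
Qed.

Lemma distB (u : dist R d) f g : u (f - g) = u f - u g.
Proof. by rewrite distD -(scaleN1r g) distZ mulN1r. Qed.

Lemma dist_sum (u : dist R d) (I : Type) (r : seq I) (P : pred I) (h : I -> testfun R d) :
  u (\sum_(i <- r | P i) h i) = \sum_(i <- r | P i) u (h i).
Proof. exact: (big_morph u (distD u) (dist0 u)). Qed.

(** A distribution has finite order, hence is continuous for the norms in which
    the Fejer means converge, and these means are combinations of waves. *)
Theorem dist_fourier_inj (u v : dist R d) :
  (forall k, u (cosk k) = v (cosk k)) -> (forall k, u (sink k) = v (sink k)) ->
  u = v.
Proof.
move=> hc hs.
have hf n f : u (fejer n f) = v (fejer n f).
  rewrite /fejer !distZ !dist_sum; congr (_ * _); apply: eq_bigr => a _.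
  rewrite !dist_sum; apply: eq_bigr => b _.
  by rewrite !distD !distZ hc hs.
apply/val_inj/funext => f.
have /asboolP[_ [C [m hC]]] := distP u.
have /asboolP[_ [D [p hD]]] := distP v.
apply/eqP; rewrite -subr_eq0 -normr_le0; apply/ler_addgt0Pr => eps eps0.
pose A := `|C| + `|D| + 1; have A0 : 0 < A by rewrite ltr_wpDl ?addr_ge0.
have epsA : 0 < eps / A by rewrite divr_gt0.
have [n0 hn0] := fejer_cvg_partial (maxn m p) f epsA.
have bu : `|u (fejer n0 f) - u f| <= C * (eps / A).
  rewrite -distB; apply: hC => l lm x; apply: hn0 => //.
  by rewrite (leq_trans lm)// leq_maxl.
have bv : `|v (fejer n0 f) - v f| <= D * (eps / A).
  rewrite -distB; apply: hD => l lm x; apply: hn0 => //.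
  by rewrite (leq_trans lm)// leq_maxr.
rewrite add0r -[leLHS]/(`|u f - v f|).
apply: (le_trans (ler_distD (u (fejer n0 f)) _ _)).
rewrite distrC {2}hf.
apply: (le_trans (lerD bu bv)); rewrite -mulrDl mulrCA -[leRHS]mulr1.
rewrite ler_wpM2l ?(ltW eps0)// ler_pdivrMr// mul1r /A.
by have := ler_norm C; have := ler_norm D; lra.
Qed.

End fourier_uniqueness.

(** * Integrals, densities and independence *)

Section measure_tools.
Local Open Scope ereal_scope.
Context d (T : measurableType d) (R : realType).

Section nonmeasurable.
Variable mu : {measure set T -> \bar R}.
Import HBNNSimple.

(** The integral of a nonnegative function is a supremum over simple functions.
    Monotonicity and homogeneity thus hold also for the loss, an uncountable
    supremum that may fail to be measurable. *)
Lemma le_integral_nomeas (f g : T -> \bar R) :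
  (forall x, 0 <= f x) -> (forall x, f x <= g x) ->
  \int[mu]_x f x <= \int[mu]_x g x.
Proof.
move=> f0 fg; have g0 x : 0 <= g x by exact: le_trans (fg x).
rewrite !ge0_integralTE//; apply: le_ereal_sup => _ [h /= hf <-].
by exists h => // x; exact: le_trans (hf x) (fg x).
Qed.

Lemma integralZl_nomeas (c : R) (f : T -> \bar R) :
  (0 <= c)%R -> (forall x, 0 <= f x) ->
  \int[mu]_x (c%:E * f x) = c%:E * \int[mu]_x f x.
Proof.
have le1 (a : R) g : (0 < a)%R -> (forall x, 0 <= g x) ->
    a%:E * \int[mu]_x g x <= \int[mu]_x (a%:E * g x).
  move=> a0 g0; have ag0 x : 0 <= a%:E * g x by rewrite mule_ge0// lee_fin ltW.
  rewrite muleC -lee_pdivlMr// !ge0_integralTE//.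
  apply: ge_ereal_sup => _ [h /= hg <-].
  rewrite lee_pdivlMr// muleC.
  have -> : a%:E * sintegral mu h = \int[mu]_x (a%:E * (h x)%:E).
    have mh : measurable_fun [set: T] (fun x => (h x)%:E : \bar R).
      by apply/measurable_EFinP; exact/measurable_funP.
    have h0 (x : T) : [set: T] x -> 0 <= ((h x)%:E : \bar R) by rewrite lee_fin.
    rewrite (@ge0_integralZl _ _ _ mu _ measurableT _ mh _ h0) ?lee_fin ?(ltW a0)//.
    by rewrite integral_nnsfun// patch_setT.
  rewrite -ge0_integralTE//.
  apply: le_integral_nomeas => x; first by rewrite mule_ge0 ?lee_fin// ltW.
  by rewrite lee_wpmul2l ?lee_fin ?(ltW a0)//; exact: hg.
move=> c0 f0; move: c0; rewrite le_eqVlt => /predU1P[<-|c0].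
  by under eq_integral do rewrite mul0e; rewrite integral0 mul0e.
apply/eqP; rewrite eq_le le1// andbT.
have ci : (0 < c^-1)%R by rewrite invr_gt0.
have /le1 : forall x, 0 <= c%:E * f x by move=> x; rewrite mule_ge0// lee_fin ltW.
move=> /(_ _ ci).
have -> : \int[mu]_x (c^-1%:E * (c%:E * f x)) = \int[mu]_x f x.
  by apply: eq_integral => x _; rewrite muleA -EFinM mulVf ?gt_eqF// mul1e.
by rewrite muleC -lee_pdivlMr// invrK muleC.
Qed.

End nonmeasurable.

Section density.
Variables (mu m : {measure set T -> \bar R}) (g : T -> R).
Hypotheses (mg : measurable_fun setT g) (g0 : forall x, (0 <= g x)%R).
Hypothesis mE : forall A, measurable A -> m A = \int[mu]_x ((\1_A x * g x)%:E).
Import HBNNSimple.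

Lemma ge0_integral_density (f : T -> \bar R) :
  measurable_fun setT f -> (forall x, 0 <= f x) ->
  \int[m]_x f x = \int[mu]_x (f x * (g x)%:E).
Proof.
move=> mf f0; pose h := nnsfun_approx measurableT mf.
have mgE : measurable_fun [set: T] (fun x => (g x)%:E : \bar R) by exact/measurable_EFinP.
have -> : \int[m]_x f x = lim (\int[m]_x (h n x)%:E @[n --> \oo]).
  transitivity (\int[m]_x lim ((h n x)%:E @[n --> \oo])).
    by apply: eq_integral => x _; apply/esym/cvg_lim => //; exact: cvg_nnsfun_approx.
  apply: monotone_convergence => //.
  - by move=> n; apply/measurable_EFinP; exact/measurable_funP.
  - by move=> n x _ /=; rewrite lee_fin.
  - by move=> x _ a b ab; rewrite lee_fin; exact/lefP/nd_nnsfun_approx.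
have -> : \int[mu]_x (f x * (g x)%:E) =
    lim (\int[mu]_x ((h n x)%:E * (g x)%:E) @[n --> \oo]).
  transitivity (\int[mu]_x lim (((h n x)%:E * (g x)%:E) @[n --> \oo])).
    apply: eq_integral => x _; apply/esym/cvg_lim => //; apply: cvgeZr => //.
    exact: cvg_nnsfun_approx.
  apply: monotone_convergence => //.
  - by move=> n; apply: emeasurable_funM => //; apply/measurable_EFinP; exact/measurable_funP.
  - by move=> n x _ /=; rewrite mule_ge0 ?lee_fin.
  - move=> x _ a b ab; rewrite lee_wpmul2r ?lee_fin//.
    exact/lefP/nd_nnsfun_approx.
congr (lim (_ @ \oo)); apply/funext => n.
have hE x : h n x = (\sum_(y \in range (h n)) (y * \1_(h n @^-1` [set y]) x))%R.
  by rewrite fimfunE.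
have mi r : measurable_fun [set: T] (fun x => (r * \1_(h n @^-1` [set r]) x)%:E : \bar R).
  by apply/measurable_EFinP; exact: measurable_funM.
transitivity (\int[m]_x \sum_(y \in range (h n)) (y * \1_(h n @^-1` [set y]) x)%:E).
  by apply: eq_integral => x _; rewrite hE -fsumEFin.
rewrite ge0_integral_fsum//; last by move=> r x _; exact: nnfun_muleindic_ge0.
transitivity (\int[mu]_x \sum_(y \in range (h n))
    ((y * \1_(h n @^-1` [set y]) x)%:E * (g x)%:E)); last first.
  apply: eq_integral => x _; rewrite hE -fsumEFin//.
  by rewrite -ge0_mule_fsuml// => y; exact: nnfun_muleindic_ge0.
rewrite ge0_integral_fsum//; last 2 first.
- by move=> r; apply: emeasurable_funM.
- by move=> r x _; rewrite mule_ge0 ?lee_fin//; have := nnfun_muleindic_ge0 (h n) r x; rewrite lee_fin.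
apply: eq_fsbigr => r rh.
have r0 : (0 <= r)%R by move: rh; rewrite inE => -[x _ <-].
under eq_integral do rewrite EFinM.
under [RHS]eq_integral do rewrite EFinM -muleA.
have mA : measurable (h n @^-1` [set r]) by exact: measurable_sfunP.
rewrite !integralZl_nomeas//; last by move=> x; rewrite mule_ge0 ?lee_fin.
congr (_ * _); rewrite integral_indic// setIT; exact: mE.
Qed.

End density.

Section independence.
Variables (P : probability T R).
Context d1 d2 (T1 : measurableType d1) (T2 : measurableType d2).
Variables (X : T -> T1) (Y : T -> T2).
Hypotheses (mX : measurable_fun setT X) (mY : measurable_fun setT Y).
Hypothesis XY : forall A B, measurable A -> measurable B ->
  P (X @^-1` A `&` Y @^-1` B) = P (X @^-1` A) * P (Y @^-1` B).

Let X' : {RV P >-> T1} := HB.pack X (isMeasurableFun.Build _ _ _ _ X mX).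
Let Y' : {RV P >-> T2} := HB.pack Y (isMeasurableFun.Build _ _ _ _ Y mY).
Let mXY : measurable_fun setT (fun o => (X o, Y o)).
Proof. exact: measurable_fun_pair. Qed.
Let Z : {RV P >-> (T1 * T2)%type} := HB.pack (fun o => (X o, Y o))
  (isMeasurableFun.Build _ _ _ _ (fun o => (X o, Y o)) mXY).

(** Integration against the joint law of independent variables, as an
    iterated integral over two copies of the sample space. *)
Lemma ge0_integral_independent (f : T1 * T2 -> \bar R) :
  measurable_fun setT f -> (forall z, 0 <= f z) ->
  \int[P]_o f (X o, Y o) = \int[P]_o' \int[P]_o f (X o, Y o').
Proof.
move=> mf f0.
have -> : \int[P]_o f (X o, Y o) = \int[distribution P Z]_z f z.
  by rewrite ge0_integral_distribution.
have ZE B C : measurable B -> measurable C ->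
    distribution P Z (B `*` C) = distribution P X' B * distribution P Y' C.
  exact: XY.
rewrite -(@eq_measure_integral _ _ _ setT _ (distribution P X' \x distribution P Y')); last first.
  by move=> A mA _; exact: product_measure_unique.
rewrite fubini_tonelli2// ge0_integral_distribution//.
- apply: eq_integral => o' _ /=; rewrite /fubini_G ge0_integral_distribution//.
  by apply: measurableT_comp => //; exact: measurable_pair2.
- exact: measurable_fun_fubini_tonelli_G.
- by move=> y; apply: integral_ge0.
Qed.

End independence.

End measure_tools.

Section lebesgue_translation.
Context {R : realType}.
Local Open Scope ereal_scope.

Lemma ge0_integral_translation (f : R -> \bar R) (h : R) :
  measurable_fun setT f -> (forall x, 0 <= f x) ->
  \int[lebesgue_measure]_x f (x + h)%R = \int[lebesgue_measure]_x f x.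
Proof.
move=> mf f0.
have mh : measurable_fun setT (fun x : measurableTypeR R => (x + h)%R : measurableTypeR R).
  exact: measurable_funD.
pose H : {mfun (measurableTypeR R) >-> (measurableTypeR R)} := HB.pack (fun x : R => (x + h)%R)
  (isMeasurableFun.Build _ _ (measurableTypeR R) (measurableTypeR R) (fun x : R => (x + h)%R) mh).
transitivity (\int[pushforward lebesgue_measure H]_x f x).
  by rewrite ge0_integral_pushforward// preimage_setT.
apply: eq_measure_integral => A mA _; apply/esym.
apply: lebesgue_measure_unique => // _ [[a b] _ <-] /=.
rewrite /pushforward.
have -> : H @^-1` `]a, b] = `](a - h)%R, (b - h)%R]%classic.
  by apply/seteqP; split=> x /=; rewrite !in_itv /= ltrBlDr lerBrDr.
rewrite !lebesgue_measure_itv /= !lte_fin ltrD2r; case: ifP => // _.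
by rewrite -!EFinB; congr (_%:E); ring.
Qed.

End lebesgue_translation.

(** * Random distributions and their covariances *)

Section measurable_distributions.
Context {R : realType} {dim : nat}.

Lemma measurable_dist_eval (phi : testfun R dim) :
  measurable_fun setT (fun u : dist R dim => u phi).
Proof.
move=> _ B mB; rewrite setTI; apply: sub_sigma_algebra.
by exists phi, B.
Qed.

Lemma measurable_distP d (T : measurableType d) (X : T -> dist R dim) :
  (forall phi, measurable_fun setT (fun o => X o phi)) -> measurable_fun setT X.
Proof.
move=> mX; apply: (@measurability _ _ _ _ _ _ (@dist_cylinder R dim)) => //.
move=> _ [_ [phi [B [mB ->]]] <-].
by have := mX phi measurableT B mB.
Qed.

Lemma measurable_dist_comp d (T : measurableType d) (X : T -> dist R dim) phi :
  measurable_fun setT X -> measurable_fun setT (fun o => X o phi).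
Proof. by move=> mX; exact: (measurableT_comp (@measurable_dist_eval phi) mX). Qed.

Lemma distE_add (u v : dist R dim) phi : (u + v) phi = u phi + v phi.
Proof. by []. Qed.
Lemma distE_scale a (u : dist R dim) phi : (a *: u) phi = a * u phi.
Proof. by []. Qed.
Lemma distE_sum (I : Type) (r : seq I) (Q : pred I) (h : I -> dist R dim) phi :
  (\sum_(i <- r | Q i) h i) phi = \sum_(i <- r | Q i) h i phi.
Proof. by elim/big_ind2: _ => // a b c c' <- <-. Qed.

End measurable_distributions.

Section gaussian_covariance.
Context {R : realType} {dim : nat} d (T : measurableType d) (P : probability T R).
Variable w : T -> dist R dim.
Implicit Types phi psi chi : testfun R dim.
Hypothesis mw : measurable_fun setT w.
Hypothesis gw : forall n (phi : 'I_n -> testfun R dim),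
  gaussian_vector P (fun i o => w o (phi i)).

Lemma gaussian_Lfun2 phi : (fun o => w o phi) \in Lfun P 2%:E.
Proof. by have [/(_ ord0)[]] := gw (fun _ : 'I_1 => phi). Qed.

Lemma gaussian_Lfun1 phi psi : (fun o => w o phi * w o psi) \in Lfun P 1.
Proof. exact: (Lfun2_mul_Lfun1 (gaussian_Lfun2 phi) (gaussian_Lfun2 psi)). Qed.

Lemma gaussian_meas phi : measurable_fun setT (fun o => w o phi).
Proof. exact: measurable_dist_comp. Qed.

Definition field_cov phi psi : R := fine ('E_P[fun o => (w o phi * w o psi)%R])%E.

Lemma field_covE phi psi :
  ('E_P[fun o => (w o phi * w o psi)%R] = (field_cov phi psi)%:E)%E.
Proof. by rewrite fineK// expectation_fin_num// gaussian_Lfun1. Qed.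

Lemma field_covC phi psi : field_cov phi psi = field_cov psi phi.
Proof.
rewrite /field_cov; congr (fine _); rewrite unlock.
by apply: eq_integral => o _; rewrite mulrC.
Qed.

Lemma field_covP a phi phi' psi :
  field_cov (a *: phi + phi') psi = a * field_cov phi psi + field_cov phi' psi.
Proof.
apply/EFin_inj; rewrite EFinD EFinM -!field_covE.
rewrite -expectationZl ?gaussian_Lfun1// -expectationD ?gaussian_Lfun1//; last first.
  exact: (Lfun_scale _ (lexx 1) (gaussian_Lfun1 phi psi)).
rewrite unlock; apply: eq_integral => o _ /=; congr (_%:E).
rewrite distD distZ; ring.
Qed.

Lemma field_cov0l psi : field_cov 0 psi = 0.
Proof.
have := field_covP 0 0 0 psi; rewrite scale0r addr0 mul0r add0r.
have := field_covP 1 0 0 psi; rewrite scale1r addr0 mul1r => /eqP.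
by rewrite -subr_eq0 opprD addrA subrr sub0r oppr_eq0 => /eqP.
Qed.
Lemma field_covZl a phi psi : field_cov (a *: phi) psi = a * field_cov phi psi.
Proof. by have := field_covP a phi 0 psi; rewrite addr0 field_cov0l addr0. Qed.
Lemma field_covDl phi phi' psi :
  field_cov (phi + phi') psi = field_cov phi psi + field_cov phi' psi.
Proof. by have := field_covP 1 phi phi' psi; rewrite scale1r mul1r. Qed.
Lemma field_covBl phi phi' psi :
  field_cov (phi - phi') psi = field_cov phi psi - field_cov phi' psi.
Proof. by rewrite field_covDl -(scaleN1r phi') field_covZl mulN1r. Qed.
Lemma field_cov_suml n (h : 'I_n -> testfun R dim) psi :
  field_cov (\sum_i h i) psi = \sum_i field_cov (h i) psi.
Proof. exact: (big_morph (field_cov ^~ psi) (fun a b => field_covDl a b psi) (field_cov0l psi)). Qed.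

Lemma field_cov_ge0 phi : 0 <= field_cov phi phi.
Proof.
by rewrite -lee_fin -field_covE; apply: expectation_ge0 => o; rewrite -expr2 sqr_ge0.
Qed.

(** The residual [phi - cov phi chi *: chi] has a nonnegative variance. *)
Lemma field_cov_cs phi chi : field_cov chi chi = 1 ->
  field_cov phi chi ^+ 2 <= field_cov phi phi.
Proof.
move=> c1; have := field_cov_ge0 (phi - field_cov phi chi *: chi).
rewrite field_covBl field_covZl 2!(field_covC _ (_ - _)) !field_covBl !field_covZl.
rewrite c1 mulr1 subrr mulr0 subr0 (field_covC chi phi) subr_ge0 expr2.
done.
Qed.

Lemma iter_integral_ge0 n (F : 'rV[R]_n -> \bar R) :
  (forall x, 0 <= F x)%E -> (0 <= iter_integral F)%E.
Proof.
elim: n F => [|n IH] F F0; first exact: F0.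
by apply: integral_ge0 => x _; apply: IH.
Qed.

Lemma iter_integralZl n (c : R) (F : 'rV[R]_n -> \bar R) : 0 <= c ->
  (forall x, 0 <= F x)%E ->
  (iter_integral (fun x => c%:E * F x) = c%:E * iter_integral F)%E.
Proof.
move=> c0; elim: n F => [//|n IH] F F0 /=.
rewrite -integralZl_nomeas//; last by move=> x; apply: iter_integral_ge0.
by apply: eq_integral => x _; rewrite IH.
Qed.

Definition centered_normal_pdf (v x : R) : R :=
  expR (- (x ^+ 2 / v) / 2) / Num.sqrt (2 * pi * v).

Lemma gaussian_density1 (v x : R) :
  gaussian_density (v%:M : 'M[R]_1) (row_mx (x%:M : 'rV_1) (0 : 'rV_0)) =
  centered_normal_pdf v x.
Proof.
rewrite /gaussian_density /centered_normal_pdf expr1 det_scalar expr1.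
have -> : row_mx (x%:M : 'rV_1) (0 : 'rV_0) = x%:M.
  by apply/matrixP => i j; rewrite !ord1 !mxE; case: splitP => j' //; rewrite ord1 mxE.
rewrite invmx_scalar tr_scalar_mx -!scalar_mxM mxE eqxx mulr1n.
by rewrite mulrAC -expr2.
Qed.

Lemma gaussian_law1 chi (B : set R) : 0 < field_cov chi chi -> measurable B ->
  (P [set o | B (w o chi)] =
   \int[lebesgue_measure]_x
     (\1_B x * centered_normal_pdf (field_cov chi chi) x)%:E)%E.
Proof.
move=> v0 mB; have [_ /=] := gw (fun _ : 'I_1 => chi).
set S := \matrix_(i, j) _; have SE : S = (field_cov chi chi)%:M.
  by apply/matrixP => i j; rewrite !ord1 !mxE eqxx mulr1n.
rewrite {}SE unitmxE det_scalar expr1 unitfE gt_eqF// => /(_ isT).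
move=> /(_ (fun=> B) (fun=> mB)) /= h.
transitivity (P [set o | forall i : 'I_1, B (w o chi)]).
  by congr (P _); apply/seteqP; split=> o /= ho; [move=> _|exact: (ho ord0)].
rewrite h; apply: eq_integral => x _; rewrite big_ord1 gaussian_density1.
by congr ((\1_B _ * _)%:E); rewrite mxE; case: splitP => j // _; rewrite ord1 mxE mulr1n.
Qed.

(** The density is largest at the origin, where it is less than the inverse of
    the standard deviation. *)
Lemma gaussian_small_ball chi (a : R) : 0 <= a -> 0 < field_cov chi chi ->
  (P [set o | (`|w o chi| <= a)%R] <= (2 * a / Num.sqrt (field_cov chi chi))%:E)%E.
Proof.
move=> a0 v0; set v := field_cov chi chi in v0 *.
have -> : [set o | `|w o chi| <= a] = [set o | `[- a, a]%classic (w o chi)].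
  by apply/seteqP; split=> o /=; rewrite in_itv /= -ler_norml.
have mI : measurable (`[- a, a]%classic : set R) by exact: measurable_itv.
rewrite gaussian_law1//; set K := (Num.sqrt v)^-1.
have K0 : 0 <= K by rewrite invr_ge0 sqrtr_ge0.
have pdfK x : centered_normal_pdf v x <= K.
  rewrite /centered_normal_pdf -[leRHS]mul1r ler_pM ?expR_ge0 ?invr_ge0//.
    rewrite -expR0 ler_expR mulNr oppr_le0 divr_ge0// divr_ge0 ?sqr_ge0//.
    exact: ltW.
  rewrite /K lef_pV2 ?posrE ?sqrtr_gt0 ?mulr_gt0 ?pi_gt0//.
  apply: ler_wsqrtr; rewrite ler_peMl ?(ltW v0)//.
  by have := pi_ge2 R; lra.
apply: (@le_trans _ _ (\int[lebesgue_measure]_x (K%:E * (\1_(`[- a, a]%classic) x)%:E))%E).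
  apply: le_integral_nomeas => x.
    by rewrite lee_fin mulr_ge0// divr_ge0 ?expR_ge0// sqrtr_ge0.
  by rewrite -EFinM lee_fin mulrC ler_wpM2r.
rewrite integralZl_nomeas//.
rewrite integral_indic// setIT /= lebesgue_measure_itv /= lte_fin.
case: ifPn => _; last by rewrite mule0 lee_fin !mulr_ge0.
by rewrite -EFinB -EFinM lee_fin; lra.
Qed.

End gaussian_covariance.

(** * The covariance as a distribution; independence on generating families *)

Section covariance_distribution.
Context {R : realType} {dim : nat} d (T : measurableType d) (P : probability T R).
Variable w : T -> dist R dim.
Implicit Types phi psi chi : testfun R dim.
Hypothesis mw : measurable_fun setT w.
Hypothesis gw : forall n (phi : 'I_n -> testfun R dim),
  gaussian_vector P (fun i o => w o (phi i)).
Variable chi : testfun R dim.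
Hypothesis chi1 : field_cov P w chi chi = 1.
Local Notation cov := (field_cov P w).

(** Otherwise there are test functions [phi_n] of [C^n] norm at most [B_n]
    such that [w phi_n] has a standard deviation larger than [2 n (n+1) B_n],
    hence is bounded by [n B_n] with probability at most [1 / (n+1)]. But each
    realization of [w] has finite order, so it satisfies all these bounds but
    finitely many. *)
Lemma field_cov_finite_order : finite_order (fun phi => cov phi chi).
Proof.
apply: contrapT => nfo.
have /choice[pB hpB] : forall n : nat, exists pB : testfun R dim * R,
    (forall l : seq 'I_dim, (size l <= n)%N -> forall x, `|partial l pB.1 x| <= pB.2) /\
    2 * n%:R * n.+1%:R * pB.2 < `|cov pB.1 chi|.
  move=> n; apply: contrapT => h; apply: nfo.
  exists (2 * n%:R * n.+1%:R), n => phi B hB; rewrite leNgt; apply/negP => lt.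
  by apply: h; exists (phi, B).
pose phi n := (pB n).1; pose B n := (pB n).2.
have hB n : forall l : seq 'I_dim, (size l <= n)%N -> forall x, `|partial l (phi n) x| <= B n.
  by have [] := hpB n.
have hc n : 2 * n%:R * n.+1%:R * B n < `|cov (phi n) chi| by have [] := hpB n.
have B0 n : 0 <= B n by apply: le_trans (hB n [::] isT 0).
pose A n := [set o | `|w o (phi n)| <= n%:R * B n].
have mA n : measurable (A n).
  have -> : A n = [set: T] `&` (fun o => w o (phi n)) @^-1` `[- (n%:R * B n), n%:R * B n].
    by rewrite setTI; apply/seteqP; split=> o /=; rewrite in_itv /= -ler_norml.
  by apply: gaussian_meas => //; exact: measurable_itv.
have PA n : (P (A n) <= (n.+1%:R^-1)%:E)%E.
  have c0 : 0 < `|cov (phi n) chi| by apply: le_lt_trans (hc n); rewrite !mulr_ge0.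
  have cs : `|cov (phi n) chi| ^+ 2 <= cov (phi n) (phi n).
    by rewrite real_normK ?num_real// field_cov_cs.
  have v0 : 0 < cov (phi n) (phi n) by apply: lt_le_trans cs; rewrite exprn_gt0.
  have nB0 : 0 <= n%:R * B n by rewrite mulr_ge0.
  have PA1 := gaussian_small_ball gw nB0 v0.
  apply: (le_trans PA1); rewrite lee_fin.
  have s0 : 0 < Num.sqrt (cov (phi n) (phi n)) by rewrite sqrtr_gt0.
  rewrite ler_pdivrMr// [leRHS]mulrC ler_pdivlMr ?ltr0n//.
  have : `|cov (phi n) chi| <= Num.sqrt (cov (phi n) (phi n)).
    by rewrite -[leLHS]normr_id -sqrtr_sqr ler_wsqrtr.
  apply: le_trans; apply: le_trans (ltW (hc n)).
  by rewrite -!mulrA ler_pM2l// ler_wpM2l// mulrC.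
pose Z n0 := \bigcap_(n in [set n | (n0 <= n)%N]) A n.
have mZ n0 : measurable (Z n0) by apply: bigcap_measurable => //; exists n0 => /=.
have PZ n0 : P (Z n0) = 0%E.
  apply/eqP; rewrite eq_le measure_ge0 andbT; apply/lee_addgt0Pr => e e0.
  rewrite add0e; pose n := maxn n0 (Num.truncn e^-1).
  apply: (@le_trans _ _ (P (A n))).
    apply: le_measure; rewrite ?inE//.
    by apply: bigcap_inf => /=; exact: leq_maxl.
  apply: (le_trans (PA n)); rewrite lee_fin invf_ple ?posrE ?ltr0n//.
  by apply: (le_trans (ltW (truncnS_gt _))); rewrite ler_nat ltnS leq_maxr.
have ZT : \bigcup_n0 Z n0 = setT.
  rewrite -subTset => o _.
  have /asboolP[_ [C [m hC]]] := distP (w o).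
  exists (maxn m (Num.truncn C).+1) => // n /=; rewrite geq_max => /andP[mn Cn].
  apply: (@le_trans _ _ (C * B n)).
    by apply: hC => l lm x; apply: hB; rewrite (leq_trans lm).
  rewrite ler_wpM2r//; apply: (le_trans (ltW (truncnS_gt C))).
  by rewrite ler_nat.
have : P.-negligible setT.
  rewrite -ZT; apply: negligible_bigcup => n0.
  exists (Z n0); split; [exact: mZ|exact: PZ|by []].
move=> /(negligibleP P measurableT) P0.
have : P [set: T] = 1%E by exact: probability_setT.
by rewrite P0 => /eqP; rewrite eq_sym onee_eq0.
Qed.

Lemma field_cov_dist_subproof :
  (fun phi => cov phi chi) \in @distribution_pred R dim.
Proof.
apply/asboolP; split; last exact: field_cov_finite_order.
by move=> a phi psi; exact: field_covP.
Qed.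

(** The Cameron-Martin direction dual to the variable [w chi]. *)
Definition cm_direction : dist R dim := Dist field_cov_dist_subproof.

Lemma cm_directionE phi : cm_direction phi = cov phi chi. Proof. by []. Qed.

End covariance_distribution.

Section generated_independence.
Context {R : realType} d (T : measurableType d) (P : probability T R).
Context d2 (S : measurableType d2) (Y : T -> S) (mY : measurable_fun setT Y).
Variables (E : set T) (mE : measurable E) (G : set (set S)).
Hypotheses (Gm : G `<=` measurable) (GI : setI_closed G) (GT : G setT).
Hypothesis mG : measurable `<=` <<s G >>.
Local Open Scope ereal_scope.

(** Both sides are finite measures in [A] with the same mass, so that they agree
    once they agree on the generating pi-system [G]. *)
Lemma independent_generated :
  (forall A, G A -> P (E `&` Y @^-1` A) = P E * P (Y @^-1` A)) ->
  forall A, measurable A -> P (E `&` Y @^-1` A) = P E * P (Y @^-1` A).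
Proof.
move=> h A mA.
pose Y' : {mfun T >-> S} := HB.pack Y (isMeasurableFun.Build _ _ _ _ Y mY).
have PEr : P E \is a fin_num by rewrite fin_num_measure.
pose p : {nonneg R} := NngNum (fine_ge0 (measure_ge0 P E)).
pose push1 : {measure set S -> \bar R} := pushforward (mrestr P mE) Y'.
pose push2 : {measure set S -> \bar R} := mscale p (pushforward P Y').
pose m1 := push1 mY; pose m2 := push2 mY.
have m1E B : m1 B = P (E `&` Y @^-1` B) by rewrite /m1 /= /pushforward /mrestr setIC.
have m2E B : m2 B = P E * P (Y @^-1` B).
  by rewrite /m2 /= /mscale /pushforward /= fineK.
rewrite -m1E -m2E; apply: (@g_sigma_algebra_measure_unique _ _ _ G _ (fun=> setT)) => //.
- by rewrite bigcup_const.
- by move=> B GB; rewrite m1E m2E; exact: h.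
- by move=> k; rewrite m1E preimage_setT setIT -ge0_fin_numE.
- exact: mG.
Qed.

End generated_independence.

Section tuple_rectangles.
Context d (S : measurableType d) (n : nat).

Definition tuple_rectangle : set (set (n.-tuple S)) :=
  [set A | exists2 B : 'I_n -> set S, (forall i, measurable (B i)) &
    A = [set z | forall i, B i (tnth z i)]].

Lemma measurable_tuple_rectangle : tuple_rectangle `<=` measurable.
Proof.
move=> _ [B mB ->].
have -> : [set z : n.-tuple S | forall i, B i (tnth z i)] =
    \bigcap_(i in [set: 'I_n]) ((fun z : n.-tuple S => tnth z i) @^-1` B i).
  by apply/seteqP; split=> z h i; [move=> _; exact: h|exact: (h i I)].
apply: fin_bigcap_measurable => // i _; rewrite -[X in measurable X]setTI.
exact: measurable_tnth.
Qed.

Lemma tuple_rectangle_setI : setI_closed tuple_rectangle.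
Proof.
move=> _ _ [B mB ->] [C mC ->]; exists (fun i => B i `&` C i).
  by move=> i; exact: measurableI.
apply/seteqP; split=> z /=; first by move=> [h1 h2] i; split.
by move=> h; split=> i; have [] := h i.
Qed.

Lemma tuple_rectangle_setT : tuple_rectangle setT.
Proof. by exists (fun=> setT) => //; apply/seteqP; split. Qed.

Lemma measurable_tuple_generated : measurable `<=` <<s tuple_rectangle >>.
Proof.
apply: smallest_sub; first exact: smallest_sigma_algebra.
apply: (big_ind (fun X : set (set (n.-tuple S)) => X `<=` <<s tuple_rectangle >>)).
- by [].
- by move=> X X' hX hX'; rewrite subUset.
move=> i _ _ [A mA <-]; rewrite setTI; apply: sub_sigma_algebra.
exists (fun j => if j == i then A else setT); first by move=> j; case: ifP.
apply/seteqP; split=> z /= h; first by move=> j; case: eqVneq => [->|].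
by have := h i; rewrite eqxx.
Qed.

End tuple_rectangles.

(** * Uncorrelated Gaussian variables are independent *)

Section gaussian_independence.
Context {R : realType} {dim : nat} d (T : measurableType d) (P : probability T R).
Variable w : T -> dist R dim.
Implicit Types phi psi : testfun R dim.
Hypothesis mw : measurable_fun setT w.
Hypothesis gw : forall n (phi : 'I_n -> testfun R dim),
  gaussian_vector P (fun i o => w o (phi i)).
Variable chi : testfun R dim.
Local Notation cov := (field_cov P w).
Hypothesis chi1 : cov chi chi = 1.

Definition cov_mx n (phi : 'I_n -> testfun R dim) : 'M[R]_n :=
  \matrix_(i, j) cov (phi i) (phi j).

Lemma gaussian_law n (phi : 'I_n -> testfun R dim) (B : 'I_n -> set R) :
  cov_mx phi \in unitmx -> (forall i, measurable (B i)) ->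
  P [set o | forall i, B i (w o (phi i))] =
  iter_integral (fun x =>
    ((\prod_i \1_(B i) (x 0 i)) * gaussian_density (cov_mx phi) x)%:E).
Proof. by move=> uS mB; have [_ /(_ uS B mB)] := gw phi. Qed.

Lemma gaussian_density_block n (S : 'M[R]_n) (x : R) (y : 'rV[R]_n) :
  S \in unitmx ->
  gaussian_density (block_mx (1%:M : 'M[R]_1) 0 0 S) (row_mx (x%:M : 'rV_1) y) =
  centered_normal_pdf 1 x * gaussian_density S y.
Proof.
move=> uS; set A := block_mx _ _ _ _.
have uA : A \in unitmx by rewrite block_diag_mx_unit unitmx1.
have VE : invmx A = block_mx (1%:M : 'M[R]_1) 0 0 (invmx S).
  by rewrite invmx_block_diag// invmx1.
rewrite /gaussian_density VE tr_row_mx mul_row_block !mulmx0 !addr0 add0r mulmx1.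
rewrite mul_row_col tr_scalar_mx -scalar_mxM mxE.
have -> : ((x * x)%:M : 'M[R]_1) 0 0 = x ^+ 2 by rewrite mxE mulr1n expr2.
rewrite opprD mulrDl expRD det_ublock det1 mul1r.
have -> : (2 * pi) ^+ (1 + n) * \det S = (2 * pi * 1) * ((2 * pi) ^+ n * \det S).
  by rewrite exprS mulr1 mulrA.
rewrite [Num.sqrt (2 * pi * 1 * _)]sqrtrM ?mulr_ge0 ?pi_ge0//.
by rewrite invfM mulrACA /centered_normal_pdf divr1.
Qed.

(** With an invertible covariance, uncorrelated Gaussian variables have a
    joint density that splits as a product. *)
Lemma gaussian_indep_unit n (phi : 'I_n -> testfun R dim) (B0 : set R)
    (B : 'I_n -> set R) :
  (forall i, cov (phi i) chi = 0) -> cov_mx phi \in unitmx ->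
  measurable B0 -> (forall i, measurable (B i)) ->
  (P ([set o | B0 (w o chi)] `&` [set o | forall i, B i (w o (phi i))]) =
   P [set o | B0 (w o chi)] * P [set o | forall i, B i (w o (phi i))])%E.
Proof.
move=> c0 uS mB0 mB.
pose Phi (i : 'I_(1 + n)) := match fintype.split i with inl _ => chi | inr j => phi j end.
pose BB (i : 'I_(1 + n)) := match fintype.split i with inl _ => B0 | inr j => B j end.
have SE : cov_mx Phi = block_mx (1%:M : 'M[R]_1) 0 0 (cov_mx phi).
  apply/matrixP => i j; rewrite !mxE /Phi.
  case: (fintype.split i) => i'; rewrite !mxE; case: (fintype.split j) => j'; rewrite ?mxE.
  - by rewrite !ord1 chi1.
  - by rewrite field_covC c0.
  - exact: c0.
  - by [].
have uPhi : cov_mx Phi \in unitmx.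
  by rewrite SE unitmxE det_ublock det1 mul1r -unitmxE.
have mBB i : measurable (BB i) by rewrite /BB; case: (fintype.split i).
have -> : [set o | B0 (w o chi)] `&` [set o | forall i, B i (w o (phi i))] =
    [set o | forall i, BB i (w o (Phi i))].
  apply/seteqP; split=> o /=.
    by move=> [h0 h] i; rewrite /BB /Phi; case: (fintype.split i).
  move=> h; split=> [|i].
    by have := h (lshift n ord0); rewrite /BB /Phi (unsplitK (inl _ ord0)).
  by have := h (rshift 1 i); rewrite /BB /Phi (unsplitK (inr _ i)).
rewrite (gaussian_law uPhi mBB) (gaussian_law uS mB).
have v0 : 0 < cov chi chi by rewrite chi1.
rewrite (gaussian_law1 gw v0 mB0) chi1.
set J := (X in _ = (_ * X)%E).
have J0 : (0 <= J)%E.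
  apply: iter_integral_ge0 => x; rewrite lee_fin mulr_ge0//.
    by apply: prodr_ge0 => i _.
  by rewrite divr_ge0 ?expR_ge0// sqrtr_ge0.
have Jfin : J \is a fin_num.
  rewrite /J -(gaussian_law uS mB) fin_num_measure//.
  have -> : [set o | forall i, B i (w o (phi i))] =
      \bigcap_(i in [set: 'I_n]) ([set: T] `&` (fun o => w o (phi i)) @^-1` B i).
    by apply/seteqP; split=> o h i; [move=> _; split=> //; exact: h|exact: (h i I).2].
  apply: fin_bigcap_measurable => // i _; exact: (gaussian_meas mw).
rewrite -[J in RHS]fineK// muleC -integralZl_nomeas ?fine_ge0//; last first.
  by move=> x; rewrite lee_fin mulr_ge0// divr_ge0 ?expR_ge0// sqrtr_ge0.
rewrite SE /=; apply: eq_integral => x _.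
rewrite fineK// [RHS]muleC /J -iter_integralZl.
- congr iter_integral; apply/funext => y.
  rewrite gaussian_density_block// -EFinM; congr (_%:E).
  rewrite big_split_ord big_ord1 row_mxEl mxE eqxx mulr1n.
  rewrite /BB (unsplitK (inl _ ord0)) mulrACA; congr (_ * (_ * _)).
  by apply: eq_bigr => i _; rewrite row_mxEr (unsplitK (inr _ i)).
- by rewrite mulr_ge0// divr_ge0 ?expR_ge0// sqrtr_ge0.
- move=> y; rewrite lee_fin mulr_ge0 ?prodr_ge0//.
  by rewrite divr_ge0 ?expR_ge0// sqrtr_ge0.
Qed.

Let Yt n (phi : 'I_n -> testfun R dim) (o : T) : n.-tuple R :=
  [tuple w o (phi i) | i < n].

Let mYt n (phi : 'I_n -> testfun R dim) : measurable_fun setT (Yt phi).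
Proof.
apply/measurable_fun_tnthP => i.
rewrite (_ : _ \o _ = fun o => w o (phi i)); first exact: gaussian_meas.
by apply/funext => o /=; rewrite tnth_mktuple.
Qed.

Lemma measure_eq_off_null (A B N : set T) : measurable A -> measurable B ->
  measurable N -> P N = 0%E -> A `\` N = B `\` N -> P A = P B.
Proof.
move=> mA mB mN PN AB.
have h (C : set T) : measurable C -> P C = P (C `\` N).
  move=> mC.
  have -> : P C = (P (C `\` N) + P (C `&` N))%E by exact: measureDI.
  suff -> : P (C `&` N) = 0%E by rewrite adde0.
  by apply: (@subset_measure0 _ _ _ _ _ N) => //; exact: measurableI.
by rewrite (h A mA) (h B mB) AB.
Qed.

Lemma gaussian_degenerate psi : cov psi psi = 0 ->
  P [set o | w o psi != 0] = 0%E.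
Proof.
move=> c0.
have mpsi : measurable_fun setT (fun o => (w o psi)%:E : \bar R).
  by apply/measurable_EFinP; exact: (gaussian_meas mw).
have mf : measurable_fun setT (fun o => (w o psi * w o psi)%:E : \bar R).
  by apply/measurable_EFinP; apply: measurable_funM; exact: (gaussian_meas mw).
have : (\int[P]_o `|(w o psi * w o psi)%:E| = 0)%E.
  have := field_covE gw psi psi; rewrite c0 unlock => E; apply: etrans E.
  by apply: eq_integral => o _; rewrite gee0_abs// lee_fin -expr2 sqr_ge0.
move=> /(ae_eq_integral_abs P measurableT mf)[N [mN PN hN]].
apply: (@subset_measure0 _ _ _ _ _ N) => //.
  by have := emeasurable_neq measurableT mpsi 0%E; rewrite setTI.
move=> o /= wo; apply: hN => /= /(_ Logic.I) [] /eqP.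
by rewrite mulf_eq0 orbb; exact/negP.
Qed.

(** If the covariance is degenerate, one coordinate is almost surely a linear
    combination of the others and can be dropped. *)
Lemma gaussian_indep n (phi : 'I_n -> testfun R dim) (B0 : set R)
    (C : set (n.-tuple R)) :
  (forall i, cov (phi i) chi = 0) -> measurable B0 -> measurable C ->
  (P ([set o | B0 (w o chi)] `&` [set o | C [tuple w o (phi i) | i < n]]) =
   P [set o | B0 (w o chi)] * P [set o | C [tuple w o (phi i) | i < n]])%E.
Proof.
move=> + mB0.
have mE : measurable [set o | B0 (w o chi)].
  by rewrite -[X in measurable X]setTI; exact: (gaussian_meas mw).
elim: n phi C => [|n IH] phi C c0 mC.
  apply: (independent_generated (mYt phi) mE (@measurable_tuple_rectangle _ _ _)
    (@tuple_rectangle_setI _ _ _) (@tuple_rectangle_setT _ _ _)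
    (@measurable_tuple_generated _ _ _)) => // _ [B mB ->].
  have -> : Yt phi @^-1` [set z | forall i, B i (tnth z i)] = setT.
    by apply/seteqP; split=> o // _ [].
  by rewrite setIT probability_setT mule1.
have [uS|] := boolP (cov_mx phi \in unitmx).
  apply: (independent_generated (mYt phi) mE (@measurable_tuple_rectangle _ _ _)
    (@tuple_rectangle_setI _ _ _) (@tuple_rectangle_setT _ _ _)
    (@measurable_tuple_generated _ _ _)) => // _ [B mB ->].
  have -> : Yt phi @^-1` [set z | forall i, B i (tnth z i)] =
      [set o | forall i, B i (w o (phi i))].
    apply/seteqP; split=> o /= h i; have := h i; by rewrite tnth_mktuple.
  exact: gaussian_indep_unit.
rewrite -row_free_unit -kermx_eq0 => /rowV0Pn[a /sub_kermxP aS a0].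
have [i0 ai0] : exists i, a 0 i != 0.
  apply: contrapT => h; move/eqP: a0; apply; apply/rowP => i; rewrite mxE.
  by apply/eqP/negPn/negP => ki; apply: h; exists i.
pose psi := \sum_i a 0 i *: phi i.
have psi0 : cov psi psi = 0.
  rewrite {1}/psi field_cov_suml// big1// => i _; rewrite field_covZl//.
  rewrite field_covC /psi field_cov_suml//.
  have := congr1 (fun M : 'rV[R]_n.+1 => M 0 i) aS; rewrite !mxE => E.
  rewrite [X in _ * X](_ : _ = 0) ?mulr0// -[RHS]E.
  by apply: eq_bigr => j _; rewrite mxE field_covZl.
pose N := [set o | w o psi != 0]; have PN : P N = 0%E by exact: gaussian_degenerate.
have mN : measurable N.
  have := emeasurable_neq measurableT ((measurable_EFinP _ _).2 (gaussian_meas mw psi)) 0%E.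
  by rewrite setTI.
pose phi' j := phi (lift i0 j).
pose ins (y : n.-tuple R) : n.+1.-tuple R := [tuple
  if unlift i0 i is Some j then tnth y j
  else - (a 0 i0)^-1 * \sum_(j < n) a 0 (lift i0 j) * tnth y j | i < n.+1].
have mins : measurable_fun setT ins.
  apply/measurable_fun_tnthP => i; rewrite /ins.
  case E : (unlift i0 i) => [j|].
    rewrite (_ : _ \o _ = fun y : n.-tuple R => tnth y j).
      exact: measurable_tnth.
    by apply/funext => y /=; rewrite tnth_mktuple E.
  rewrite (_ : _ \o _ = fun y : n.-tuple R =>
    - (a 0 i0)^-1 * \sum_(j < n) a 0 (lift i0 j) * tnth y j).
    apply: measurable_funM; first exact: measurable_cst.
    apply: measurable_sum => j; apply: measurable_funM; first exact: measurable_cst.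
    exact: measurable_tnth.
  by apply/funext => y /=; rewrite tnth_mktuple E.
have insE o : ~ N o -> [tuple w o (phi i) | i < n.+1] = ins [tuple w o (phi' i) | i < n].
  move=> /negP; rewrite negbK => /eqP; rewrite /psi dist_sum => E.
  apply/eq_from_tnth => i; rewrite !tnth_mktuple.
  case: unliftP => [j ->|->]; first by rewrite tnth_mktuple.
  move: E; rewrite (bigD1_ord i0)//= distZ => /eqP; rewrite addr_eq0 => /eqP E.
  rewrite -[LHS](mulKf ai0) E mulrN mulNr; congr (- (_ * _)).
  by apply: eq_bigr => j _; rewrite tnth_mktuple distZ.
have mC' : measurable (ins @^-1` C) by rewrite -[X in measurable X]setTI; exact: mins.
have mYC : measurable [set o | C [tuple w o (phi i) | i < n.+1]].
  by rewrite -[X in measurable X]setTI; exact: mYt.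
have mYC' : measurable [set o | (ins @^-1` C) [tuple w o (phi' i) | i < n]].
  by rewrite -[X in measurable X]setTI; exact: (mYt phi').
have E1 : P [set o | C [tuple w o (phi i) | i < n.+1]] =
    P [set o | (ins @^-1` C) [tuple w o (phi' i) | i < n]].
  apply: (measure_eq_off_null mYC mYC' mN PN).
  by apply/seteqP; split=> o /= [h No]; move: h; rewrite insE.
have E2 : P ([set o | B0 (w o chi)] `&` [set o | C [tuple w o (phi i) | i < n.+1]]) =
    P ([set o | B0 (w o chi)] `&` [set o | (ins @^-1` C) [tuple w o (phi' i) | i < n]]).
  apply: (measure_eq_off_null (measurableI _ _ mE mYC) (measurableI _ _ mE mYC') mN PN).
  by apply/seteqP; split=> o /= [[h0 h] No]; split=> //; split=> //; move: h; rewrite insE.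
by rewrite E1 E2; apply: IH => // i; exact: c0.
Qed.

End gaussian_independence.

(** * The Cameron-Martin theorem *)

Section dist_pi_system.
Context {R : realType} {dim : nat}.

(** Cylinders over finitely many test functions are closed under intersection;
    those over a single one are not. *)
Definition dist_finite_cylinder : set (set (dist R dim)) :=
  [set A | exists n (phi : 'I_n -> testfun R dim), exists2 C : set (n.-tuple R),
    measurable C & A = [set u : dist R dim | C [tuple u (phi i) | i < n]]].

Lemma measurable_finite_eval n (phi : 'I_n -> testfun R dim) :
  measurable_fun setT (fun u : dist R dim => [tuple u (phi i) | i < n]).
Proof.
apply/measurable_fun_tnthP => i.
rewrite (_ : _ \o _ = fun u : dist R dim => u (phi i)).
  exact: measurable_dist_eval.
by apply/funext => u /=; rewrite tnth_mktuple.
Qed.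

Lemma measurable_dist_finite_cylinder : dist_finite_cylinder `<=` measurable.
Proof.
move=> _ [n [phi [C mC ->]]]; rewrite -[X in measurable X]setTI.
exact: measurable_finite_eval.
Qed.

Lemma dist_finite_cylinder_setI : setI_closed dist_finite_cylinder.
Proof.
move=> _ _ [n [phi [C mC ->]]] [p [psi [D mD ->]]].
exists (n + p)%N.
exists (fun i => match fintype.split i with inl j => phi j | inr j => psi j end).
pose l (z : (n + p).-tuple R) := [tuple tnth z (lshift p i) | i < n].
pose r (z : (n + p).-tuple R) := [tuple tnth z (rshift n i) | i < p].
have ml : measurable_fun setT l.
  apply/measurable_fun_tnthP => i.
  rewrite (_ : _ \o _ = fun z : (n + p).-tuple R => tnth z (lshift p i)).
    exact: measurable_tnth.
  by apply/funext => u /=; rewrite tnth_mktuple.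
have mr : measurable_fun setT r.
  apply/measurable_fun_tnthP => i.
  rewrite (_ : _ \o _ = fun z : (n + p).-tuple R => tnth z (rshift n i)).
    exact: measurable_tnth.
  by apply/funext => u /=; rewrite tnth_mktuple.
exists (([set: _] `&` l @^-1` C) `&` ([set: _] `&` r @^-1` D)).
  by apply: measurableI; [exact: ml|exact: mr].
apply/seteqP; rewrite !setTI; split=> u /=.
  have -> : l [tuple u match fintype.split i with inl j => phi j | inr j => psi j end | i < n + p] =
    [tuple u (phi i) | i < n].
    by apply/eq_from_tnth => i; rewrite !tnth_mktuple (unsplitK (inl _ i)).
  have -> : r [tuple u match fintype.split i with inl j => phi j | inr j => psi j end | i < n + p] =
    [tuple u (psi i) | i < p].
    by apply/eq_from_tnth => i; rewrite !tnth_mktuple (unsplitK (inr _ i)).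
  by [].
have -> : l [tuple u match fintype.split i with inl j => phi j | inr j => psi j end | i < n + p] =
  [tuple u (phi i) | i < n].
  by apply/eq_from_tnth => i; rewrite !tnth_mktuple (unsplitK (inl _ i)).
have -> : r [tuple u match fintype.split i with inl j => phi j | inr j => psi j end | i < n + p] =
  [tuple u (psi i) | i < p].
  by apply/eq_from_tnth => i; rewrite !tnth_mktuple (unsplitK (inr _ i)).
by [].
Qed.

Lemma dist_finite_cylinder_setT : dist_finite_cylinder setT.
Proof. by exists 0%N, (fun=> 0), setT => //; apply/seteqP; split. Qed.

Lemma measurable_dist_generated : measurable `<=` <<s dist_finite_cylinder >>.
Proof.
apply: smallest_sub; first exact: smallest_sigma_algebra.
move=> _ [phi [B [mB ->]]]; apply: sub_sigma_algebra.
exists 1%N, (fun=> phi), ([set: _] `&` (fun z : 1.-tuple R => tnth z ord0) @^-1` B).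
  by apply: measurable_tnth.
by rewrite setTI; apply/seteqP; split=> u /=; rewrite tnth_mktuple.
Qed.

Lemma measurable_dist_add : measurable_fun setT
  (fun z : dist R dim * dist R dim => z.1 + z.2).
Proof.
apply: measurable_distP => phi.
apply: (measurable_funD (f := fun z : dist R dim * dist R dim => z.1 phi)
  (g := fun z : dist R dim * dist R dim => z.2 phi)).
  by apply: measurable_dist_comp; exact: measurable_fst.
by apply: measurable_dist_comp; exact: measurable_snd.
Qed.

Lemma measurable_dist_line d (T : measurableType d) (X : T -> dist R dim)
    (h : T -> R) (eta : dist R dim) :
  measurable_fun setT X -> measurable_fun setT h ->
  measurable_fun setT (fun o => X o + h o *: eta).
Proof.
move=> mX mh; apply: measurable_distP => phi.
apply: (measurable_funD (f := fun o => X o phi) (g := fun o => h o * eta phi)).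
  exact: measurable_dist_comp.
by apply: measurable_funM => //; exact: measurable_cst.
Qed.

End dist_pi_system.

Section cameron_martin.
Context {R : realType} {dim : nat} d (T : measurableType d) (P : probability T R).
Variable w : T -> dist R dim.
Implicit Types phi psi : testfun R dim.
Hypothesis mw : measurable_fun setT w.
Hypothesis gw : forall n (phi : 'I_n -> testfun R dim),
  gaussian_vector P (fun i o => w o (phi i)).
Variable chi : testfun R dim.
Local Notation cov := (field_cov P w).
Hypothesis chi1 : cov chi chi = 1.
Local Notation eta := (cm_direction mw gw chi1).

Let residual o : dist R dim := w o + (- w o chi) *: eta.

Let residualE o phi : residual o phi = w o (phi - cov phi chi *: chi).
Proof.
by rewrite distE_add distE_scale cm_directionE distB distZ mulNr mulrC.
Qed.

Let mxi : measurable_fun setT (fun o => w o chi).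
Proof. exact: (gaussian_meas mw). Qed.

Let mresidual : measurable_fun setT residual.
Proof.
apply: (measurable_dist_line (h := fun o => - w o chi)) => //.
exact: measurableT_comp.
Qed.

(** The residual is uncorrelated with [w chi], hence independent of it on every
    finite-dimensional cylinder. *)
Lemma residual_indep (A : set R) (B : set (dist R dim)) :
  measurable A -> measurable B ->
  (P ((fun o => w o chi) @^-1` A `&` residual @^-1` B) =
   P ((fun o => w o chi) @^-1` A) * P (residual @^-1` B))%E.
Proof.
move=> mA; move: B.
have mE : measurable ((fun o => w o chi) @^-1` A).
  by rewrite -[X in measurable X]setTI; exact: mxi.
apply: (independent_generated mresidual mE measurable_dist_finite_cylinder
  dist_finite_cylinder_setI dist_finite_cylinder_setT measurable_dist_generated).
move=> _ [n [phi [C mC ->]]].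
pose phi' i := phi i - cov (phi i) chi *: chi.
have -> : residual @^-1` [set u | C [tuple u (phi i) | i < n]] =
    [set o | C [tuple w o (phi' i) | i < n]].
  apply/seteqP; split=> o /=.
    rewrite (_ : [tuple residual o (phi i) | i < n] = [tuple w o (phi' i) | i < n])//.
    by apply/eq_from_tnth => i; rewrite !tnth_mktuple residualE.
  rewrite (_ : [tuple w o (phi' i) | i < n] = [tuple residual o (phi i) | i < n])//.
  by apply/eq_from_tnth => i; rewrite !tnth_mktuple residualE.
apply: (gaussian_indep mw gw chi1) => // i.
by rewrite /phi' field_covBl// field_covZl// chi1 mulr1 subrr.
Qed.

(** Completing the square in the exponent translates the standard normal
    density by [h]. *)
Lemma gaussian_shift1 (h : R) (F : R -> \bar R) :
  measurable_fun setT F -> (forall x, 0 <= F x)%E ->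
  (\int[P]_o ((expR (h * w o chi - h ^+ 2 / 2))%:E * F (w o chi)) =
   \int[P]_o F (w o chi + h)%R)%E.
Proof.
move=> mF F0.
pose g (x : R) : R := centered_normal_pdf 1 x.
have mg : measurable_fun [set: R] g.
  rewrite /g /centered_normal_pdf; apply: measurable_funM; last exact: measurable_cst.
  apply: measurableT_comp => //; apply: measurable_funM; last exact: measurable_cst.
  apply: measurableT_comp => //; apply: measurable_funM; last exact: measurable_cst.
  exact: measurable_funX.
have g0 x : 0 <= g x by rewrite divr_ge0 ?expR_ge0// sqrtr_ge0.
pose xi : {RV P >-> measurableTypeR R} := HB.pack (fun o => w o chi)
  (isMeasurableFun.Build _ _ T (measurableTypeR R) (fun o => w o chi) mxi).
have lawE (f : R -> \bar R) : measurable_fun setT f -> (forall x, 0 <= f x)%E ->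
    (\int[P]_o f (w o chi) = \int[lebesgue_measure]_x (f x * (g x)%:E))%E.
  move=> mf f0.
  transitivity (\int[distribution P xi]_x f x)%E; first by rewrite ge0_integral_distribution.
  apply: (@ge0_integral_density _ (measurableTypeR R) R lebesgue_measure
    (distribution P xi) g) => // A mA.
  have v0 : 0 < cov chi chi by rewrite chi1.
  by have := gaussian_law1 gw v0 mA; rewrite chi1.
have mexp : measurable_fun [set: R] (fun x : R => (expR (h * x - h ^+ 2 / 2))%:E : \bar R).
  apply/measurable_EFinP; apply: measurableT_comp => //; apply: measurable_funB.
    by apply: measurable_funM.
  exact: measurable_cst.
have mFh : measurable_fun setT (fun x : R => F (x + h)).
  by apply: measurableT_comp => //; exact: measurable_funD.
rewrite (lawE (fun x => F (x + h)))//.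
rewrite (lawE (fun x => (expR (h * x - h ^+ 2 / 2))%:E * F x)%E); last 2 first.
- exact: emeasurable_funM.
- by move=> x; rewrite mule_ge0// lee_fin expR_ge0.
rewrite -(ge0_integral_translation h (f := fun x => ((expR (h * x - h ^+ 2 / 2))%:E * F x * (g x)%:E)%E)).
- apply: eq_integral => x _; rewrite muleC muleA -EFinM [RHS]muleC; congr (_%:E * _)%E.
  rewrite /g /centered_normal_pdf mulrAC -expRD; congr (expR _ / _); by field.
- apply: emeasurable_funM; first exact: emeasurable_funM.
  exact/measurable_EFinP.
- by move=> x; rewrite !mule_ge0 ?lee_fin ?expR_ge0//.
Qed.

(** Cameron-Martin: [w] is the sum of its residual and of [w chi *: eta],
    which are independent; translating [w] by [h *: eta] translates only the
    one-dimensional Gaussian variable [w chi]. *)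
Theorem cameron_martin (h : R) (F : dist R dim -> \bar R) :
  measurable_fun setT F -> (forall x, 0 <= F x)%E ->
  (\int[P]_o ((expR (h * w o chi - h ^+ 2 / 2))%:E * F (w o)) =
   \int[P]_o F (w o + h *: eta)%R)%E.
Proof.
move=> mF F0.
have wE o a : w o + a *: eta = residual o + (w o chi + a) *: eta.
  by rewrite /residual scalerDl scaleNr addrA subrK.
have mline a : measurable_fun setT
    (fun z : R * dist R dim => F (z.2 + (z.1 + a) *: eta)).
  apply: measurableT_comp => //.
  apply: (measurable_dist_line (X := snd) (h := fun z : R * dist R dim => z.1 + a)) => //.
  apply: measurable_funD; [exact: measurable_fst|exact: measurable_cst].
pose f (z : R * dist R dim) :=
  ((expR (h * z.1 - h ^+ 2 / 2))%:E * F (z.2 + (z.1 + 0)%R *: eta)%R)%E.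
have mf : measurable_fun setT f.
  apply: emeasurable_funM => //; apply/measurable_EFinP; apply: measurableT_comp => //.
  apply: measurable_funB; last exact: measurable_cst.
  by apply: measurable_funM => //; exact: measurable_fst.
have f0 z : (0 <= f z)%E by rewrite mule_ge0// lee_fin expR_ge0.
pose f' (z : R * dist R dim) := F (z.2 + (z.1 + h) *: eta).
transitivity (\int[P]_o f (w o chi, residual o))%E.
  apply: eq_integral => o _; rewrite /f /=; congr (_ * F _)%E.
  by rewrite -wE scale0r addr0.
transitivity (\int[P]_o f' (w o chi, residual o))%E; last first.
  by apply: eq_integral => o _; rewrite /f' /= -wE.
rewrite (ge0_integral_independent mxi mresidual residual_indep mf f0).
rewrite (ge0_integral_independent mxi mresidual residual_indep (mline h) (fun=> F0 _)).
apply: eq_integral => o' _.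
rewrite -(gaussian_shift1 h (F := fun x => F (residual o' + x *: eta))).
- by apply: eq_integral => o _; rewrite /f /= addr0.
- apply: measurableT_comp => //.
  by apply: (measurable_dist_line (X := fun=> residual o') (h := idfun));
    [exact: measurable_cst|exact: measurable_id].
- by [].
Qed.

End cameron_martin.

(** * Shifting the noise of a sample *)

Section independent_coordinates.
Context {R : realType} d (T : measurableType d) (P : probability T R).
Context d' (D : measurableType d') (K : nat) (V : 'I_K -> T -> D).
Hypothesis mV : forall k, measurable_fun setT (V k).
Hypothesis iV : mutually_independent P V.

Definition replace (k : 'I_K) (x : D) (z : K.-tuple D) : K.-tuple D :=
  [tuple if j == k then x else tnth z j | j < K].

Lemma tnth_replace k x z j :
  tnth (replace k x z) j = if j == k then x else tnth z j.
Proof. by rewrite tnth_mktuple. Qed.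

Definition sample (o : T) : K.-tuple D := [tuple V k o | k < K].

Lemma measurable_sample : measurable_fun setT sample.
Proof.
apply/measurable_fun_tnthP => k.
rewrite (_ : _ \o _ = V k)//; apply/funext => o /=.
by rewrite tnth_mktuple.
Qed.

Lemma measurable_replace d1 (T1 : measurableType d1) k (x : T1 -> D)
    (z : T1 -> K.-tuple D) :
  measurable_fun setT x -> measurable_fun setT z ->
  measurable_fun setT (fun y => replace k (x y) (z y)).
Proof.
move=> mx mz; apply/measurable_fun_tnthP => j.
have [jk|jk] := boolP (j == k).
  rewrite (_ : _ \o _ = x)//; apply/funext => y /=.
  by rewrite tnth_replace jk.
rewrite (_ : _ \o _ = fun y => tnth (z y) j).
  by apply: (measurableT_comp (measurable_tnth _) mz).
by apply/funext => y /=; rewrite tnth_replace (negbTE jk).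
Qed.

Lemma independent_rest k (x0 : D) (A : set D) (B : set (K.-tuple D)) :
  measurable A -> measurable B ->
  (P (V k @^-1` A `&` (fun o => replace k x0 (sample o)) @^-1` B) =
   P (V k @^-1` A) * P ((fun o => replace k x0 (sample o)) @^-1` B))%E.
Proof.
move=> mA; move: B.
have mE : measurable (V k @^-1` A) by rewrite -[X in measurable X]setTI; exact: mV.
have mrest : measurable_fun setT (fun o => replace k x0 (sample o)).
  by apply: measurable_replace; [exact: measurable_cst|exact: measurable_sample].
apply: (independent_generated mrest mE (@measurable_tuple_rectangle _ _ _)
    (@tuple_rectangle_setI _ _ _) (@tuple_rectangle_setT _ _ _)
    (@measurable_tuple_generated _ _ _)) => // _ [B mB ->].
have [Bk|nBk] := pselect (B k x0); last first.
  have -> : (fun o => replace k x0 (sample o)) @^-1` [set z | forall i, B i (tnth z i)] = set0.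
    by apply/seteqP; split=> o //= /(_ k); rewrite tnth_replace eqxx.
  by rewrite setI0 measure0 mule0.
pose B1 (C : set D) j := if j == k then C else B j.
have mB1 C : measurable C -> forall j, measurable (B1 C j).
  by move=> mC j; rewrite /B1; case: ifP.
have -> : (fun o => replace k x0 (sample o)) @^-1` [set z | forall i, B i (tnth z i)] =
    [set o | forall j, B1 setT j (V j o)].
  apply/seteqP; split=> o /= h j; have := h j; rewrite /B1 tnth_replace tnth_mktuple.
    by case: eqVneq.
  by case: eqVneq => // ->.
have -> : V k @^-1` A `&` [set o | forall j, B1 setT j (V j o)] =
    [set o | forall j, B1 A j (V j o)].
  apply/seteqP; split=> o /=.
    by move=> [Ao h] j; have := h j; rewrite /B1; case: eqVneq => // ->.
  move=> h; split; first by have := h k; rewrite /B1 eqxx.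
  by move=> j; have := h j; rewrite /B1; case: eqVneq.
rewrite (iV (mB1 _ mA)) (iV (mB1 _ measurableT)).
rewrite (bigD1 k)//= [in RHS](bigD1 k)//= /B1 eqxx.
rewrite preimage_setT probability_setT mul1e; congr (_ * _)%E.
by apply: eq_bigr => j /negbTE ->.
Qed.

End independent_coordinates.

Section shifted_samples.
Context {R : realType} {dim : nat} d (T : measurableType d) (P : probability T R).
Local Notation D := (dist R dim).
Context (N : nat) (V : 'I_(N + N) -> T -> D).
Hypothesis mV : forall k, measurable_fun setT (V k).
Hypothesis iV : mutually_independent P V.
Variables (chi : testfun R dim) (eta : D).
Hypothesis cmV : forall (i : 'I_N) (h : R) (F : D -> \bar R),
  measurable_fun setT F -> (forall x, 0 <= F x)%E ->
  (\int[P]_o ((expR (h * V (rshift N i) o chi - h ^+ 2 / 2))%:E * F (V (rshift N i) o)) =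
   \int[P]_o F (V (rshift N i) o + h *: eta)%R)%E.
Variables (h : D -> R).
Hypothesis mh : measurable_fun setT h.
Implicit Types (z : (N + N).-tuple D) (Phi : (N + N).-tuple D -> \bar R).

Let ht i z : R := h (tnth z (lshift N i)).
Let noise i z : D := tnth z (rshift N i).

Let mht i : measurable_fun setT (ht i).
Proof. exact: (measurableT_comp mh (measurable_tnth _)). Qed.

Let mnoise i : measurable_fun setT (noise i).
Proof. exact: measurable_tnth. Qed.

Definition shift_noise1 i z := replace (rshift N i) (noise i z + ht i z *: eta) z.

Lemma measurable_shift_noise1 i : measurable_fun setT (shift_noise1 i).
Proof.
apply: measurable_replace; last exact: measurable_id.
exact: measurable_dist_line.
Qed.

Definition shift_weight i z : R := expR (ht i z * noise i z chi - ht i z ^+ 2 / 2).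

Lemma measurable_shift_weight i : measurable_fun setT (shift_weight i).
Proof.
apply: measurableT_comp => //; apply: measurable_funB.
  by apply: measurable_funM => //; exact: measurable_dist_comp.
by apply: measurable_funM; [exact: measurable_funX|exact: measurable_cst].
Qed.

(** The size of the shift is a function of the input, which is independent of the
    noise: the one-variable formula applies with all other variables frozen. *)
Lemma change_of_measure1 i Phi :
  measurable_fun setT Phi -> (forall z, 0 <= Phi z)%E ->
  (\int[P]_o ((shift_weight i (sample V o))%:E * Phi (sample V o)) =
   \int[P]_o Phi (shift_noise1 i (sample V o)))%E.
Proof.
move=> mPhi Phi0; pose k := rshift N i.
(* the other variables, completed by a dummy value at [k] *)
pose rest o := replace k (0 : D) (sample V o).
have mrest : measurable_fun setT rest.
  by apply: measurable_replace; [exact: measurable_cst|exact: measurable_sample].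
have lk j : (lshift N j == k) = false by apply/eqP => /(congr1 val) /= E; have := ltn_ord j; rewrite E ltnNge leq_addr.
pose f (y : D * (N + N).-tuple D) :=
  ((expR (ht i y.2 * y.1 chi - ht i y.2 ^+ 2 / 2))%:E * Phi (replace k y.1 y.2))%E.
pose f' (y : D * (N + N).-tuple D) :=
  Phi (replace k (y.1 + ht i y.2 *: eta) y.2).
have mht2 : measurable_fun setT (fun y : D * (N + N).-tuple D => ht i y.2).
  by apply: measurableT_comp => //; exact: measurable_snd.
have mf : measurable_fun setT f.
  apply: emeasurable_funM.
    apply/measurable_EFinP; apply: measurableT_comp => //; apply: measurable_funB.
      apply: measurable_funM => //; apply: measurable_dist_comp; exact: measurable_fst.
    by apply: measurable_funM; [exact: measurable_funX|exact: measurable_cst].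
  apply: measurableT_comp => //; apply: measurable_replace;
    [exact: measurable_fst|exact: measurable_snd].
have mf' : measurable_fun setT f'.
  apply: measurableT_comp => //; apply: measurable_replace; last exact: measurable_snd.
  by apply: measurable_dist_line => //; exact: measurable_fst.
have f0 y : (0 <= f y)%E by rewrite mule_ge0// lee_fin expR_ge0.
have htE o : ht i (rest o) = ht i (sample V o) by rewrite /ht tnth_replace lk.
have repE x o : replace k x (rest o) = replace k x (sample V o).
  by apply/eq_from_tnth => j; rewrite !tnth_replace; case: eqP.
have VE o : V k o = noise i (sample V o) by rewrite /noise tnth_mktuple.
transitivity (\int[P]_o f (V k o, rest o))%E.
  apply: eq_integral => o _; rewrite /f /= htE repE VE; congr (_ * Phi _)%E.
  apply/eq_from_tnth => j; rewrite tnth_replace; case: eqP => // ->; by rewrite /noise.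
transitivity (\int[P]_o f' (V k o, rest o))%E; last first.
  by apply: eq_integral => o _; rewrite /f' /= htE repE VE.
have ind := @independent_rest _ _ _ _ _ _ _ _ mV iV k (0 : D).
rewrite (ge0_integral_independent (mV k) mrest ind mf f0).
rewrite (ge0_integral_independent (mV k) mrest ind mf' (fun=> Phi0 _)).
apply: eq_integral => o' _; rewrite /f /f' /=.
apply: (cmV i (ht i (rest o')) (F := fun x => Phi (replace k x (rest o')))).
  apply: measurableT_comp => //; apply: measurable_replace => //; exact: measurable_cst.
by [].
Qed.

(** The noises are shifted one after the other: shifting one of them affects
    neither the inputs nor the weights of the others. *)
Lemma change_of_measure_seq (s : seq 'I_N) Phi : uniq s ->
  measurable_fun setT Phi -> (forall z, 0 <= Phi z)%E ->
  (\int[P]_o ((\prod_(i <- s) shift_weight i (sample V o))%:E * Phi (sample V o)) =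
   \int[P]_o Phi (foldr shift_noise1 (sample V o) s))%E.
Proof.
elim: s Phi => [|i s IH] Phi /=.
  by move=> _ mPhi Phi0; apply: eq_integral => o _; rewrite big_nil mul1e.
move=> /andP[ins us] mPhi Phi0.
have lk (j i' : 'I_N) : (lshift N j == rshift N i') = false.
  by apply/eqP => /(congr1 val) /= E; have := ltn_ord j; rewrite E ltnNge leq_addr.
have wE j z : j \in s -> shift_weight j (shift_noise1 i z) = shift_weight j z.
  move=> js; rewrite /shift_weight /ht /noise /shift_noise1 !tnth_replace lk.
  rewrite (inj_eq (@rshift_inj _ _)); case: eqP => // ji.
  by rewrite ji (negbTE ins) in js.
have mprod : measurable_fun setT (fun z => \prod_(j <- s) shift_weight j z).
  apply: measurable_prod => j _; exact: measurable_shift_weight.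
have prod0 z : 0 <= \prod_(j <- s) shift_weight j z.
  by apply: prodr_ge0 => j _; exact: expR_ge0.
transitivity (\int[P]_o ((shift_weight i (sample V o))%:E *
    ((\prod_(j <- s) shift_weight j (sample V o))%:E * Phi (sample V o))))%E.
  by apply: eq_integral => o _; rewrite big_cons EFinM muleA.
pose Psi z := ((\prod_(j <- s) shift_weight j z)%:E * Phi z)%E.
have mPsi : measurable_fun setT Psi.
  by apply: emeasurable_funM => //; exact/measurable_EFinP.
have Psi0 z : (0 <= Psi z)%E by rewrite mule_ge0// lee_fin.
have mPhi1 : measurable_fun setT (fun z => Phi (shift_noise1 i z)).
  exact: (measurableT_comp mPhi (measurable_shift_noise1 i)).
rewrite -[LHS]/(\int[P]_o ((shift_weight i (sample V o))%:E * Psi (sample V o)))%E.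
rewrite (change_of_measure1 i mPsi Psi0).
rewrite -(IH _ us mPhi1 (fun=> Phi0 _)).
apply: eq_integral => o _; rewrite /Psi; congr (_%:E * _)%E.
by apply: eq_big_seq => j js; rewrite wE.
Qed.

Definition shift_noise z : (N + N).-tuple D :=
  [tuple match fintype.split k with
   | inl _ => tnth z k
   | inr i => tnth z k + ht i z *: eta end | k < N + N].

Lemma measurable_shift_noise : measurable_fun setT shift_noise.
Proof.
apply/measurable_fun_tnthP => k.
case E: (fintype.split k) => [i|i].
  rewrite (_ : _ \o _ = fun z => tnth z k); first exact: measurable_tnth.
  by apply/funext => z /=; rewrite tnth_mktuple E.
rewrite (_ : _ \o _ = fun z => tnth z k + ht i z *: eta).
  by apply: measurable_dist_line => //; exact: measurable_tnth.
by apply/funext => z /=; rewrite tnth_mktuple E.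
Qed.

Lemma change_of_measure Phi :
  measurable_fun setT Phi -> (forall z, 0 <= Phi z)%E ->
  (\int[P]_o ((\prod_(i < N) shift_weight i (sample V o))%:E * Phi (sample V o)) =
   \int[P]_o Phi (shift_noise (sample V o)))%E.
Proof.
move=> mPhi Phi0.
rewrite (change_of_measure_seq (index_enum_uniq _) mPhi Phi0).
apply: eq_integral => o _; congr Phi; set z := sample V o.
have foldE (s : seq 'I_N) : uniq s -> forall k, tnth (foldr shift_noise1 z s) k =
    match fintype.split k with
   | inl _ => tnth z k
   | inr i => if i \in s then tnth z k + ht i z *: eta else tnth z k end.
  elim: s => [|i s IH] us k /=; first by case: (fintype.split k).
  move: us => /= /andP[ins us].
  have {}IH := IH us.
  rewrite tnth_replace /noise /ht !IH.
  rewrite (unsplitK (inl _ i)) (unsplitK (inr _ i)) (negbTE ins).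
  case: splitP => j kj.
    case: eqP => // ki; have := ltn_ord j.
    by rewrite -kj ki /= ltnNge leq_addr.
  have -> : k = rshift N j by apply/val_inj.
  rewrite (inj_eq (@rshift_inj _ _)) inE.
  by case: eqVneq => [->|].
apply/eq_from_tnth => k; rewrite foldE ?index_enum_uniq// [RHS]tnth_mktuple.
by case: (fintype.split k) => // i; rewrite mem_index_enum.
Qed.

End shifted_samples.

(** * Two-point lower bound *)

Section two_points.
Context {R : realType} {dim : nat} d (T : measurableType d) (P : probability T R).
Local Notation D := (dist R dim).

(** The triangle inequality bounds the weighted sum of the two losses from below
    by [2 b min p m], and [min p m >= q - (p + m) / 4]. *)
Lemma two_point_pointwise (p m q g b : R) : 0 < p -> 0 < m -> 0 <= q -> 0 <= b ->
  q ^+ 2 = p * m ->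
  2 * b * q <= p * `|g - b| + m * `|g + b| + b / 2 * (p + m).
Proof.
move=> p0 m0 q0 b0 qE.
have tri : 2 * b <= `|g - b| + `|g + b|.
  have -> : 2 * b = (g + b) - (g - b) by ring.
  by rewrite (le_trans (ler_norm _))// (le_trans (ler_normB _ _))// addrC.
have key (x y : R) : 0 < x -> 0 < y -> q ^+ 2 = x * y -> 4 * q <= 5 * x + y.
  move=> x0 y0 E; have yx0 : 0 <= 5 * x + y by rewrite addr_ge0 ?mulr_ge0 ?ltW.
  rewrite -(@ler_pXn2r _ 2) ?nnegrE ?mulr_ge0// exprMn E.
  by have := sqr_ge0 (x - y); have := mulr_gt0 x0 y0; nra.
have n1 := normr_ge0 (g - b); have n2 := normr_ge0 (g + b).
have [pm|mp] := leP p m.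
  have h := key p m p0 m0 qE.
  have h1 : p * `|g + b| <= m * `|g + b| by rewrite ler_wpM2r.
  have h2 : p * (2 * b) <= p * (`|g - b| + `|g + b|) by rewrite ler_pM2l.
  have h3 : b * (4 * q) <= b * (5 * p + m) by rewrite ler_wpM2l.
  move: h1 h2 h3; set A := `|g - b|; set B := `|g + b|; lra.
have h : 4 * q <= 5 * m + p by apply: key => //; rewrite mulrC.
have h1 : m * `|g - b| <= p * `|g - b| by rewrite ler_wpM2r// ltW.
have h2 : m * (2 * b) <= m * (`|g - b| + `|g + b|) by rewrite ler_pM2l.
have h3 : b * (4 * q) <= b * (5 * m + p) by rewrite ler_wpM2l.
by move: h1 h2 h3; set A := `|g - b|; set B := `|g + b|; lra.
Qed.

Context (N : nat) (V : 'I_(N + N) -> T -> D).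
Hypothesis mV : forall k, measurable_fun setT (V k).
Hypothesis iV : mutually_independent P V.
Variables (chi : testfun R dim) (eta : D).
Hypothesis cmV : forall (i : 'I_N) (h : R) (F : D -> \bar R),
  measurable_fun setT F -> (forall x, 0 <= F x)%E ->
  (\int[P]_o ((expR (h * V (rshift N i) o chi - h ^+ 2 / 2))%:E * F (V (rshift N i) o)) =
   \int[P]_o F (V (rshift N i) o + h *: eta)%R)%E.
Variables (h : D -> R).
Hypothesis mh : measurable_fun setT h.

(** Both shifted experiments have a density with respect to the unshifted one,
    and the product of the two densities is [expR (- H)], where [H] is the sum
    of the squared signals. *)
Lemma two_point (g : (N + N).-tuple D -> R) (b : R) :
  measurable_fun setT g -> 0 <= b ->
  (b%:E <= \int[P]_o (`|g (shift_noise eta h (sample V o)) - b|)%:E +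
           \int[P]_o (`|g (shift_noise eta (\- h) (sample V o)) + b|)%:E +
           b%:E * \int[P]_o (\sum_(i < N) h (V (lshift N i) o) ^+ 2)%:E)%E.
Proof.
move=> mg b0; pose z o := sample V o.
have mz : measurable_fun setT z by exact: measurable_sample.
have mNh : measurable_fun setT (\- h) by exact: measurableT_comp.
pose L1 (y : (N + N).-tuple D) := \prod_(i < N) shift_weight chi h i y.
pose L2 (y : (N + N).-tuple D) := \prod_(i < N) shift_weight chi (\- h) i y.
pose H (y : (N + N).-tuple D) := \sum_(i < N) h (tnth y (lshift N i)) ^+ 2.
have mL1 : measurable_fun setT L1.
  by apply: measurable_prod => i _; exact: measurable_shift_weight.
have mL2 : measurable_fun setT L2.
  by apply: measurable_prod => i _; exact: measurable_shift_weight.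
have mH : measurable_fun setT H.
  apply: measurable_sum => i; apply: measurable_funX.
  exact: (measurableT_comp mh (measurable_tnth _)).
have L10 y : 0 < L1 y by apply: prodr_gt0 => i _; exact: expR_gt0.
have L20 y : 0 < L2 y by apply: prodr_gt0 => i _; exact: expR_gt0.
have H0 y : 0 <= H y by apply: sumr_ge0 => i _; exact: sqr_ge0.
have qE y : expR (- H y / 2) ^+ 2 = L1 y * L2 y.
  rewrite expr2 -expRD.
  have -> : - H y / 2 + - H y / 2 = - H y by field.
  rewrite /L1 /L2 -big_split /= /H -sumrN expR_sum; apply: eq_bigr => i _.
  by rewrite -expRD; congr expR; rewrite /=; field.
have ptw y : 2 * b <= L1 y * `|g y - b| + L2 y * `|g y + b| +
    b / 2 * (L1 y + L2 y) + b * H y.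
  have := @two_point_pointwise _ _ _ (g y) b (L10 y) (L20 y) (expR_ge0 _) b0 (qE y).
  (* the affinity [expR (- H / 2)] is linearized to let the mean of [H] appear *)
  have : b * (1 + - H y / 2) <= b * expR (- H y / 2) by rewrite ler_wpM2l// expR_ge1Dx.
  set A := L1 y * _; set B := L2 y * _; lra.
pose F1 (y : (N + N).-tuple D) : \bar R := (`|g y - b|)%:E.
pose F2 (y : (N + N).-tuple D) : \bar R := (`|g y + b|)%:E.
have mF1 : measurable_fun setT F1.
  by apply/measurable_EFinP; apply: measurableT_comp => //; apply: measurable_funB => //; exact: measurable_cst.
have mF2 : measurable_fun setT F2.
  by apply/measurable_EFinP; apply: measurableT_comp => //; apply: measurable_funD => //; exact: measurable_cst.
have F10 y : (0 <= F1 y)%E by rewrite lee_fin.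
have F20 y : (0 <= F2 y)%E by rewrite lee_fin.
rewrite -(change_of_measure mV iV cmV mh mF1 F10).
rewrite -(change_of_measure mV iV cmV mNh mF2 F20).
have int_cst (c : R) : (\int[P]_o c%:E = c%:E)%E.
  rewrite integral_cst//; apply: etrans (mule1 _); congr (_ * _)%E.
  exact: probability_setT.
have one1 : (\int[P]_o (L1 (z o))%:E = 1)%E.
  apply: etrans (etrans (change_of_measure mV iV cmV mh
    (measurable_cst (1%:E : \bar R)) (fun=> lee01)) (int_cst 1)).
  by apply: eq_integral => o _; rewrite mule1.
have one2 : (\int[P]_o (L2 (z o))%:E = 1)%E.
  apply: etrans (etrans (change_of_measure mV iV cmV mNh
    (measurable_cst (1%:E : \bar R)) (fun=> lee01)) (int_cst 1)).
  by apply: eq_integral => o _; rewrite mule1.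
have HE : (\int[P]_o (\sum_(i < N) h (V (lshift N i) o) ^+ 2)%:E = \int[P]_o (H (z o))%:E)%E.
  apply: eq_integral => o _; congr (_%:E); apply: eq_bigr => i _.
  by rewrite /z /sample tnth_mktuple.
rewrite HE -/z.
have m1 : measurable_fun setT (fun o => (L1 (z o))%:E : \bar R).
  by apply/measurable_EFinP; exact: measurableT_comp.
have m2 : measurable_fun setT (fun o => (L2 (z o))%:E : \bar R).
  by apply/measurable_EFinP; exact: measurableT_comp.
have m3 : measurable_fun setT (fun o => (H (z o))%:E : \bar R).
  by apply/measurable_EFinP; exact: measurableT_comp.
have m4 : measurable_fun setT (fun o => (L1 (z o))%:E * F1 (z o))%E.
  by apply: emeasurable_funM => //; exact: measurableT_comp.
have m5 : measurable_fun setT (fun o => (L2 (z o))%:E * F2 (z o))%E.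
  by apply: emeasurable_funM => //; exact: measurableT_comp.
have g1 o : (0 <= (L1 (z o))%:E * F1 (z o))%E by rewrite mule_ge0// lee_fin ltW.
have g2 o : (0 <= (L2 (z o))%:E * F2 (z o))%E by rewrite mule_ge0// lee_fin ltW.
have g3 o : (0 <= (b / 2)%:E * ((L1 (z o))%:E + (L2 (z o))%:E))%E.
  by apply: mule_ge0; [rewrite lee_fin divr_ge0|rewrite adde_ge0// lee_fin ltW].
have g4 o : (0 <= b%:E * (H (z o))%:E)%E by rewrite mule_ge0// lee_fin.
have intD (f f' : T -> \bar R) : measurable_fun setT f -> (forall o, 0 <= f o)%E ->
    measurable_fun setT f' -> (forall o, 0 <= f' o)%E ->
    (\int[P]_o (f o + f' o) = \int[P]_o f o + \int[P]_o f' o)%E.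
  by move=> mf f0 mf1 f1; rewrite ge0_integralD.
have big : ((2 * b)%:E <= \int[P]_o ((L1 (z o))%:E * F1 (z o)) +
    \int[P]_o ((L2 (z o))%:E * F2 (z o)) + b%:E + b%:E * \int[P]_o (H (z o))%:E)%E.
  have b3 : (\int[P]_o ((b / 2)%:E * ((L1 (z o))%:E + (L2 (z o))%:E)) = b%:E)%E.
    rewrite integralZl_nomeas ?divr_ge0//; last by move=> o; rewrite adde_ge0// lee_fin ltW.
    rewrite intD//; try by move=> o; rewrite lee_fin ltW.
    by rewrite one1 one2 -EFinD -EFinM; congr (_%:E); field.
  rewrite -{1}b3 -integralZl_nomeas//; last by move=> o; rewrite lee_fin.
  have mb3 : measurable_fun setT (fun o => (b / 2)%:E * ((L1 (z o))%:E + (L2 (z o))%:E))%E.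
    by apply: measurable_funeM; exact: emeasurable_funD.
  have mb4 : measurable_fun setT (fun o => b%:E * (H (z o))%:E)%E by exact: measurable_funeM.
  have m45 := emeasurable_funD m4 m5.
  have m453 := emeasurable_funD m45 mb3.
  have g12 o : (0 <= (L1 (z o))%:E * F1 (z o) + (L2 (z o))%:E * F2 (z o))%E.
    by rewrite adde_ge0.
  rewrite -(intD _ _ m4 g1 m5 g2) -(intD _ _ m45 g12 mb3 g3).
  rewrite -(intD _ _ m453 _ mb4 g4); last by move=> o; rewrite adde_ge0.
  apply: (@le_trans _ _ (\int[P]_o (2 * b)%:E)%E).
    by rewrite int_cst.
  apply: le_integral_nomeas => o; first by rewrite lee_fin mulr_ge0.
  by rewrite -!(EFinM, EFinD) lee_fin; exact: ptw.
have : (b%:E + b%:E <= b%:E + (\int[P]_o ((L1 (z o))%:E * F1 (z o)) +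
    \int[P]_o ((L2 (z o))%:E * F2 (z o)) + b%:E * \int[P]_o (H (z o))%:E))%E.
  rewrite -EFinD (_ : b + b = 2 * b); last by ring.
  apply: (le_trans big); rewrite le_eqVlt; apply/orP; left; apply/eqP.
  set A := (\int[P]_o (_ * F1 _))%E; set B := (\int[P]_o (_ * F2 _))%E.
  by rewrite [RHS]addeC -!addeA [(b%:E + _)%E]addeC.
by rewrite leeD2lE.
Qed.

End two_points.

(** * Sobolev norms and pairings of waves *)

Section finite_fourier_support.
Context {R : realType} {d : nat}.
Local Notation D := (dist R d).
Local Notation Zd := ('rV[int]_d).
Implicit Types (k l : Zd) (u v : D) (a : R) (S : seq Zd).

Lemma esum_seq (F : Zd -> R) S : uniq S -> (forall l, 0 <= F l) ->
  (forall l, l \notin S -> F l = 0) ->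
  (\esum_(l in [set: Zd]) (F l)%:E = (\sum_(l <- S) F l)%:E)%E.
Proof.
move=> uS F0 FS.
transitivity (\esum_(l in [set` S]) (F l)%:E)%E.
  rewrite [RHS]esum_mkcond; apply: eq_esum => l _.
  by case: ifPn => // lS; rewrite FS//; apply: contra lS; rewrite mem_setE.
rewrite esum_fset; [|exact: finite_seq|by move=> l _; rewrite lee_fin].
by rewrite -fsbig_seq// sumEFin.
Qed.

Lemma esum_seq_le (F : Zd -> R) S : uniq S -> (forall l, 0 <= F l) ->
  ((\sum_(l <- S) F l)%:E <= \esum_(l in [set: Zd]) (F l)%:E)%E.
Proof.
move=> uS F0; apply: esum_ge; exists [set` S]; first by split; [exact: finite_seq|].
by rewrite -fsbig_seq// sumEFin.
Qed.

Lemma zsum_seq (F : Zd -> R) S : uniq S -> (forall l, l \notin S -> F l = 0) ->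
  zsum F = \sum_(l <- S) F l.
Proof.
move=> uS FS; rewrite /zsum (esum_seq uS); last 2 first.
- by move=> l; rewrite le_max lexx orbT.
- by move=> l /FS ->; rewrite maxxx.
rewrite (esum_seq uS); last 2 first.
- by move=> l; rewrite le_max lexx orbT.
- by move=> l /FS ->; rewrite oppr0 maxxx.
rewrite /= -sumrB; apply: eq_bigr => l _.
by case: (leP (F l) 0) => h1; case: (leP (- F l) 0) => h2; lra.
Qed.

Lemma symbol_ge1 k : 1 <= symbol k :> R.
Proof.
rewrite /symbol lerDl mulr_ge0//; first by rewrite mulr_ge0// sqr_ge0.
by apply: sumr_ge0 => i _; exact: sqr_ge0.
Qed.

Lemma symbol_gt0 k : 0 < symbol k :> R.
Proof. by apply: lt_le_trans (symbol_ge1 k). Qed.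

Lemma symbolN k : symbol (- k) = symbol k :> R.
Proof.
rewrite /symbol; congr (1 + _ * _); apply: eq_bigr => i _.
by rewrite mxE rmorphN sqrrN.
Qed.

Lemma symbol0 : symbol (0 : Zd) = 1 :> R.
Proof.
by rewrite /symbol big1 ?mulr0 ?addr0// => i _; rewrite mxE expr0n.
Qed.

Lemma sqrte_le1 (x : \bar R) : (0 <= x -> (sqrte x <= 1) = (x <= 1))%E.
Proof.
case: x => [r||]//; rewrite lee_fin => r0 /=; rewrite !lee_fin.
rewrite -[X in _ <= X]sqrtr1 ler_sqrt//.
Qed.

Lemma sqrte_ltoo (x : \bar R) : (0 <= x -> (sqrte x < +oo) = (x < +oo))%E.
Proof. by case: x => [r||]//= _; rewrite !ltry. Qed.

Definition energy a u k : R := symbol k `^ a * (reF u k ^+ 2 + imF u k ^+ 2).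

Lemma energy_ge0 a u k : 0 <= energy a u k.
Proof. by rewrite mulr_ge0 ?powR_ge0// addr_ge0 ?sqr_ge0. Qed.

Lemma sobolev_norm_le1 a u :
  (sobolev_norm a u <= 1)%E = (\esum_(k in [set: Zd]) (energy a u k)%:E <= 1)%E.
Proof.
by rewrite /sobolev_norm sqrte_le1//; apply: esum_ge0 => k _; rewrite lee_fin energy_ge0.
Qed.

Lemma sobolevE a u :
  sobolev a u = (\esum_(k in [set: Zd]) (energy a u k)%:E < +oo)%E.
Proof.
rewrite /sobolev /= /sobolev_norm sqrte_ltoo//.
by apply: esum_ge0 => k _; rewrite lee_fin energy_ge0.
Qed.

Lemma unit_ball_sum a u S : uniq S -> (sobolev_norm a u <= 1)%E ->
  \sum_(k <- S) symbol k `^ a * reF u k ^+ 2 <= 1.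
Proof.
move=> uS; rewrite sobolev_norm_le1 => h.
have := le_trans (esum_seq_le uS (@energy_ge0 a u)) h; rewrite lee_fin.
apply: le_trans; apply: ler_sum => k _.
by rewrite ler_wpM2l ?powR_ge0// lerDl sqr_ge0.
Qed.

Lemma reFD u v k : reF (u + v) k = reF u k + reF v k. Proof. by []. Qed.
Lemma reFZ a u k : reF (a *: u) k = a * reF u k. Proof. by []. Qed.
Lemma reF_sum (I : Type) (r : seq I) (Q : pred I) (h : I -> D) k :
  reF (\sum_(i <- r | Q i) h i) k = \sum_(i <- r | Q i) reF (h i) k.
Proof. exact: distE_sum. Qed.
Lemma imF_sum (I : Type) (r : seq I) (Q : pred I) (h : I -> D) k :
  imF (\sum_(i <- r | Q i) h i) k = \sum_(i <- r | Q i) imF (h i) k.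
Proof. by rewrite /imF distE_sum sumrN. Qed.
Lemma imFZ a u k : imF (a *: u) k = a * imF u k.
Proof. by rewrite /imF distE_scale mulrN. Qed.
Lemma reFN u k : reF u (- k) = reF u k. Proof. by rewrite /reF coskN. Qed.

Lemma pairingC u v : pairing u v = pairing v u.
Proof.
rewrite /pairing; congr zsum; apply/funext => k.
by congr (_ + _); exact: mulrC.
Qed.

(** The Fourier coefficients of [cos (2 pi k.x)], seen as a distribution. *)
Definition wave_coef k l : R := ((l == k)%:R + (l == - k)%:R) / 2.

Lemma wave_coef_ge0 k l : 0 <= wave_coef k l.
Proof. by rewrite divr_ge0// addr_ge0. Qed.
Lemma wave_coef_le1 k l : wave_coef k l <= 1.
Proof. by rewrite /wave_coef; do 2 case: eqP => _ /=; lra. Qed.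
Lemma wave_coef_diag k : 2^-1 <= wave_coef k k.
Proof. by rewrite /wave_coef eqxx; case: eqP => _ /=; lra. Qed.

Definition is_wave (psi : Zd -> D) := forall k l,
  reF (psi k) l = wave_coef k l /\ imF (psi k) l = 0.

Variable psi : Zd -> D.
Hypothesis psiP : is_wave psi.
Variable J : finType.
Implicit Types (c : J -> R) (kk : J -> Zd).

Definition wave_comb c kk : D := \sum_j c j *: psi (kk j).

Definition spectrum kk : seq Zd :=
  undup ([seq kk j | j <- enum J] ++ [seq - kk j | j <- enum J]).

Lemma spectrum_uniq kk : uniq (spectrum kk). Proof. exact: undup_uniq. Qed.

Lemma mem_spectrum kk j : kk j \in spectrum kk.
Proof. by rewrite mem_undup mem_cat map_f// mem_enum. Qed.

Lemma mem_spectrumN kk j : - kk j \in spectrum kk.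
Proof.
rewrite mem_undup mem_cat (map_f (fun j => - kk j)) ?orbT//.
by rewrite mem_enum.
Qed.

Lemma sum_seq_delta (F : Zd -> R) S k : uniq S -> k \in S ->
  \sum_(l <- S) F l * (l == k)%:R = F k.
Proof.
move=> uS kS; rewrite (bigD1_seq k)//= eqxx mulr1 big1 ?addr0// => l /negbTE ->.
by rewrite mulr0.
Qed.

Lemma sum_wave_coef (F : Zd -> R) kk j :
  \sum_(l <- spectrum kk) F l * wave_coef (kk j) l = (F (kk j) + F (- kk j)) / 2.
Proof.
rewrite -(sum_seq_delta F (spectrum_uniq kk) (mem_spectrum kk j)).
rewrite -(sum_seq_delta F (spectrum_uniq kk) (mem_spectrumN kk j)).
rewrite -big_split mulr_suml; apply: eq_bigr => l _ /=.
by rewrite -mulrDr mulrA.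
Qed.

Lemma reF_wave_comb c kk l : reF (wave_comb c kk) l = \sum_j c j * wave_coef (kk j) l.
Proof.
by rewrite reF_sum; apply: eq_bigr => j _; rewrite reFZ (psiP _ _).1.
Qed.

Lemma imF_wave_comb c kk l : imF (wave_comb c kk) l = 0.
Proof.
by rewrite imF_sum big1// => j _; rewrite imFZ (psiP _ _).2 mulr0.
Qed.

Lemma reF_wave_comb0 c kk l : l \notin spectrum kk -> reF (wave_comb c kk) l = 0.
Proof.
move=> lS; rewrite reF_wave_comb big1// => j _; rewrite /wave_coef.
have [ek|_] := eqVneq l (kk j); first by rewrite ek mem_spectrum in lS.
have [ek|_] := eqVneq l (- kk j); first by rewrite ek mem_spectrumN in lS.
by rewrite addr0 mul0r mulr0.
Qed.

Lemma pairing_wave_comb u c kk :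
  pairing u (wave_comb c kk) = \sum_j c j * reF u (kk j).
Proof.
rewrite /pairing (zsum_seq (spectrum_uniq kk)); last first.
  by move=> l lS; rewrite reF_wave_comb0// imF_wave_comb !mulr0 addr0.
under eq_bigr do rewrite reF_wave_comb imF_wave_comb mulr0 addr0 mulr_sumr.
rewrite exchange_big; apply: eq_bigr => j _ /=.
under eq_bigr do rewrite mulrCA.
rewrite -mulr_sumr (sum_wave_coef (reF u)) reFN.
by congr (_ * _); field.
Qed.

Lemma sobolev_wave_comb a c kk : sobolev a (wave_comb c kk).
Proof.
rewrite sobolevE (esum_seq (spectrum_uniq kk) (@energy_ge0 a _)) ?ltry// => l lS.
by rewrite /energy reF_wave_comb0// imF_wave_comb expr0n addr0 mulr0.
Qed.

(** Waves whose frequencies are distinct up to sign have disjoint spectra, so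
    that their squared norms add up. *)
Lemma wave_comb_unit_ball a c kk :
  (forall i j, i != j -> kk i != kk j /\ kk i != - kk j) ->
  \sum_j c j ^+ 2 * symbol (kk j) `^ a <= 1 ->
  (sobolev_norm a (wave_comb c kk) <= 1)%E.
Proof.
move=> orth c1; rewrite sobolev_norm_le1.
rewrite (esum_seq (spectrum_uniq kk) (@energy_ge0 a _)); last first.
  by move=> l lS; rewrite /energy reF_wave_comb0// imF_wave_comb expr0n addr0 mulr0.
rewrite lee_fin; apply: le_trans c1.
have b0 i j l : i != j -> wave_coef (kk i) l * wave_coef (kk j) l = 0.
  move=> /orth[ij iNj]; rewrite /wave_coef.
  have [->|li] := eqVneq l (kk i).
    by rewrite (negbTE ij) (negbTE iNj) addr0 mul0r mulr0.
  have [->|lNi] := eqVneq l (- kk i); last by rewrite addr0 !mul0r.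
  rewrite eqr_oppLR (negbTE iNj) (inj_eq oppr_inj) (negbTE ij).
  by rewrite addr0 mul0r mulr0.
apply: (@le_trans _ _ (\sum_(l <- spectrum kk)
    \sum_j c j ^+ 2 * (symbol l `^ a * wave_coef (kk j) l))).
  apply: ler_sum => l _; rewrite /energy imF_wave_comb expr0n addr0 reF_wave_comb.
  have -> : (\sum_j c j * wave_coef (kk j) l) ^+ 2 =
      \sum_j c j ^+ 2 * wave_coef (kk j) l ^+ 2.
    rewrite expr2 mulr_suml; apply: eq_bigr => j _.
    rewrite mulr_sumr (bigD1 j)//= big1 => [|i ij].
      by rewrite addr0; ring.
    by rewrite mulrACA (b0 j i l) ?mulr0// eq_sym.
  rewrite mulr_sumr; apply: ler_sum => j _; rewrite mulrCA ler_wpM2l ?sqr_ge0//.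
  rewrite ler_wpM2l ?powR_ge0// expr2 ler_piMr ?wave_coef_ge0//.
  exact: wave_coef_le1.
rewrite exchange_big /=; apply: ler_sum => j _; rewrite -mulr_sumr.
by rewrite (sum_wave_coef (fun l => symbol l `^ a)) symbolN ler_wpM2l ?sqr_ge0//; lra.
Qed.

End finite_fourier_support.

(** * Operators with prescribed signs *)

Section hypotheses.
Context {R : realType} {d : nat}.
Local Notation D := (dist R d).
Local Notation Zd := ('rV[int]_d).
Implicit Types (k l : Zd) (u v : D) (S : seq Zd).

(** The sum that defines the norm is the supremum of its finite partial sums,
    of which there are countably many. *)
Lemma measurable_sobolev (a : R) : measurable (@sobolev R d a).
Proof.
pose F (B n : nat) : set D := if unpickle n is Some r then
  [set u | \sum_(k <- undup r) energy a u k <= B%:R] else setT.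
have -> : @sobolev R d a = \bigcup_B \bigcap_n F B n.
  apply/seteqP; split=> u; rewrite sobolevE.
    have e0 : (0 <= \esum_(k in [set: Zd]) (energy a u k)%:E)%E.
      by apply: esum_ge0 => k _; rewrite lee_fin energy_ge0.
    move=> fin; exists (Num.truncn (fine (\esum_(k in [set: Zd]) (energy a u k)%:E))).+1 => // n _.
    rewrite /F; case: unpickle => // S /=.
    rewrite (le_trans _ (ltW (truncnS_gt _)))// -lee_fin fineK; last by rewrite ge0_fin_numE.
    by rewrite esum_seq_le ?undup_uniq// => l; exact: energy_ge0.
  move=> [B _ hB]; apply: (@le_lt_trans _ _ (B%:R)%:E); last exact: ltry.
  apply: ge_ereal_sup => _ [A [finA _] <-].
  rewrite fsbig_finite//= sumEFin lee_fin.
  have := hB (pickle (finmap.enum_fset (fset_set A))) Logic.I; rewrite /F pickleK /=.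
  by rewrite undup_id// finmap.fset_uniq.
apply: bigcup_measurable => B _; apply: bigcap_measurable => [|n _]; first by exists 0%N.
rewrite /F; case: unpickle => // S.
have me : measurable_fun setT (fun u : D => \sum_(k <- undup S) energy a u k).
  apply: measurable_sum => k; apply: measurable_funM; first exact: measurable_cst.
  apply: measurable_funD; apply: measurable_funX; first exact: measurable_dist_eval.
  by apply: measurableT_comp => //; exact: measurable_dist_eval.
have -> : [set u | \sum_(k <- undup S) energy a u k <= B%:R] =
    [set: D] `&` (fun u : D => \sum_(k <- undup S) energy a u k) @^-1` `]-oo, B%:R].
  by rewrite setTI; apply/seteqP; split=> u /=; rewrite in_itv.
by apply: me => //; exact: measurable_itv.
Qed.

Variable psi : Zd -> D.
Hypothesis psiP : is_wave psi.
Variable J : finType.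
Implicit Types (th : {ffun J -> bool}) (kk ll : J -> Zd).

Definition pm (b : bool) : R := if b then 1 else -1.

Lemma pm_norm b : `|pm b| = 1. Proof. by case: b; rewrite /pm ?normrN normr1. Qed.

(** The hypotheses to be tested: the wave [ll j] is emitted with amplitude [a]
    and sign [th j] times the coefficient of the input at [kk j]. *)
Definition hyp_op (a : R) kk ll th (u : D) : D :=
  wave_comb psi (fun j => a * pm (th j) * reF u (kk j)) ll.

Lemma hyp_opP a kk ll th (x : R) v u :
  hyp_op a kk ll th (x *: v + u) = x *: hyp_op a kk ll th v + hyp_op a kk ll th u.
Proof.
rewrite /hyp_op /wave_comb scaler_sumr -big_split; apply: eq_bigr => j _.
by rewrite [RHS]/= reFD reFZ scalerA -scalerDl; congr (_ *: _); ring.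
Qed.

Lemma amgm_class (a t p rad Kr : R) : 0 <= a -> 0 <= t -> 0 < rad -> 0 < Kr ->
  0 <= p -> Kr * a ^+ 2 <= rad ^+ 2 * p ->
  a * t <= rad / 2 * (Kr^-1 + p * t ^+ 2).
Proof.
move=> a0 t0 rad0 K0 p0 h.
have K1 : 0 < Kr^-1 by rewrite invr_gt0.
have pt : 0 <= p * t ^+ 2 by rewrite mulr_ge0// sqr_ge0.
rewrite -(@ler_pXn2r _ 2) ?nnegrE ?mulr_ge0 ?divr_ge0 ?addr_ge0 ?(ltW rad0) ?(ltW K1)//.
have h' : a ^+ 2 <= rad ^+ 2 * p * Kr^-1 by rewrite ler_pdivlMr// mulrC.
have h2 : (a * t) ^+ 2 <= rad ^+ 2 * (Kr^-1 * (p * t ^+ 2)).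
  rewrite exprMn; apply: (le_trans (ler_wpM2r (sqr_ge0 t) h')).
  by rewrite le_eqVlt; apply/orP; left; apply/eqP; ring.
apply: (le_trans h2); rewrite [leRHS]exprMn exprMn -mulrA ler_wpM2l ?sqr_ge0//.
have := sqr_ge0 (Kr^-1 - p * t ^+ 2).
set x := Kr^-1; set y := p * t ^+ 2 => hx.
have -> : 2^-1 ^+ 2 * (x + y) ^+ 2 = x * y + 4^-1 * (x - y) ^+ 2 by field.
by rewrite lerDl mulr_ge0.
Qed.

(** By the inequality between arithmetic and geometric means, each term of the
    bilinear form is at most [rad / 2] times [#|J|^-1] plus a product of terms
    of the two squared norms; since one of the families of frequencies is
    injective, these products sum to at most one. *)
Lemma hyp_op_class (a s s' rad : R) kk ll th : 0 <= a -> 0 < rad ->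
  injective kk \/ injective ll ->
  (forall j, #|J|%:R * a ^+ 2 <=
     rad ^+ 2 * (symbol (kk j) `^ s * symbol (ll j) `^ s')) ->
  operator_class s s' rad (hyp_op a kk ll th).
Proof.
move=> a0 rad0 inj ha.
have bd : (opnorm s s' (hyp_op a kk ll th) <= rad%:E)%E.
  apply: ge_ereal_sup => _ [u /= hu] [v /= hv] <-.
  rewrite lee_fin pairingC (pairing_wave_comb psiP).
  apply: (le_trans (ler_norm_sum _ _ _)).
  pose p j := symbol (kk j) `^ s * symbol (ll j) `^ s'.
  pose q j := reF u (kk j) * reF v (ll j).
  have le1 j : `|a * pm (th j) * reF u (kk j) * reF v (ll j)| <=
      rad / 2 * (#|J|%:R^-1 + p j * q j ^+ 2).
    rewrite -mulrA !normrM pm_norm mulr1 (ger0_norm a0) -normrM -/(q j).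
    rewrite -(real_normK (num_real (q j))).
    apply: amgm_class => //; last exact: ha.
      by rewrite ltr0n; apply/card_gt0P; exists j.
    by rewrite mulr_ge0// powR_ge0.
  apply: (le_trans (ler_sum _ (fun j _ => le1 j))).
  rewrite -mulr_sumr big_split /= sumr_const.
  have h1 : #|J|%:R^-1 *+ #|J| <= 1 :> R.
    rewrite -[leLHS]mulr_natr; have [->|n0] := eqVneq #|J| 0%N; first by rewrite mulr0.
    by rewrite mulVf// pnatr_eq0.
  have uJ : uniq (enum J) by exact: enum_uniq.
  have h2 : \sum_j p j * q j ^+ 2 <= 1.
    have ball1 (b : R) (x : D) (kl : Zd) : (sobolev_norm b x <= 1)%E ->
        symbol kl `^ b * reF x kl ^+ 2 <= 1.
      move=> hx; have := @unit_ball_sum _ _ b x [:: kl] isT hx.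
      by rewrite big_seq1.
    have P0 (b : R) x kl : 0 <= symbol kl `^ b * reF x kl ^+ 2.
      by rewrite mulr_ge0 ?powR_ge0// sqr_ge0.
    case: inj => inj.
      have := @unit_ball_sum _ _ s u [seq kk j | j <- enum J] _ hu.
      rewrite map_inj_uniq// uJ big_map big_enum /= => /(_ isT); apply: le_trans.
      apply: ler_sum => j _; rewrite /p /q exprMn mulrACA ler_piMr//.
      exact: ball1.
    have := @unit_ball_sum _ _ s' v [seq ll j | j <- enum J] _ hv.
    rewrite map_inj_uniq// uJ big_map big_enum /= => /(_ isT); apply: le_trans.
    apply: ler_sum => j _; rewrite /p /q exprMn mulrACA ler_piMl//.
    exact: ball1.
  by have := lerD h1 h2; nra.
split=> //; split.
- by move=> u _; exact: (sobolev_wave_comb psiP).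
- by move=> x v u _ _; exact: hyp_opP.
- by apply: (le_lt_trans bd); exact: ltry.
Qed.

Definition linear_on (t : R) (A : D -> D) := forall x v u,
  sobolev t v -> sobolev t u -> A (x *: v + u) = x *: A v + A u.

Lemma linear_on_wave_comb (t : R) (A : D -> D) c kk : linear_on t A ->
  A (wave_comb psi c kk) = \sum_j c j *: A (psi (kk j)).
Proof.
move=> lA.
have psi_sob k : sobolev t (psi k).
  have -> : psi k = wave_comb psi (fun _ : unit => 1) (fun=> k).
    by rewrite /wave_comb (big_pred1 tt)// ?scale1r// => -[].
  exact: sobolev_wave_comb.
have sob0 : sobolev t (0 : D).
  have -> : (0 : D) = wave_comb psi (fun _ : unit => 0) (fun=> 0).
    by rewrite /wave_comb big1// => i _; rewrite scale0r.
  exact: sobolev_wave_comb.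
have A0 : A 0 = 0.
  have := lA 1 0 0 sob0 sob0; rewrite scaler0 addr0 scale1r => /eqP.
  by rewrite -subr_eq0 opprD addrA subrr sub0r oppr_eq0 => /eqP.
rewrite /wave_comb.
have step (r : seq J) : sobolev t (\sum_(j <- r) c j *: psi (kk j)).
  have -> : \sum_(j <- r) c j *: psi (kk j) =
      wave_comb psi (fun i : 'I_(size r) => c (tnth (in_tuple r) i))
        (fun i => kk (tnth (in_tuple r) i)).
    by rewrite /wave_comb big_tnth.
  exact: sobolev_wave_comb.
elim: (index_enum J) => [|j r IH]; first by rewrite !big_nil.
by rewrite !big_cons lA ?IH.
Qed.

Definition frequencies_apart kk := forall i j, i != j ->
  kk i != kk j /\ kk i != - kk j.

Lemma frequencies_apart_inj kk : frequencies_apart kk -> injective kk.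
Proof.
move=> apart i j ij; apply/eqP; apply: contraT => /apart[].
by rewrite ij eqxx.
Qed.

Lemma wave_coef_apart kk i j : frequencies_apart kk -> i != j ->
  wave_coef (kk i) (kk j) = 0 :> R.
Proof.
move=> apart ij; have [a1 a2] := apart i j ij; rewrite /wave_coef.
by rewrite eq_sym (negbTE a1) -eqr_oppLR eq_sym (negbTE a2) addr0 mul0r.
Qed.

(** Testing the operator against the waves with optimal signs turns the
    operator norm into an [l^1] norm of matrix entries. *)
Lemma opnorm_ge_entries (t t' lam : R) (A : D -> D) kk ll : 0 <= lam ->
  linear_on t A ->
  (frequencies_apart kk /\ (forall j, ll j = 0)) \/
  (frequencies_apart ll /\ (forall j, kk j = 0)) ->
  (forall j, lam ^+ 2 * #|J|%:R * (symbol (kk j) `^ t * symbol (ll j) `^ t') <= 1) ->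
  ((lam * \sum_j `|reF (A (psi (kk j))) (ll j)|)%:E <= opnorm t t' A)%E.
Proof.
move=> lam0 lA cases hlam.
pose x j := reF (A (psi (kk j))) (ll j).
pose c j := lam * Num.sg (x j).
have cx : \sum_j c j * x j = lam * \sum_j `|x j|.
  by rewrite mulr_sumr; apply: eq_bigr => j _; rewrite -mulrA -normrEsg.
have c2 j : c j ^+ 2 <= lam ^+ 2.
  rewrite exprMn ler_piMr ?sqr_ge0//.
  by case: sgrP => _; rewrite ?expr0n ?sqrrN ?expr1n.
have cball (b : R) (mm : J -> Zd) : (forall j, lam ^+ 2 * #|J|%:R * symbol (mm j) `^ b <= 1) ->
    \sum_j c j ^+ 2 * symbol (mm j) `^ b <= 1.
  move=> hm; apply: (@le_trans _ _ (\sum_(j : J) #|J|%:R^-1)).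
    apply: ler_sum => j _; have K0 : 0 < #|J|%:R :> R.
      by rewrite ltr0n; apply/card_gt0P; exists j.
    apply: (@le_trans _ _ (lam ^+ 2 * symbol (mm j) `^ b)).
      by rewrite ler_wpM2r// powR_ge0.
    by rewrite -[leRHS]mul1r ler_pdivlMr// mulrAC.
  rewrite sumr_const -[leLHS]mulr_natr; have [->|n0] := eqVneq #|J| 0%N; first by rewrite mulr0.
  by rewrite mulVf// pnatr_eq0.
have single (b : R) : (sobolev_norm b (psi 0%R) <= 1)%E.
  have -> : psi 0 = wave_comb psi (fun _ : unit => 1) (fun=> 0).
    by rewrite /wave_comb (big_pred1 tt)// ?scale1r// => -[].
  apply: (wave_comb_unit_ball psiP) => [[] []//|].
  by rewrite (big_pred1 tt) => [|[]//]; rewrite symbol0 powR1 expr1n mulr1.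
have pair0 u : pairing u (psi 0) = reF u 0.
  have -> : psi 0 = wave_comb psi (fun _ : unit => 1) (fun=> 0).
    by rewrite /wave_comb (big_pred1 tt)// ?scale1r// => -[].
  by rewrite (pairing_wave_comb psiP) (big_pred1 tt) ?mul1r// => -[].
suff [h [v [hh hv hE]]] : exists h v, [/\ (sobolev_norm t h <= 1)%E,
    (sobolev_norm t' v <= 1)%E & pairing (A h) v = lam * \sum_j `|x j|].
  apply: ereal_sup_ubound; exists h => //; exists v => //; rewrite hE.
  by rewrite ger0_norm// mulr_ge0// sumr_ge0.
case: cases => -[apart z0].
  exists (wave_comb psi c kk), (psi 0); split => //.
    apply: (wave_comb_unit_ball psiP apart); apply: cball => j.
    by have := hlam j; rewrite z0 symbol0 powR1 mulr1.
  rewrite pair0 (linear_on_wave_comb _ _ lA) reF_sum -cx; apply: eq_bigr => j _.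
  by rewrite reFZ /x z0.
exists (psi 0), (wave_comb psi c ll); split => //.
  apply: (wave_comb_unit_ball psiP apart); apply: cball => j.
  by have := hlam j; rewrite z0 symbol0 powR1 mul1r.
rewrite (pairing_wave_comb psiP) -cx; apply: eq_bigr => j _.
by rewrite /x z0.
Qed.

End hypotheses.

(** * Waves as Cameron-Martin directions *)

Section field_waves.
Context {R : realType} {dim : nat} d (T : measurableType d) (P : probability T R).
Local Notation D := (dist R dim).
Local Notation Zd := ('rV[int]_dim).
Variables (r : R) (X : T -> D).
Hypothesis fX : gaussian_field P r X.
Implicit Types (k l m : Zd).
Local Notation cov := (field_cov P X).

Let mX : measurable_fun setT X. Proof. by case: fX. Qed.
Let gX : forall n (phi : 'I_n -> testfun R dim),
  gaussian_vector P (fun i o => X o (phi i)).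
Proof. by case: fX. Qed.

Lemma field_cov_diag k l :
  cov (cosk k) (cosk l) + cov (sink k) (sink l) = (k == l)%:R * symbol k `^ (- r).
Proof.
have [_ _ /(_ k l) h _] := fX; apply/EFin_inj; rewrite -h EFinD -!(field_covE gX).
rewrite -expectationD ?gaussian_Lfun1// unlock.
by apply: eq_integral => o _ /=; rewrite /reF /imF mulrNN.
Qed.

Lemma field_cov_offdiag k l : cov (cosk k) (sink l) = cov (sink k) (cosk l).
Proof.
have [_ _ _ /(_ k l) h] := fX; apply/eqP; rewrite -subr_eq0; apply/eqP/EFin_inj.
rewrite -[RHS]h EFinB -!(field_covE gX) -expectationB ?gaussian_Lfun1// unlock.
by apply: eq_integral => o _ /=; rewrite /reF /imF mulNr mulrN opprK addrC.
Qed.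

Lemma field_covNr phi psi : cov phi (- psi) = - cov phi psi.
Proof. by rewrite field_covC -scaleN1r (field_covZl gX) mulN1r field_covC. Qed.

(** The identity between Fourier coefficients at [k] and [l] only gives the sum
    of the covariances of cosines and of sines. Changing [l] to [- l] changes
    the sign of the second one, which separates them. *)
Lemma field_cov_cos k l : cov (cosk k) (cosk l) = symbol l `^ (- r) * wave_coef l k.
Proof.
have h1 := field_cov_diag k l; have h2 := field_cov_diag k (- l).
rewrite coskN sinkN field_covNr in h2.
have symE : (k == l)%:R * symbol k `^ (- r) = (k == l)%:R * symbol l `^ (- r) :> R.
  by case: eqP => [->|]; rewrite ?mul0r.
have symNE : (k == - l)%:R * symbol k `^ (- r) = (k == - l)%:R * symbol l `^ (- r) :> R.
  by case: eqP => [->|]; rewrite ?mul0r// symbolN.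
rewrite symE in h1; rewrite symNE in h2; rewrite /wave_coef.
move: h1 h2; set a := cov _ _; set b := cov _ _; set s := _ `^ _; lra.
Qed.

Lemma field_cov_sin k l : cov (sink k) (cosk l) = 0.
Proof.
have h1 := field_cov_offdiag k l; have h2 := field_cov_offdiag k (- l).
rewrite coskN sinkN field_covNr in h2.
by move: h1 h2; set a := cov _ _; set b := cov _ _; lra.
Qed.

Definition wave_std l : R := Num.sqrt (symbol l `^ (- r) * wave_coef l l).

Lemma wave_var_gt0 l : 0 < symbol l `^ (- r) * wave_coef l l.
Proof.
rewrite mulr_gt0 ?powR_gt0 ?symbol_gt0//.
by apply: (lt_le_trans _ (@wave_coef_diag R dim l)); rewrite invr_gt0.
Qed.

Lemma wave_std_gt0 l : 0 < wave_std l.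
Proof. by rewrite sqrtr_gt0 wave_var_gt0. Qed.

Lemma wave_std_sqr l : wave_std l ^+ 2 = symbol l `^ (- r) * wave_coef l l.
Proof. by rewrite sqr_sqrtr// ltW// wave_var_gt0. Qed.

Definition unit_wave l : testfun R dim := (wave_std l)^-1 *: cosk l.

Lemma unit_wave_var l : cov (unit_wave l) (unit_wave l) = 1.
Proof.
rewrite (field_covZl gX) field_covC (field_covZl gX) field_cov_cos -wave_std_sqr.
by field; rewrite gt_eqF ?wave_std_gt0.
Qed.

Let dir l : D := cm_direction mX gX (unit_wave_var l).

Let dir_cos l m : dir l (cosk m) = symbol l `^ (- r) / wave_std l * wave_coef l m.
Proof. by rewrite cm_directionE field_covC (field_covZl gX) field_covC field_cov_cos; ring. Qed.

Let dir_sin l m : dir l (sink m) = 0.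
Proof. by rewrite cm_directionE field_covC (field_covZl gX) field_covC field_cov_sin mulr0. Qed.

(** The waves [cos (2 pi l.x)] are distributions, as multiples of the
    covariances of the field. *)
Lemma exists_wave : exists psi : Zd -> D, is_wave psi.
Proof.
exists (fun l => (wave_std l / symbol l `^ (- r)) *: dir l) => k l; split.
  rewrite reFZ /reF dir_cos; field.
  by rewrite (gt_eqF (wave_std_gt0 k)) gt_eqF ?powR_gt0 ?symbol_gt0.
by rewrite imFZ /imF dir_sin oppr0 mulr0.
Qed.

(** The Cameron-Martin direction of [unit_wave l] has the same Fourier
    coefficients as a multiple of the wave of frequency [l], hence equals it. *)
Lemma wave_shift (psi : Zd -> D) l (h : R) (F : D -> \bar R) : is_wave psi ->
  measurable_fun setT F -> (forall x, 0 <= F x)%E ->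
  (\int[P]_o ((expR (h * X o (unit_wave l) - h ^+ 2 / 2))%:E * F (X o)) =
   \int[P]_o F (X o + h *: ((symbol l `^ (- r) / wave_std l) *: psi l))%R)%E.
Proof.
move=> psiP mF F0.
have <- : dir l = (symbol l `^ (- r) / wave_std l) *: psi l.
  apply: dist_fourier_inj => m.
    by rewrite dir_cos distE_scale -[psi l _]/(reF (psi l) m) (psiP l m).1.
  rewrite dir_sin distE_scale -[psi l _]opprK -/(imF (psi l) m) (psiP l m).2.
  by rewrite oppr0 mulr0.
exact: cameron_martin.
Qed.

Lemma wave_second_moment k :
  ('E_P[fun o => (reF (X o) k ^+ 2)%R] <= (symbol k `^ (- r))%:E)%E.
Proof.
have -> : ('E_P[fun o => (reF (X o) k ^+ 2)%R] = (cov (cosk k) (cosk k))%:E)%E.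
  by rewrite -(field_covE gX) unlock; apply: eq_integral => o _; rewrite expr2.
rewrite lee_fin field_cov_cos ler_piMr ?powR_ge0//.
exact: wave_coef_le1.
Qed.

End field_waves.

(** * Reduction to sign patterns *)

Section joint_sample.
Context {R : realType} {dim : nat} d (T : measurableType d) (P : probability T R).
Local Notation D := (dist R dim).
Context (N : nat) (u w : 'I_N -> T -> D).

Definition joint (k : 'I_(N + N)) : T -> D :=
  match fintype.split k with inl i => u i | inr i => w i end.

Lemma joint_input i : joint (lshift N i) = u i.
Proof. by rewrite /joint (unsplitK (inl _ i)). Qed.

Lemma joint_noise i : joint (rshift N i) = w i.
Proof. by rewrite /joint (unsplitK (inr _ i)). Qed.

Lemma joint_independent :
  mutually_independent P
    (fun i : 'I_N + 'I_N => match i with inl j => u j | inr j => w j end) ->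
  mutually_independent P joint.
Proof.
move=> ind B mB.
have bij : {on predT, bijective (@unsplit N N)}.
  by apply: onW_bij; exists (@fintype.split N N); [exact: unsplitK|exact: splitK].
rewrite (reindex _ bij) /=.
have := ind (fun i => B (unsplit i)) (fun i => mB _).
have -> : [set o | forall i, B (unsplit i) (match i with inl j => u j | inr j => w j end o)] =
    [set o | forall k, B k (joint k o)].
  apply/seteqP; split=> o /= h.
    by move=> k; have := h (fintype.split k); rewrite splitK /joint; case: (fintype.split k).
  by move=> i; have := h (unsplit i); rewrite /joint unsplitK; case: i.
move=> ->; apply: eq_bigr => i _.
suff -> : joint (unsplit i) = (match i with inl j => u j | inr j => w j end) by [].
by rewrite /joint unsplitK; case: i.
Qed.

End joint_sample.

Section assouad.
Context {R : realType} {dim : nat} d (T : measurableType d) (P : probability T R).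
Local Notation D := (dist R dim).
Local Notation Zd := ('rV[int]_dim).
Context (N : nat) (u w : 'I_N -> T -> D) (r1 r2 : R).
Hypothesis design : iid_gaussian_design P r1 r2 u w.
Variable psi : Zd -> D.
Hypothesis psiP : is_wave psi.
Variables (J : finType) (kk ll : J -> Zd) (s a : R).
Hypothesis a0 : 0 <= a.
Implicit Types (th : {ffun J -> bool}) (j : J).
Local Notation op := (hyp_op psi a kk ll).

Let fu i : gaussian_field P r1 (u i). Proof. by case: design. Qed.
Let fw i : gaussian_field P r2 (w i). Proof. by case: design. Qed.
Let mu' i : measurable_fun setT (u i). Proof. by case: (fu i). Qed.
Let mw' i : measurable_fun setT (w i). Proof. by case: (fw i). Qed.

Let V := joint u w.
Let mV k : measurable_fun setT (V k).
Proof. by rewrite /V /joint; case: (fintype.split k). Qed.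
Let iV : mutually_independent P V.
Proof. by apply: joint_independent; case: design. Qed.

Let scl j : R := wave_std r2 (ll j) / symbol (ll j) `^ (- r2).
Let scl' j : R := symbol (ll j) `^ (- r2) / wave_std r2 (ll j).

Let sclK j : scl j * scl' j = 1.
Proof.
rewrite /scl /scl'; field.
by rewrite (gt_eqF (wave_std_gt0 r2 (ll j))) gt_eqF ?powR_gt0 ?symbol_gt0.
Qed.

(** The part of the observation that depends on the sign of index [j], in
    units of the Cameron-Martin direction of the noise. *)
Definition signal j (v : D) : R :=
  if `[< sobolev s v >] then a * reF v (kk j) * scl j else 0.

Definition background th j (v : D) : D :=
  if `[< sobolev s v >] then
    \sum_(i | i != j) (a * pm (th i) * reF v (kk i)) *: psi (ll i)
  else 0.

Definition observe th j (z : (N + N).-tuple D) : N.-tuple (D * D) :=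
  [tuple (tnth z (lshift N i),
          background th j (tnth z (lshift N i)) + tnth z (rshift N i)) | i < N].

Let msob : measurable_fun [set: D] (fun v : D => `[< sobolev s v >]).
Proof.
apply: (measurable_fun_bool true).
rewrite setTI (_ : _ @^-1` _ = sobolev s); first exact: measurable_sobolev.
by apply/seteqP; split=> v /= /asboolP.
Qed.

Lemma measurable_reF k : measurable_fun [set: D] (fun v : D => reF v k).
Proof. exact: measurable_dist_eval. Qed.

Lemma measurable_signal j : measurable_fun setT (signal j).
Proof.
apply: measurable_fun_ifT => //.
apply: measurable_funM; last exact: measurable_cst.
by apply: measurable_funM; [exact: measurable_cst|exact: measurable_reF].
Qed.

Lemma measurable_background th j : measurable_fun setT (background th j).
Proof.
apply: measurable_distP => phi.
rewrite (_ : (fun o => _) = fun v : D => if `[< sobolev s v >] then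
  (\sum_(i | i != j) (a * pm (th i) * reF v (kk i)) * psi (ll i) phi) else 0); last first.
  by apply/funext => v; rewrite /background; case: ifP => // _; rewrite distE_sum.
apply: measurable_fun_ifT => //.
rewrite (_ : (fun o => _) = fun v : D => \sum_i (if i != j then
  a * pm (th i) * reF v (kk i) * psi (ll i) phi else 0)); last first.
  by apply/funext => v; rewrite -big_mkcond.
apply: measurable_sum => i; case: (i != j); last exact: measurable_cst.
apply: measurable_funM; last exact: measurable_cst.
by apply: measurable_funM; [exact: measurable_cst|exact: measurable_reF].
Qed.

Lemma measurable_observe th j : measurable_fun setT (observe th j).
Proof.
apply/measurable_fun_tnthP => i.
rewrite (_ : _ \o _ = fun z : (N + N).-tuple D => (tnth z (lshift N i),
          background th j (tnth z (lshift N i)) + tnth z (rshift N i))); last first.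
  by apply/funext => z /=; rewrite tnth_mktuple.
have ml : measurable_fun setT (fun z : (N + N).-tuple D => tnth z (lshift N i)).
  exact: measurable_tnth.
have mr : measurable_fun setT (fun z : (N + N).-tuple D => tnth z (rshift N i)).
  exact: measurable_tnth.
apply: measurable_fun_pair => //.
have mb := measurableT_comp (measurable_background th j) ml.
exact: (measurableT_comp measurable_dist_add (measurable_fun_pair mb mr)).
Qed.

(** The sign of the index [j] enters the data only as a shift of the noise, along
    a Cameron-Martin direction, by a function of the input. *)
Lemma observationsE th j o :
  observations s (op th) u w o =
  observe th j (shift_noise (scl' j *: psi (ll j)) (fun v => pm (th j) * signal j v)
    (sample V o)).
Proof.
apply/eq_from_tnth => i; rewrite [LHS]tnth_mktuple [RHS]tnth_mktuple !tnth_mktuple.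
rewrite (unsplitK (inl _ i)) (unsplitK (inr _ i)) !tnth_mktuple.
rewrite /V joint_input joint_noise; congr pair.
rewrite /apply_on /background /signal; case: ifP => _; last first.
  by rewrite mulr0 scale0r addr0.
rewrite /hyp_op /wave_comb (bigD1 j)//=.
rewrite -[LHS]addrA [LHS]addrC -[LHS]addrA; congr (_ + (_ + _)).
rewrite scalerA; congr (_ *: _).
rewrite -[LHS]mulr1 -(sclK j); ring.
Qed.

Definition flip j th : {ffun J -> bool} := [ffun i => if i == j then ~~ th i else th i].

Lemma flipK j : involutive (flip j).
Proof.
move=> th; apply/ffunP => i; rewrite !ffunE.
by case: eqP => // _; rewrite negbK.
Qed.

Lemma observe_flip th j z : observe (flip j th) j z = observe th j z.
Proof.
apply/eq_from_tnth => i; rewrite !tnth_mktuple /background; congr (_, _ + _).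
case: ifP => // _; apply: eq_bigr => k /negbTE kj.
by rewrite ffunE kj.
Qed.

(** The entry [(kk j, ll j)] of the operator with unit amplitude; a wave of
    nonzero frequency [k] has only half of its mass at [k], the rest at [- k]. *)
Definition overlap j : R := wave_coef (kk j) (kk j) * wave_coef (ll j) (ll j).

Lemma overlap_ge j : 4^-1 <= overlap j.
Proof.
have h1 := @wave_coef_diag R dim (kk j); have h2 := @wave_coef_diag R dim (ll j).
have -> : (4^-1 : R) = 2^-1 * 2^-1 by field.
by apply: ler_pM.
Qed.

Hypothesis apart :
  (frequencies_apart kk /\ (forall j, ll j = 0)) \/
  (frequencies_apart ll /\ (forall j, kk j = 0)).

Lemma hyp_op_entry th j :
  reF (op th (psi (kk j))) (ll j) = pm (th j) * (a * overlap j).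
Proof.
rewrite /hyp_op (reF_wave_comb psiP) (bigD1 j)//= big1 => [|i ij].
  by rewrite addr0 /reF -[psi _ _]/(reF (psi (kk j)) (kk j)) (psiP _ _).1 /overlap; ring.
rewrite -[reF (psi _) _]/(reF (psi (kk j)) (kk i)) (psiP _ _).1.
case: apart => -[ap _].
  by rewrite (@wave_coef_apart R dim J kk j i ap) 1?eq_sym// mulr0 mul0r.
by rewrite (@wave_coef_apart R dim J ll i j ap)// mulr0.
Qed.

Hypothesis weak : forall j,
  N%:R * a ^+ 2 * (symbol (kk j) `^ (- r1) * symbol (ll j) `^ r2) <= 4^-1.

Let scl_sqr j : scl j ^+ 2 <= symbol (ll j) `^ r2.
Proof.
rewrite /scl expr_div_n wave_std_sqr powRN.
have p0 : 0 < symbol (ll j) `^ r2 by rewrite powR_gt0// symbol_gt0.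
set x := symbol _ `^ _ in p0 *.
have -> : x^-1 * wave_coef (ll j) (ll j) / x^-1 ^+ 2 = wave_coef (ll j) (ll j) * x.
  by field; rewrite gt_eqF.
by rewrite ler_piMl ?wave_coef_le1 ?ltW.
Qed.

(** An input contributes at most [a ^+ 2] times the variance of the input mode
    [kk j] divided by that of the noise mode [ll j]. *)
Lemma signal_energy j :
  (\int[P]_o (\sum_(i < N) signal j (V (lshift N i) o) ^+ 2)%:E <= (4^-1)%:E)%E.
Proof.
under eq_integral do rewrite -sumEFin.
have mreu i : measurable_fun setT (fun o => (reF (u i o) (kk j) ^+ 2)%:E).
  apply/measurable_EFinP/measurable_funX.
  exact: (measurableT_comp (measurable_reF _) (mu' i)).
rewrite ge0_integral_sum//; last 2 first.
  move=> i; apply/measurable_EFinP/measurable_funX.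
  exact: (measurableT_comp (measurable_signal j) (mV _)).
  by move=> i o _; rewrite lee_fin sqr_ge0.
set e := a ^+ 2 * symbol (ll j) `^ r2.
have e0 : 0 <= e by rewrite mulr_ge0 ?sqr_ge0 ?powR_ge0.
apply: (@le_trans _ _ (\sum_(i < N) (e * symbol (kk j) `^ (- r1))%:E)%E); last first.
  rewrite sumEFin lee_fin sumr_const card_ord -[leLHS]mulr_natl.
  by have := weak j; congr (_ <= _); rewrite /e; ring.
apply: lee_sum => i _; rewrite /V joint_input EFinM.
apply: (@le_trans _ _ (e%:E * 'E_P[fun o => (reF (u i o) (kk j) ^+ 2)%R])%E); last first.
  by apply: lee_wpmul2l => //; exact: (wave_second_moment (fu i)).
rewrite unlock -integralZl_nomeas//; last by move=> o; rewrite lee_fin sqr_ge0.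
apply: le_integral_nomeas => o; first by rewrite lee_fin sqr_ge0.
rewrite -EFinM lee_fin /signal; case: ifP => _; last first.
  by rewrite expr0n mulr_ge0 ?sqr_ge0.
rewrite [(_ * scl j) ^+ 2]exprMn [(a * _) ^+ 2]exprMn /e [leLHS]mulrAC ler_wpM2r ?sqr_ge0//.
by rewrite ler_wpM2l ?sqr_ge0 ?scl_sqr.
Qed.

Variables (t t' : R) (Ahat : N.-tuple (D * D) -> D -> D).
Hypothesis est : estimator t t' Ahat.

Let psi1 k : psi k = wave_comb psi (fun _ : unit => 1) (fun=> k).
Proof. by rewrite /wave_comb (big_pred1 tt)// ?scale1r// => -[]. Qed.

Let psi_sob (b : R) k : sobolev b (psi k).
Proof. by rewrite psi1; exact: (sobolev_wave_comb psiP). Qed.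

Definition entry j z : R := reF (Ahat z (psi (kk j))) (ll j).

Lemma measurable_entry j : measurable_fun setT (entry j).
Proof.
have [_ /(_ (psi (kk j)) (psi (ll j)) (psi_sob _ _) (psi_sob _ _))] := est.
congr measurable_fun; apply/funext => z.
by rewrite [in LHS](psi1 (ll j)) (pairing_wave_comb psiP) (big_pred1 tt) ?mul1r// => -[].
Qed.

Definition entry_risk th j : \bar R :=
  (\int[P]_o (`|entry j (observations s (op th) u w o) -
      reF (op th (psi (kk j))) (ll j)|)%:E)%E.

Lemma measurable_entry_loss th j : measurable_fun setT
  (fun o => (`|entry j (observations s (op th) u w o) -
      reF (op th (psi (kk j))) (ll j)|)%:E).
Proof.
apply/measurable_EFinP; apply: measurableT_comp => //.
apply: measurable_funB; last exact: measurable_cst.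
apply: (measurableT_comp (measurable_entry j)).
have mh : measurable_fun setT (fun v => pm (th j) * signal j v).
  by apply: measurable_funM; [exact: measurable_cst|exact: measurable_signal].
have mz := measurable_shift_noise (scl' j *: psi (ll j)) mh (N := N).
have := measurableT_comp (measurable_observe th j) (measurableT_comp mz (measurable_sample mV)).
by congr measurable_fun; apply/funext => o; rewrite (observationsE th j).
Qed.

(** For the data, flipping the sign of [j] amounts to reverting the shift of
    the noise. *)
Lemma entry_two_point th j :
  ((3 / 16 * a)%:E <= entry_risk th j + entry_risk (flip j th) j)%E.
Proof.
wlog thj : th / th j.
  move=> H; case thj: (th j); first exact: H.
  rewrite addeC -{2}(flipK j th); apply: H.
  by rewrite ffunE eqxx thj.
set b := a * overlap j.
have b0 : 0 <= b by rewrite mulr_ge0// (le_trans _ (overlap_ge j)).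
(* the energy is at most [1 / 4], which leaves [3 / 4 * b >= 3 / 16 * a] *)
have ba : a / 4 <= b by rewrite ler_wpM2l// overlap_ge.
have cmV (i : 'I_N) (h : R) (F : D -> \bar R) :
    measurable_fun setT F -> (forall x, 0 <= F x)%E ->
    (\int[P]_o ((expR (h * V (rshift N i) o (unit_wave r2 (ll j)) - h ^+ 2 / 2))%:E *
       F (V (rshift N i) o)) =
     \int[P]_o F (V (rshift N i) o + h *: (scl' j *: psi (ll j)))%R)%E.
  by move=> mF F0; rewrite /V joint_noise; have e := wave_shift (fw i) (ll j) h psiP mF F0; exact: e.
have mg : measurable_fun setT (fun z => entry j (observe th j z)).
  exact: (measurableT_comp (measurable_entry j) (measurable_observe th j)).
have := two_point mV iV cmV (measurable_signal j) mg b0.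
have <- : entry_risk th j = (\int[P]_o (`|entry j (observe th j
    (shift_noise (scl' j *: psi (ll j)) (signal j) (sample V o))) - b|)%:E)%E.
  have E : (fun v => pm (th j) * signal j v) = signal j.
    by apply/funext => v; rewrite thj mul1r.
  by apply: eq_integral => o _; rewrite (observationsE th j) hyp_op_entry E thj mul1r.
have <- : entry_risk (flip j th) j = (\int[P]_o (`|entry j (observe th j
    (shift_noise (scl' j *: psi (ll j)) (\- signal j) (sample V o))) + b|)%:E)%E.
  have fj : flip j th j = false by rewrite ffunE eqxx thj.
  have E : (fun v => pm (flip j th j) * signal j v) = \- signal j.
    by apply/funext => v; rewrite fj mulN1r.
  apply: eq_integral => o _; rewrite (observationsE _ j) hyp_op_entry observe_flip.
  by rewrite E fj mulN1r opprK.
move=> h2.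
have h3 : (b%:E * \int[P]_o (\sum_(i < N) signal j (V (lshift N i) o) ^+ 2)%:E <=
    (b / 4)%:E)%E.
  by rewrite [(b / 4)%:E]EFinM; apply: lee_wpmul2l; [rewrite lee_fin|exact: signal_energy].
have h4 : (b%:E <= entry_risk th j + entry_risk (flip j th) j + (b / 4)%:E)%E.
  by apply: (le_trans h2); exact: leeD.
have := h4; rewrite -leeBlDr// -EFinB; apply: le_trans.
rewrite lee_fin; lra.
Qed.

Lemma entry_risk_le th (lam : R) : 0 <= lam ->
  (forall j, lam ^+ 2 * #|J|%:R * (symbol (kk j) `^ t * symbol (ll j) `^ t') <= 1) ->
  (lam%:E * \sum_j entry_risk th j <=
   \int[P]_o opnorm t t' (fun h => (Ahat (observations s (op th) u w o) h - op th h)%R))%E.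
Proof.
move=> lam0 hlam.
rewrite -ge0_integral_sum//; last by move=> j; exact: measurable_entry_loss.
rewrite -integralZl_nomeas//; last by move=> o; apply: sume_ge0.
apply: le_integral_nomeas => o; first by rewrite mule_ge0// sume_ge0.
rewrite sumEFin -EFinM; apply: (opnorm_ge_entries psiP) => //.
move=> x v v' sv sv'.
have [/(_ (observations s (op th) u w o))[_ lA _] _] := est.
by rewrite lA// hyp_opP opprD addrACA -scalerBr.
Qed.

End assouad.

(** Averaging over the vertices of the cube: flipping the coordinate [j] is an
    involution, so a bound on the sum of the losses at both ends of each edge
    is a bound on twice the average loss. *)
Lemma cube_average {R : realType} (J : finType)
    (rr : {ffun J -> bool} -> J -> R) (lam m b : R) : 0 <= lam ->
  (forall th, lam * \sum_j rr th j <= m) ->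
  (forall th j, b <= rr th j + rr (flip j th) j) -> lam * (b / 2) * #|J|%:R <= m.
Proof.
move=> lam0 hm hb; pose K := #|{: {ffun J -> bool}}|.
have K0 : 0 < K%:R :> R by rewrite ltr0n; apply/card_gt0P; exists [ffun=> true].
rewrite -(ler_pM2l K0).
have -> : K%:R * m = \sum_(th : {ffun J -> bool}) m.
  by rewrite sumr_const mulr_natl.
apply: le_trans (ler_sum _ (fun th _ => hm th)).
rewrite -mulr_sumr exchange_big /=.
have -> : K%:R * (lam * (b / 2) * #|J|%:R) = lam * (K%:R * (b / 2) * #|J|%:R) by ring.
rewrite ler_wpM2l//.
have edge j : K%:R * (b / 2) <= \sum_th rr th j.
  have : \sum_(th : {ffun J -> bool}) b <= \sum_th (rr th j + rr (flip j th) j).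
    exact: ler_sum.
  rewrite big_split /= [X in _ + X](reindex_inj (inv_inj (flipK j))) /=.
  under [X in _ + X]eq_bigr do rewrite flipK.
  rewrite sumr_const -[leLHS]mulr_natl -/K; lra.
apply: le_trans (ler_sum _ (fun j _ => edge j)).
by rewrite sumr_const -[leRHS]mulr_natr.
Qed.

(** Assouad's lemma for operators that differ in the signs of a family of
    rank one terms: [a] is the size of these terms, and the class, the design
    and the loss impose one condition each. *)
Lemma minimax_lower {R : realType} {dim : nat} d (T : measurableType d)
    (P : probability T R) (N : nat) (u w : 'I_N -> T -> dist R dim)
    (s s' r1 r2 t t' rad a lam : R) (J : finType) (kk ll : J -> 'rV[int]_dim) :
  (1 <= N)%N -> iid_gaussian_design P r1 r2 u w -> 0 <= a -> 0 < lam -> 0 < rad ->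
  (frequencies_apart kk /\ (forall j, ll j = 0)) \/
  (frequencies_apart ll /\ (forall j, kk j = 0)) ->
  (forall j, #|J|%:R * a ^+ 2 <=
     rad ^+ 2 * (symbol (kk j) `^ s * symbol (ll j) `^ s')) ->
  (forall j, lam ^+ 2 * #|J|%:R * (symbol (kk j) `^ t * symbol (ll j) `^ t') <= 1) ->
  (forall j, N%:R * a ^+ 2 *
     (symbol (kk j) `^ (- r1) * symbol (ll j) `^ r2) <= 4^-1) ->
  ((3 / 32 * (lam * a * #|J|%:R))%:E <= minimax_risk P u w s s' t t' rad)%E.
Proof.
move=> N1 design a0 lam0 rad0 apart hclass hlam weak.
have [psi psiP] : exists psi : 'rV[int]_dim -> dist R dim, is_wave psi.
  by case: design => _ fw _; exact: (exists_wave (fw (Ordinal N1))).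
apply: le_ereal_inf_tmp => _ [Ahat est <-].
set M := ereal_sup _.
have riskM th : (lam%:E * \sum_j entry_risk P u w psi kk ll s a Ahat th j <= M)%E.
  have h := entry_risk_le design psiP s a apart est th (ltW lam0) hlam.
  apply: (le_trans h).
  apply: ereal_sup_ubound; exists (hyp_op psi a kk ll th) => //.
  apply: (hyp_op_class psiP) => //.
  by case: apart => -[/frequencies_apart_inj]; [left|right].
have risk0 th j : (0 <= entry_risk P u w psi kk ll s a Ahat th j)%E.
  by apply: integral_ge0 => o _; rewrite lee_fin.
have M0 : (0 <= M)%E.
  by apply: (le_trans _ (riskM [ffun=> true])); rewrite mule_ge0 ?sume_ge0// lee_fin ltW.
have [Mfin|] := boolP (M \is a fin_num); last first.
  by rewrite ge0_fin_numE// -leNgt leye_eq => /eqP ->; rewrite leey.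
have riskfin th j : entry_risk P u w psi kk ll s a Ahat th j \is a fin_num.
  rewrite ge0_fin_numE// ltNge leye_eq; apply/eqP => E.
  have := riskM th; rewrite leNgt => /negP; apply.
  rewrite (bigD1 j)//= E addye; last first.
    by rewrite -ltNye (lt_le_trans (@ltNy0 R))// sume_ge0.
  by rewrite mulry gtr0_sg// mul1e ltey_eq Mfin.
rewrite -(fineK Mfin) lee_fin.
have -> : 3 / 32 * (lam * a * #|J|%:R) = lam * (3 / 16 * a / 2) * #|J|%:R by field.
apply: (@cube_average _ _ (fun th j => fine (entry_risk P u w psi kk ll s a Ahat th j))).
- exact: ltW.
- move=> th; rewrite -lee_fin fineK// EFinM -sumEFin.
  by under eq_bigr do rewrite fineK//; exact: riskM.
- move=> th j; rewrite -lee_fin EFinD !fineK//.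
  exact: (entry_two_point design psiP s a0 apart weak est).
Qed.

(** * Frequencies and rates *)

Section numerics.
Context {R : realType}.
Implicit Types (x y e p C : R).

Lemma powR_comparable_ub x y C e : 0 < y -> y <= x -> x <= C * y -> 1 <= C ->
  x `^ e <= C `^ `|e| * y `^ e.
Proof.
move=> y0 yx xC C1; have x0 := lt_le_trans y0 yx.
have C0 : 0 <= C by rewrite (le_trans ler01).
have [e0|e0] := leP 0 e.
  rewrite ger0_norm// -powRM ?(ltW y0)//.
  by apply: ge0_ler_powR; rewrite ?nnegrE ?mulr_ge0 ?(ltW y0) ?(ltW x0).
have -> : e = - `|e| by rewrite ltr0_norm// opprK.
rewrite normrN normr_id !powRN.
apply: (@le_trans _ _ (y `^ `|e|)^-1).
  rewrite lef_pV2 ?posrE ?powR_gt0//.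
  by apply: ge0_ler_powR; rewrite ?nnegrE ?(ltW y0) ?(ltW x0).
rewrite ler_peMl ?invr_ge0 ?powR_ge0//.
by rewrite -[leLHS](powRr0 C) ler_powR.
Qed.

Lemma powR_comparable_lb x y C e : 0 < y -> y <= x -> x <= C * y -> 1 <= C ->
  (C `^ `|e|)^-1 * y `^ e <= x `^ e.
Proof.
move=> y0 yx xC C1; have x0 := lt_le_trans y0 yx.
have C0 : 0 < C by rewrite (lt_le_trans ltr01).
have := powR_comparable_ub (- e) y0 yx xC C1.
rewrite normrN !powRN => h.
by rewrite -lef_pV2 ?posrE ?mulr_gt0 ?invr_gt0 ?powR_gt0// invfM invrK.
Qed.

(** [M] exceeds [N ^ p^-1 >= 1] by at most one, hence by a factor at most two. *)
Lemma resolution p (N : nat) : 0 < p -> (1 <= N)%N ->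
  exists M : nat, [/\ (0 < M)%N, N%:R <= M%:R `^ p & M%:R <= 2 * N%:R `^ p^-1 :> R].
Proof.
move=> p0 N1; set x : R := N%:R `^ p^-1.
have N1R : 1 <= N%:R :> R by rewrite ler1n.
have x1 : 1 <= x by rewrite -(powRr0 N%:R) ler_powR// invr_ge0 ltW.
have x0 : 0 <= x by rewrite (le_trans ler01).
exists (Num.truncn x).+1; split => //.
  have -> : N%:R = x `^ p by rewrite -powRrM mulVf ?gt_eqF// powRr1.
  by apply: ge0_ler_powR; rewrite ?nnegrE// ?ltW// truncnS_gt.
rewrite -natr1; have := truncn_le x; rewrite x0; lra.
Qed.

End numerics.

Section frequency_box.
Context {R : realType} {d : nat}.
Hypothesis d0 : (0 < d)%N.
Variable M : nat.
Hypothesis M0 : (0 < M)%N.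

(** All coordinates are positive, so that no two of these frequencies are
    opposite. *)
Definition box_freq (j : {ffun 'I_d -> 'I_M}) : 'rV[int]_d :=
  \row_i Posz (M + j i).

Lemma box_freq_apart : frequencies_apart box_freq.
Proof.
move=> i j ij; split.
  apply: contra ij => /eqP/rowP E; apply/eqP/ffunP => x; apply/val_inj.
  by have := E x; rewrite !mxE => -[] /addnI.
have pos (k : {ffun 'I_d -> 'I_M}) : 0 < Posz (M + k (Ordinal d0)).
  by rewrite ltz_nat addn_gt0 M0.
apply/eqP => /rowP /(_ (Ordinal d0)); rewrite !mxE => E.
by have := pos i; rewrite E oppr_gt0 ltNge ltW.
Qed.

Definition box_ratio : R := 1 + 16 * pi ^+ 2 * d%:R.

Lemma box_ratio_ge1 : 1 <= box_ratio.
Proof. by rewrite lerDl !mulr_ge0 ?pi_ge0. Qed.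

Lemma box_symbol_ge j : M%:R ^+ 2 <= symbol (box_freq j) :> R.
Proof.
rewrite /symbol; set S := \sum_i _.
have S1 : M%:R ^+ 2 <= S.
  rewrite /S (bigD1 (Ordinal d0))//= mxE -[leLHS]addr0 lerD//.
    by rewrite ler_pXn2r ?nnegrE ?ler0n// -pmulrn ler_nat leq_addr.
  by rewrite sumr_ge0// => i _; exact: sqr_ge0.
have pi2 : 1 <= pi ^+ 2 :> R.
  by rewrite expr_ge1 ?pi_ge0// (le_trans _ (pi_ge2 R))// ler1n.
have M2 : 0 <= M%:R ^+ 2 :> R by exact: sqr_ge0.
nra.
Qed.

Lemma box_symbol_le j : symbol (box_freq j) <= box_ratio * M%:R ^+ 2 :> R.
Proof.
rewrite /symbol /box_ratio; set S := \sum_i _.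
have S1 : S <= d%:R * (4 * M%:R ^+ 2).
  rewrite -[d in d%:R]card_ord mulr_natl -sumr_const; apply: ler_sum => i _.
  rewrite mxE -pmulrn (_ : 4 * _ = (M + M)%:R ^+ 2); last by rewrite natrD; ring.
  by rewrite ler_pXn2r ?nnegrE ?ler0n// ler_nat leq_add2l ltnW.
have M1 : 1 <= M%:R ^+ 2 :> R by rewrite expr_ge1// ler1n.
have pi2 : 0 <= pi ^+ 2 :> R by exact: sqr_ge0.
have h := ler_wpM2l pi2 S1; nra.
Qed.

Lemma box_symbol_ub e j :
  symbol (box_freq j) `^ e <= box_ratio `^ `|e| * M%:R `^ (2 * e) :> R.
Proof.
rewrite powRrM powR_mulrn//; apply: powR_comparable_ub.
- by rewrite exprn_gt0// ltr0n.
- exact: box_symbol_ge.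
- exact: box_symbol_le.
- exact: box_ratio_ge1.
Qed.

Lemma box_symbol_lb e j :
  (box_ratio `^ `|e|)^-1 * M%:R `^ (2 * e) <= symbol (box_freq j) `^ e :> R.
Proof.
rewrite powRrM powR_mulrn//; apply: powR_comparable_lb.
- by rewrite exprn_gt0// ltr0n.
- exact: box_symbol_ge.
- exact: box_symbol_le.
- exact: box_ratio_ge1.
Qed.

Lemma card_box : #|{: {ffun 'I_d -> 'I_M}}|%:R = M%:R `^ d%:R :> R.
Proof. by rewrite card_ffun !card_ord natrX powR_mulrn. Qed.

End frequency_box.

(** With [M ^ d] frequencies of size [M] the class allows entries of size
    [M ^ (s - d / 2)] and the loss weighs them by [M ^ (- t - d / 2)]; the data
    do not determine their signs as long as [N <= M ^ (2 (r - s) + d)]. *)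
Lemma box_rate {R : realType} (d : nat) (s t r rad : R) : (0 < d)%N -> 0 < rad ->
  0 < 2 * (r - s) + d%:R -> s < t ->
  exists2 c : R, 0 < c & forall N : nat, (1 <= N)%N ->
  exists (M : nat) (a lam : R), [/\ 0 <= a /\ 0 < lam,
    @frequencies_apart d {ffun 'I_d -> 'I_M} (@box_freq d M),
    forall j, #|{: {ffun 'I_d -> 'I_M}}|%:R * a ^+ 2 <= rad ^+ 2 * symbol (@box_freq d M j) `^ s,
    forall j, lam ^+ 2 * #|{: {ffun 'I_d -> 'I_M}}|%:R * symbol (@box_freq d M j) `^ t <= 1
    & (forall j, N%:R * a ^+ 2 * symbol (@box_freq d M j) `^ (- r) <= 4^-1) /\
      c * N%:R `^ (- ((t - s) / (2 * (r - s) + d%:R))) <=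
        3 / 32 * (lam * a * #|{: {ffun 'I_d -> 'I_M}}|%:R)].
Proof.
move=> d0 rad0 p0 st; set p := 2 * (r - s) + d%:R in p0 *.
have B1 := @box_ratio_ge1 R d; set B := box_ratio in B1.
(* [E] bounds the ratios of the powers of the symbol to those of [M ^+ 2] *)
pose E := B `^ (`|s| + `|t| + `|r|).
have BE e : `|e| <= `|s| + `|t| + `|r| -> B `^ `|e| <= E by move=> h; rewrite /E ler_powR.
have E1 : 1 <= E by rewrite -[leLHS](powRr0 B) ler_powR// !addr_ge0.
have E0 : 0 < E by rewrite (lt_le_trans ltr01).
(* [q <= rad] serves the class and [q <= 2^-1] the size of the signal *)
pose q := Num.min rad 2^-1.
have q0 : 0 < q by rewrite lt_min rad0/= invr_gt0.
have qrad : q ^+ 2 <= rad ^+ 2 by rewrite ler_pXn2r ?nnegrE ?(ltW q0) ?(ltW rad0)// ge_min lexx.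
have q4 : q ^+ 2 <= 4^-1.
  rewrite (_ : 4^-1 = 2^-1 ^+ 2); last by field.
  by rewrite ler_pXn2r ?nnegrE ?invr_ge0 ?(ltW q0)// ge_min lexx orbT.
exists (3 / 32 * (q / E ^+ 2) * 2 `^ (s - t)).
  by rewrite !mulr_gt0 ?powR_gt0 ?invr_gt0 ?exprn_gt0.
move=> N N1; have [M [M0 NM M2]] := resolution p0 N1.
set m : R := M%:R in NM M2 *.
have m0 : 0 < m by rewrite ltr0n.
have mD x y : m `^ (x + y) = m `^ x * m `^ y by rewrite powRD// (gt_eqF m0) implybT.
have msq x : (m `^ x) ^+ 2 = m `^ (2 * x) by rewrite mulrC powRrM powR_mulrn ?powR_ge0.
have up e j : `|e| <= `|s| + `|t| + `|r| ->
    symbol (@box_freq d M j) `^ e <= E * m `^ (2 * e).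
  move=> h; apply: le_trans (box_symbol_ub d0 M0 e j) _.
  by rewrite ler_wpM2r ?powR_ge0 ?BE.
have lo e j : `|e| <= `|s| + `|t| + `|r| ->
    E^-1 * m `^ (2 * e) <= symbol (@box_freq d M j) `^ e.
  move=> h; apply: le_trans (box_symbol_lb d0 M0 e j).
  by rewrite ler_wpM2r ?powR_ge0// lef_pV2 ?posrE ?powR_gt0 ?BE// (lt_le_trans ltr01).
have EVle1 : E^-1 <= 1 by rewrite invf_le1.
have EV0 : 0 < E^-1 by rewrite invr_gt0.
exists M, (q / E * m `^ (s - d%:R / 2)), (E^-1 * m `^ (- t - d%:R / 2)).
rewrite card_box -/m; split.
- by rewrite !mulr_ge0 ?mulr_gt0 ?powR_gt0 ?powR_ge0 ?(ltW q0) ?(ltW EV0).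
- exact: box_freq_apart.
- move=> j; apply: (@le_trans _ _ (rad ^+ 2 * (E^-1 * m `^ (2 * s)))); last first.
    by rewrite ler_wpM2l ?sqr_ge0// lo// -addrA lerDl addr_ge0.
  rewrite exprMn msq mulrCA -mD (_ : _ + _ = 2 * s); last by field.
  rewrite mulrA ler_wpM2r ?powR_ge0// exprMn.
  apply: ler_pM; rewrite ?sqr_ge0//.
  by rewrite expr2 ler_piMl// ltW.
- move=> j; apply: (@le_trans _ _ ((E^-1 * m `^ (- t - d%:R / 2)) ^+ 2 * m `^ d%:R *
      (E * m `^ (2 * t)))).
    rewrite ler_wpM2l ?mulr_ge0 ?powR_ge0 ?(ltW EV0)// up//.
    by rewrite addrAC lerDr addr_ge0.
  rewrite exprMn msq (_ : _ * _ * _ * _ = (E^-1 ^+ 2 * E) *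
    (m `^ (2 * (- t - d%:R / 2)) * m `^ d%:R * m `^ (2 * t))); last by ring.
  rewrite -!mD (_ : _ + _ + _ = 0); last by field.
  by rewrite powRr0 mulr1 expr2 -mulrA mulVf ?mulr1// gt_eqF.
split.
- move=> j; apply: (@le_trans _ _ (N%:R * (q / E * m `^ (s - d%:R / 2)) ^+ 2 *
      (E * m `^ (2 * - r)))).
    by rewrite ler_wpM2l ?mulr_ge0 ?powR_ge0 ?(ltW q0) ?(ltW EV0)// up// normrN lerDr addr_ge0.
  rewrite exprMn msq (_ : _ * _ * _ = (q / E) ^+ 2 * E * (N%:R *
    (m `^ (2 * (s - d%:R / 2)) * m `^ (2 * - r)))); last by ring.
  rewrite -mD (_ : _ + _ = - p); last by rewrite /p; field.
  apply: (@le_trans _ _ ((q / E) ^+ 2 * E * 1)).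
    rewrite ler_wpM2l ?mulr_ge0 ?(ltW q0) ?(ltW EV0) ?(ltW E0)//.
    by rewrite powRN ler_pdivrMr ?powR_gt0// mul1r.
  rewrite mulr1 (_ : _ * E = q ^+ 2 * E^-1); last by field; rewrite gt_eqF.
  by apply: le_trans q4; rewrite ler_piMr ?sqr_ge0.
have -> : E^-1 * m `^ (- t - d%:R / 2) * (q / E * m `^ (s - d%:R / 2)) * m `^ d%:R =
    q / E ^+ 2 * m `^ (s - t).
  transitivity (q / E ^+ 2 *
    (m `^ (- t - d%:R / 2) * m `^ (s - d%:R / 2) * m `^ d%:R)).
    by field; rewrite gt_eqF.
  by rewrite -!mD (_ : _ + _ + _ = s - t)//; field.
rewrite -[leLHS]mulrA [leRHS]mulrA ler_wpM2l ?mulr_ge0 ?invr_ge0 ?mulr_ge0 ?(ltW E0) ?(ltW q0)//.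
have -> : N%:R `^ (- ((t - s) / p)) = (N%:R `^ p^-1) `^ (s - t) :> R.
  by rewrite -powRrM; congr (_ `^ _); field; rewrite gt_eqF.
rewrite -powRM ?powR_ge0//.
rewrite -(opprB t s) !powRN lef_pV2 ?posrE ?powR_gt0//; last first.
  by rewrite (lt_le_trans m0).
by apply: ge0_ler_powR; rewrite ?nnegrE ?subr_ge0 ?(ltW st) ?(ltW m0)// (le_trans (ltW m0)).
Qed.

Section rate.
Context {R : realType} (d : nat) (s s' r1 r2 t t' : R).
Local Notation p1 := (2 * (r1 - s) + d%:R).
Local Notation p2 := (2 * (- r2 - s') + d%:R).

Lemma rate_exponent_cases : s' < t' ->
  [\/ rate_exponent d s s' r1 r2 t t' = 2^-1,
      rate_exponent d s s' r1 r2 t t' = (t - s) / p1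
    | 0 < p2 /\ rate_exponent d s s' r1 r2 t t' = (t' - s') / p2].
Proof.
move=> st; rewrite /rate_exponent.
have [p0|p0] := ltP 0 p2.
  rewrite inver gt_eqF// -EFinM /Order.min; case: ifP => _; first by constructor 1.
  by case: ifP => _; [constructor 2|constructor 3].
rewrite inver eqxx gt0_muley ?lte_fin ?subr_gt0//.
rewrite /Order.min ltry /=; case: ifP => _; first by constructor 1.
by constructor 2.
Qed.

End rate.

(** * The three rates *)

Section rates.
Context {R : realType} (d : nat).
Variables (s s' r1 r2 t t' rad : R).
Hypothesis rad0 : 0 < rad.

Definition has_rate (e : R) := exists2 c : R, 0 < c &
  forall (N : nat) (disp : measure_display) (T : measurableType disp)
    (P : probability T R) (u w : 'I_N -> T -> dist R d),
    (1 <= N)%N -> iid_gaussian_design P r1 r2 u w ->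
    ((c * N%:R `^ (- e))%:E <= minimax_risk P u w s s' t t' rad)%E.

(** Even if a single coefficient is unknown, on the constant mode, a change of
    order [N ^ (- 1 / 2)] of its value is hidden by the noise of [N] data. *)
Lemma parametric_rate : has_rate 2^-1.
Proof.
pose q := Num.min rad 2^-1.
have q0 : 0 < q by rewrite lt_min rad0/= invr_gt0.
have qrad : q <= rad by rewrite ge_min lexx.
have q2 : q <= 2^-1 by rewrite ge_min lexx orbT.
exists (3 / 32 * q); first by rewrite !mulr_gt0// invr_gt0.
move=> N disp T P u w N1 design.
have N0 : 0 < N%:R :> R by rewrite ltr0n.
set x : R := N%:R `^ (- 2^-1).
have x0 : 0 <= x by exact: powR_ge0.
have x2 : x ^+ 2 = N%:R^-1.
  by rewrite -powR_mulrn// -powRrM mulNr mulVf// powR_inv1// ltW.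
have x2le : x ^+ 2 <= 1 by rewrite x2 invf_le1// ler1n.
have q2le : q ^+ 2 <= rad ^+ 2 by rewrite ler_pXn2r ?nnegrE ?(ltW q0) ?(ltW rad0).
have q4 : q ^+ 2 <= 4^-1.
  rewrite (_ : 4^-1 = 2^-1 ^+ 2); last by field.
  by rewrite ler_pXn2r ?nnegrE ?invr_ge0 ?(ltW q0).
have -> : 3 / 32 * q * x = 3 / 32 * (1 * (q * x) * #|{: unit}|%:R).
  by rewrite card_unit; ring.
have one (e e' : R) : symbol (0 : 'rV[int]_d) `^ e * symbol (0 : 'rV[int]_d) `^ e' = 1.
  by rewrite symbol0 !powR1 mulr1.
apply: (@minimax_lower _ _ _ _ _ _ _ _ _ _ r1 r2 _ _ _ _ _ _ (fun=> 0) (fun=> 0)) => //.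
- by rewrite mulr_ge0// ltW.
- by left; split=> // -[] [].
- by move=> j; rewrite one mulr1 card_unit mul1r exprMn; have := sqr_ge0 q; nra.
- by move=> j; rewrite one card_unit expr1n !mulr1.
- by move=> j; rewrite one mulr1 exprMn x2 mulrCA mulfV ?gt_eqF// mulr1.
Qed.

Hypothesis d0 : (0 < d)%N.

(** The unknown operators send many high modes to the constant mode; as the
    input is smooth, it hardly excites these modes. *)
Lemma input_rate : 0 < 2 * (r1 - s) + d%:R -> s < t ->
  has_rate ((t - s) / (2 * (r1 - s) + d%:R)).
Proof.
move=> p0 st; have [c c0 hc] := box_rate d0 rad0 p0 st.
exists c => // N disp T P u w N1 design.
have [M [a [lam [[a0 lam0] apart hclass hlam [weak rate]]]]] := hc N N1.
apply: (@le_trans _ _ (3 / 32 * (lam * a * #|{: {ffun 'I_d -> 'I_M}}|%:R))%:E).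
  by rewrite lee_fin.
apply: (@minimax_lower _ _ _ _ _ _ _ _ _ _ r1 r2 _ _ _ _ _ _ (@box_freq d M) (fun=> 0)) => //.
- by left.
- by move=> j; rewrite symbol0 powR1 mulr1.
- by move=> j; rewrite symbol0 powR1 mulr1.
- by move=> j; rewrite symbol0 powR1 mulr1.
Qed.

(** The unknown operators send the constant mode to many high modes, where the
    signal is hidden by the noise. *)
Lemma noise_rate : 0 < 2 * (- r2 - s') + d%:R -> s' < t' ->
  has_rate ((t' - s') / (2 * (- r2 - s') + d%:R)).
Proof.
move=> p0 st; have [c c0 hc] := box_rate d0 rad0 p0 st.
exists c => // N disp T P u w N1 design.
have [M [a [lam [[a0 lam0] apart hclass hlam [weak rate]]]]] := hc N N1.
apply: (@le_trans _ _ (3 / 32 * (lam * a * #|{: {ffun 'I_d -> 'I_M}}|%:R))%:E).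
  by rewrite lee_fin.
apply: (@minimax_lower _ _ _ _ _ _ _ _ _ _ r1 r2 _ _ _ _ _ _ (fun=> 0) (@box_freq d M)) => //.
- by right.
- by move=> j; rewrite symbol0 powR1 mul1r.
- by move=> j; rewrite symbol0 powR1 mul1r.
- by move=> j; rewrite symbol0 powR1 mul1r -[r2]opprK.
Qed.

End rates.

Theorem proposition4p9 (R : realType) (d : nat) (s s' r1 r2 t t' rad : R)
    (hd : (1 <= d)%N) (hrad : 0 < rad) (hr1 : r1 - d%:R / 2 > s)
    (ht : s < t) (ht' : s' < t') :
  exists2 c : R, 0 < c &
    forall (N : nat) (disp : measure_display) (T : measurableType disp)
      (P : probability T R) (u w : 'I_N -> T -> dist R d),
      (1 <= N)%N -> iid_gaussian_design P r1 r2 u w ->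
      ((c * N%:R `^ (- rate_exponent d s s' r1 r2 t t'))%:E <=
        minimax_risk P u w s s' t t' rad)%E.
Proof.
have p1 : 0 < 2 * (r1 - s) + d%:R.
  by have : 0 <= d%:R :> R by []; lra.
have [->|->|[p2 ->]] := rate_exponent_cases d s r1 r2 t ht'.
- exact: parametric_rate.
- exact: input_rate.
- exact: noise_rate.
Qed.
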